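(* Let $1\le M\le n$, and let $\underline{s}\in\mathbb{R}^n$ with $s_i>-\frac32$ for $i\neq M$ and $s_M>-1$; put $s_0=s_{n+1}=0$. The mean function of the Wishart exponential family $(\tilde\gamma^{(M)}_{\underline{s},x})_{x\in Q_G}$ on $P_G$ is, for $x\in Q_G$, $$\tilde m^{(M)}_{\underline{s}}(x)=\sum_{i=1}^{M-1}(s_i+\tfrac32)(x_{\{i:i+1\}}^{-1})^0+\sum_{i=M+1}^{n}(s_i+\tfrac32)(x_{\{i-1:i\}}^{-1})^0-\sum_{i=2}^{M-1}(s_{i-1}+1)(x_{ii}^{-1})^0$$ $$\qquad-(s_{M-1}-s_M+s_{M+1}+1)(x_{MM}^{-1})^0-\sum_{i=M+1}^{n-1}(s_{i+1}+1)(x_{ii}^{-1})^0.$$ The covariance function $\tilde v(x):I_G\to Z_G$ of the Wishart exponential family on $P_G$ equals $$\tilde v(x)=\sum_{i=1}^{M-1}(s_i+\tfrac32)\,\mathbb{P}\bigl[(x_{\{i:i+1\}}^{-1})^0\bigr]+\sum_{i=M+1}^{n}(s_i+\tfrac32)\,\mathbb{P}\bigl[(x_{\{i-1:i\}}^{-1})^0\bigr]-\sum_{i=2}^{M-1}(s_{i-1}+1)\,\mathbb{P}\bigl[(x_{ii}^{-1})^0\bigr]$$ $$\qquad-(s_{M-1}-s_M+s_{M+1}+1)\,\mathbb{P}\bigl[(x_{MM}^{-1})^0\bigr]-\sum_{i=M+1}^{n-1}(s_{i+1}+1)\,\mathbb{P}\bigl[(x_{ii}^{-1})^0\bigr],$$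 where $I_G$ is identified with $Z_G$ by the trace inner product.
   Context: $G=A_n$ is the path graph $1-2-\cdots-n$ on $V=\{1,\dots,n\}$; $E=\{(i,j): |i-j|\le 1\}$. $Z_G$ is the space of real symmetric $n\times n$ matrices $y$ with $y_{ij}=0$ if $(i,j)\notin E$; $P_G$ is the set of positive definite $y\in Z_G$. $I_G$ is the dual space of $Z_G$, realised as the space of incomplete symmetric matrices $x=(x_{ij})_{(i,j)\in E}$, with $\langle x,y\rangle=\mathrm{tr}(yx)=\sum_{(i,j)\in E}y_{ij}x_{ij}$; by this trace pairing $I_G$ is identified with $Z_G$ (missing entries set to $0$). $Q_G=\{x\in I_G:\langle x,y\rangle>0\ \forall y\in\overline{P_G}\setminus\{0\}\}$. $dy$ is Lebesgue measure on $Z_G$. For $I\subset V$, a subscript $I$ denotes the submatrix with rows and columns in $I$; $\{i:j\}=\{i,\dots,j\}$; $|\cdot|$ is the determinant. For a matrix $K$ indexed by $B\subset V$, $K^0$ is the $n\times n$ matrix with $(K^0)_{ij}=K_{ij}$ if $i,j\in B$ and $0$ otherwise; $(x_{ii}^{-1})^0$ has the single nonzero entry $x_{ii}^{-1}$ at $(i,i)$. $\mathbb{P}(A)u=AuA$, with entries outside $E$ discarded. Empty sums are $0$ and empty products are $1$. $$\Delta^{(M)}_{\underline{s}}(y)=\prod_{i=1}^{M-1}|y_{\{1:i\}}|^{s_i-s_{i+1}}\;|y|^{s_M}\prod_{i=M+1}^{n}|y_{\{i:n\}}|^{s_i-s_{i-1}},\qquad y\in P_G.$$ For $x\in Q_G$,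 the Wishart distribution $\tilde\gamma^{(M)}_{\underline{s},x}$ on $P_G$ is the probability measure with density proportional to $e^{-\langle x,y\rangle}\Delta^{(M)}_{\underline{s}}(y)$ with respect to $dy$ on $P_G$. $\tilde m^{(M)}_{\underline{s}}(x)$ is its mean, and $\tilde v(x):I_G\to Z_G$ is its covariance operator, $\langle u',\tilde v(x)u\rangle=\mathrm{Cov}(\langle u,Y\rangle,\langle u',Y\rangle)$ for $Y\sim\tilde\gamma^{(M)}_{\underline{s},x}$, $u,u'\in I_G$ (equivalently minus the differential of $\tilde m^{(M)}_{\underline{s}}$ at $x$).
   Formalization: The convention s_0 = s_{n+1} = 0 is replaced by s_0 = s_{n+1} = -1; with 0 the formulas fail for M = 1 or M = n (e.g. n = M = 1 has mean (s_1+1)/x, not (s_1-1)/x), and for 1 < M < n these values do not occur. *)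

(* Defs.v *)
From HB Require Import structures.
From mathcomp Require Import all_boot all_order all_algebra.
From mathcomp Require Import all_classical all_reals all_analysis.

Set Implicit Arguments.
Unset Strict Implicit.
Unset Printing Implicit Defensive.

Import Order.TTheory GRing.Theory Num.Theory.
Import numFieldNormedType.Exports.

Local Open Scope classical_set_scope.
Local Open Scope ring_scope.

(* The sigma-algebra on matrices is the one generated by the entries, i.e. the
   Borel sigma-algebra when T is the real line. *)
Definition measure_matrix_display : measure_display -> measure_display.
Proof. exact. Qed.

Section measurable_matrix.
Context {d} {T : measurableType d} (m n : nat).

Definition matrix_cylinders : set (set 'M[T]_(m, n)) :=
  [set A | exists i j (B : set T),
     measurable B /\ A = [set y : 'M[T]_(m, n) | B (y i j)]].

Let mx_set0 : <<s matrix_cylinders >> set0.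
Proof. exact: sigma_algebra0. Qed.

Let mx_setC A : <<s matrix_cylinders >> A -> <<s matrix_cylinders >> (~` A).
Proof. exact: sigma_algebraC. Qed.

Let mx_bigcup (F : (set 'M[T]_(m, n))^nat) :
  (forall i, <<s matrix_cylinders >> (F i)) ->
  <<s matrix_cylinders >> (\bigcup_i F i).
Proof. exact: sigma_algebra_bigcup. Qed.

HB.instance Definition _ := @isMeasurable.Build (measure_matrix_display d)
  'M[T]_(m, n) <<s matrix_cylinders >> mx_set0 mx_setC mx_bigcup.

End measurable_matrix.

Lemma measurable_fun_matrix d d' (S : measurableType d) (T : measurableType d')
    (m n : nat) (f : S -> 'M[T]_(m, n)) :
  (forall i j, measurable_fun [set: S] (fun a => f a i j)) ->
  measurable_fun [set: S] f.
Proof.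
move=> mf; apply: (@measurability _ _ _ _ _ _ (@matrix_cylinders _ T m n)) => //.
move=> _ [_ [i [j [B [mB ->]]]] <-].
exact: mf.
Qed.

Section tuple_lebesgue.
Context {R : realType}.

Definition tuple_cons n (p : R * n.-tuple R) : n.+1.-tuple R :=
  [tuple of p.1 :: p.2].

Definition tuple_uncons n (t : n.+1.-tuple R) : R * n.-tuple R :=
  (thead t, [tuple of behead t]).

Lemma tuple_consK n : cancel (@tuple_cons n) (@tuple_uncons n).
Proof.
move=> [a t]; rewrite /tuple_uncons /tuple_cons theadE; congr (_, _).
by apply: val_inj.
Qed.

Lemma measurable_tuple_cons n : measurable_fun setT (@tuple_cons n).
Proof. exact: measurable_cons. Qed.

Lemma measurable_tuple_uncons n : measurable_fun setT (@tuple_uncons n).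
Proof.
apply/measurable_fun_pair; first exact: measurable_tnth.
exact: measurable_behead.
Qed.

Section step.
Variables (n : nat) (mu : {sigma_finite_measure set (n.-tuple R) -> \bar R}).

Definition tuple_lebesgueS : set (n.+1.-tuple R) -> \bar R :=
  pushforward (lebesgue_measure \x mu)%E (@tuple_cons n).

Let tuple_lebesgueS0 : tuple_lebesgueS set0 = 0%E.
Proof. by rewrite /tuple_lebesgueS /pushforward preimage_set0 measure0. Qed.

Let tuple_lebesgueS_ge0 A : (0 <= tuple_lebesgueS A)%E.
Proof. by have mf := @measurable_tuple_cons n; exact: measure_ge0. Qed.

Let tuple_lebesgueS_sigma_additive : semi_sigma_additive tuple_lebesgueS.
Proof.
by have mf := @measurable_tuple_cons n; exact: measure_semi_sigma_additive.
Qed.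

HB.instance Definition _ := isMeasure.Build _ _ _ tuple_lebesgueS
  tuple_lebesgueS0 tuple_lebesgueS_ge0 tuple_lebesgueS_sigma_additive.

Let tuple_lebesgueS_sigma_finite : sigma_finite setT tuple_lebesgueS.
Proof.
have /sigma_finiteP[F [TF ndF Foo]] := sigma_finiteT (@lebesgue_measure R).
have /sigma_finiteP[G [TG ndG Goo]] := sigma_finiteT mu.
exists (fun k => @tuple_uncons n @^-1` (F k `*` G k)).
  rewrite -preimage_bigcup -[LHS](preimage_setT (@tuple_uncons n)).
  congr (_ @^-1` _); apply/seteqP; split => // -[a t] _.
  have [i _ Fi] : (\bigcup_i F i) a by rewrite -TF.
  have [j _ Gj] : (\bigcup_i G i) t by rewrite -TG.
  exists (maxn i j) => //; split => /=.
    by move: a Fi; exact/subsetPset/ndF/leq_maxl.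
  by move: t Gj; exact/subsetPset/ndG/leq_maxr.
move=> k; have [mF Fk] := Foo k; have [mG Gk] := Goo k; split.
  rewrite -[X in measurable X]setTI; apply: measurable_tuple_uncons => //.
  exact: measurableX.
rewrite /tuple_lebesgueS /pushforward -comp_preimage.
rewrite (_ : _ \o _ = id) ?preimage_id; last exact/funext/tuple_consK.
by rewrite product_measure1E// lte_mul_pinfty// ge0_fin_numE.
Qed.

HB.instance Definition _ := Measure_isSigmaFinite.Build _ _ _ tuple_lebesgueS
  tuple_lebesgueS_sigma_finite.

End step.

Fixpoint tuple_lebesgue n : {sigma_finite_measure set (n.-tuple R) -> \bar R} :=
  if n is m.+1 then tuple_lebesgueS (tuple_lebesgue m) else dirac [tuple].

End tuple_lebesgue.

(* Vertices are 'I_n, the vertex of value k standing for k + 1. Elements of Z_G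
   and of I_G are both represented by full matrices vanishing off E. *)
Section path_graph.
Context {R : realType} (n : nat).
Implicit Types (x y u : 'M[R]_n) (i j k : nat).

Definition path_edge (a b : 'I_n) : bool := (a <= b.+1)%N && (b <= a.+1)%N.

Definition ZG : set 'M[R]_n :=
  [set y | y^T = y /\ forall a b, ~~ path_edge a b -> y a b = 0].

Definition PG : set 'M[R]_n :=
  [set y | ZG y /\
     forall v : 'rV[R]_n, v != 0 -> 0 < (v *m y *m v^T) ord0 ord0].

Definition mx_pairing x y : R := \tr (y *m x).

Definition QG : set 'M[R]_n :=
  [set x | ZG x /\ forall y, closure PG y -> y <> 0 -> 0 < mx_pairing x y].

Definition path_mx (p : n.-tuple R * n.-1.-tuple R) : 'M[R]_n :=
  \matrix_(a, b) if a == b then p.1`_a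
                 else if b == a.+1 :> nat then p.2`_a
                 else if a == b.+1 :> nat then p.2`_b
                 else 0.

Lemma measurable_path_mx : measurable_fun setT path_mx.
Proof.
have mnth m (t : nat) :
    measurable_fun [set: m.-tuple R] (fun v : m.-tuple R => v`_t).
  case: (ltnP t m) => tm.
    rewrite (_ : (fun _ => _) = (@tnth m R ^~ (Ordinal tm))).
      exact: measurable_tnth.
    by apply/funext => v; rewrite (tnth_nth 0).
  rewrite (_ : (fun _ => _) = cst 0) //.
  by apply/funext => v; rewrite nth_default// size_tuple.
apply: measurable_fun_matrix => a b.
rewrite (_ : (fun p => path_mx p a b) = fun p =>
    if a == b then p.1`_a else if b == a.+1 :> nat then p.2`_a
    else if a == b.+1 :> nat then p.2`_b else 0); last first.
  by apply/funext => p; rewrite mxE.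
case: (a == b); first exact: (measurableT_comp (mnth _ a) measurable_fst).
case: (_ == a.+1); first exact: (measurableT_comp (mnth _ a) measurable_snd).
case: (_ == b.+1); first exact: (measurableT_comp (mnth _ b) measurable_snd).
exact: measurable_cst.
Qed.

(* Lebesgue measure on Z_G in the coordinates (y_{ii})_i, (y_{i,i+1})_i, seen
   as a measure on all matrices that is concentrated on Z_G. *)
Definition ZG_lebesgue : set 'M[R]_n -> \bar R :=
  pushforward (tuple_lebesgue n \x tuple_lebesgue n.-1)%E path_mx.

Let ZG_lebesgue0 : ZG_lebesgue set0 = 0%E.
Proof. by rewrite /ZG_lebesgue /pushforward preimage_set0 measure0. Qed.

Let ZG_lebesgue_ge0 A : (0 <= ZG_lebesgue A)%E.
Proof. by have mf := measurable_path_mx; exact: measure_ge0. Qed.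

Let ZG_lebesgue_sigma_additive : semi_sigma_additive ZG_lebesgue.
Proof.
by have mf := measurable_path_mx; exact: measure_semi_sigma_additive.
Qed.

HB.instance Definition _ := isMeasure.Build _ _ _ ZG_lebesgue
  ZG_lebesgue0 ZG_lebesgue_ge0 ZG_lebesgue_sigma_additive.

(* {i:j}; here and below, nat indices count vertices from 1. *)
Definition seg i j : {set 'I_n} := [set a : 'I_n | (i <= a.+1 <= j)%N].

Definition principal_submx (I : {set 'I_n}) y : 'M[R]_#|I| :=
  mxsub enum_val enum_val y.

(* K^0: the zero extension of a matrix indexed by I. *)
Definition ext0 (I : {set 'I_n}) (K : 'M[R]_#|I|) : 'M[R]_n :=
  \sum_(a < #|I|) \sum_(b < #|I|) K a b *: delta_mx (enum_val a) (enum_val b).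

(* (x_{{i:j}}^{-1})^0; for i = j this is (x_{ii}^{-1})^0. *)
Definition seg_inv i j x : 'M[R]_n :=
  ext0 (invmx (principal_submx (seg i j) x)).

Definition seg_minor i j y : R := \det (principal_submx (seg i j) y).

(* P(A)u, entries outside E being discarded. *)
Definition quadrep (A u : 'M[R]_n) : 'M[R]_n :=
  \matrix_(a, b) if path_edge a b then (A *m u *m A) a b else 0.

(* Delta^(M)_s; on P_G all the determinants are positive. *)
Definition gpower (M : nat) (s : nat -> R) y : R :=
  (\prod_(1 <= i < M) seg_minor 1 i y `^ (s i - s i.+1)) *
  \det y `^ s M *
  (\prod_(M.+1 <= i < n.+1) seg_minor i n y `^ (s i - s i.-1)).

(* As P has total mass 1, the constant c is the inverse of the integral of the
   density over P_G, which is therefore positive and finite. *)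
Definition is_wishart (M : nat) (s : nat -> R) x
    (P : probability 'M[R]_n R) : Prop :=
  exists c : R, forall A, measurable A ->
    P A = (c%:E * \int[ZG_lebesgue]_(y in A `&` PG)
                     (expR (- mx_pairing x y) * gpower M s y)%:E)%E.

(* Equality with a finite number in \bar R forces the entries to be integrable. *)
Definition is_mean (P : probability 'M[R]_n R) (m : 'M[R]_n) : Prop :=
  forall a b, ('E_P[fun y : 'M[R]_n => (y a b : R)] = (m a b)%:E)%E.

(* Z_G and I_G being identified through the trace pairing, v : I_G -> Z_G is
   characterised by its values on Z_G. *)
Definition is_covariance (P : probability 'M[R]_n R)
    (v : 'M[R]_n -> 'M[R]_n) : Prop :=
  (forall u, ZG u -> ZG (v u)) /\
  forall u u', ZG u -> ZG u' ->
    covariance P (mx_pairing u) (mx_pairing u') = (mx_pairing u' (v u))%:E.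

End path_graph.

(* Main.v *)
Require Import Defs.
From HB Require Import structures.
From mathcomp Require Import all_boot all_order all_algebra.
From mathcomp Require Import all_classical all_reals all_analysis.
From mathcomp Require Import measurable_realfun ring lra zify.

Set Implicit Arguments.
Unset Strict Implicit.
Unset Printing Implicit Defensive.

Import Order.TTheory GRing.Theory Num.Theory.
Import numFieldNormedType.Exports.

Local Open Scope classical_set_scope.
Local Open Scope ring_scope.

(** The density of the Wishart law factorises once the vertices of the path are
eliminated from both ends towards M.  Write [a] and [b] for the diagonal and the
off-diagonal of y, and let p_i be the pivot met at vertex i: p_i is
|y_{1:i}| / |y_{1:i-1}| for i < M, |y_{i:n}| / |y_{i+1:n}| for i > M, and
|y| over the product of the two outer minors for i = M.

- y is positive definite iff all p_i are positive ([pivots_pos_posdef]);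
- Delta_s(y) is the product of the p_i^{s_i}, since the exponents
  s_i - s_{i+1} and s_i - s_{i-1} telescope ([band_powerS], [band_power0S]);
- <x, y> is the sum of the x_ii p_i and, for each edge {i, j} with j the end
  nearer to M, of x_jj b^2 / p_i + 2 x_ij b, where b = y_ij
  ([band_pairing_schur]);
- passing from the diagonal of y to the pivots is a composition of
  translations of one coordinate, so that it preserves Lebesgue measure.

Given p_i, the integral in b is Gaussian and contributes
sqrt (pi p_i / x_jj) exp (x_ij^2 p_i / x_jj); what remains in p_i is a Gamma
integral of exponent s_i + 1/2 and rate |x_{i,j}| / x_jj.  Hence every edge
contributes a constant times
x_jj^{s_i + 1} |x_{i,j}|^{-(s_i + 3/2)}, and the last pivot a constant times
x_MM^{-(s_M + 1)} ([band_integral_density]).  The bounds on s are the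
convergence of these Gamma integrals, and a point of Q_G satisfies the
inequalities x_ii > 0 and |x_{i,i+1}| > 0 that they require
([QG_cliques_pos]).  The normalising integral Z(x) is therefore finite and
positive, and - log Z(x) is, up to an additive constant, a linear combination
([wishart_comb]) of the log x_ii and the log |x_{i,i+1}|, with the coefficients of
the theorem ([band_logE], [wishart_combE]).

Under the law of parameter x, exp (t <u, Y>) has expectation Z(x - t u) / Z(x).
Differentiating log Z(x - t u) twice at t = 0 gives the mean and the variance of
<u, Y>; the moments are recovered from the moment generating function by
differentiation under the integral sign ([mgf_expectation],
[mgf_expectation_sqr]).  For a clique I of the path, the derivatives of
- log |x_I - t u_I| are <u, (x_I^{-1})^0> and then <u, P[(x_I^{-1})^0] u>
([mx_pairing_seg_inv2], [mx_pairing_quadrep_seg_inv2]), so that the same linear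
combination turns into the announced mean and covariance.  Polarisation gives the
covariance of two linear forms ([wishart_is_covariance]).

Throughout, indices count from 0, M is k + 1 and n is k + m + 1; a matrix of Z_G
is handled through two sequences [a] and [b], extended by 0, and
[al], [be] and [ua], [ub] play this part for x and for u. *)

(** * Gaussian and Gamma integrals on the line *)

Section line.
Context {R : realType}.
Local Notation leb := (@lebesgue_measure R).

(** The measure structure is made explicit so that a pushforward can be integrated
against for a given proof of measurability. *)
Definition image_measure d d' (T1 : measurableType d) (T2 : measurableType d')
    (m : {measure set T1 -> \bar R}) (f : T1 -> T2)
    (mf : measurable_fun [set: T1] f) : {measure set T2 -> \bar R} :=
  measure_function_pushforward__canonical__measure_function_Measure m mf.

Lemma ge0_integral_translate (f : R -> \bar R) (c : R) :
  measurable_fun [set: R] f -> (forall r, 0 <= f r)%E ->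
  (\int[leb]_r f (r - c)%R = \int[leb]_r f r)%E.
Proof.
move=> mf f0; pose phi : R -> measurableTypeR R := fun r => r - c.
have mphi : measurable_fun [set: measurableTypeR R] phi by apply: measurable_funB.
have muE A : measurable A -> image_measure leb mphi A = leb A.
  move=> mA; apply/esym/lebesgue_measure_unique => //= _ [[a b]] _ <-.
  rewrite /pushforward (_ : phi @^-1` _ = `]a + c, b + c]%classic).
    rewrite !lebesgue_measure_itv/= !lte_fin ltrD2r; case: ifP => // _.
    by rewrite -!EFinB; congr EFin; ring.
  by apply/seteqP; split => r /=; rewrite !in_itv/= /phi ltrBrDr lerBlDr.
transitivity (\int[image_measure leb mphi]_r f r)%E.
  by rewrite ge0_integral_pushforward.
by apply: eq_measure_integral => //= A mA _; exact: muE.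
Qed.

Lemma ge0_integral_dilate (f : R -> \bar R) (k : R) : 0 < k ->
  measurable_fun [set: R] f -> (forall r, 0 <= f r)%E ->
  (\int[leb]_r f (k * r)%R = k^-1%:E * \int[leb]_r f r)%E.
Proof.
move=> k0 mf f0; pose phi : R -> measurableTypeR R := fun r => k * r.
have mphi : measurable_fun [set: measurableTypeR R] phi by apply: measurable_funM.
have k0' : 0 <= k by exact: ltW.
have muE A : measurable A -> mscale (NngNum k0') (image_measure leb mphi) A = leb A.
  move=> mA; apply/esym/lebesgue_measure_unique => //= _ [[a b]] _ <-.
  rewrite /mscale/= /pushforward.
  rewrite (_ : phi @^-1` _ = `]k^-1 * a, k^-1 * b]%classic).
    rewrite !lebesgue_measure_itv/= !lte_fin ltr_pM2l ?invr_gt0//.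
    case: ifPn => _; last by rewrite mule0.
    by rewrite -!EFinB -EFinM -mulrBr mulrA mulfV ?mul1r ?gt_eqF.
  apply/seteqP; split => r /=; rewrite !in_itv/= /phi.
    by rewrite ltr_pdivrMl// ler_pdivlMl.
  by rewrite ltr_pdivrMl// ler_pdivlMl.
transitivity (\int[image_measure leb mphi]_r f r)%E.
  by rewrite ge0_integral_pushforward.
have <- : (\int[mscale (NngNum k0') (image_measure leb mphi)]_r f r =
    \int[leb]_r f r)%E.
  by apply: eq_measure_integral => //= A mA _; exact: muE.
have -> := @ge0_integral_mscale _ _ _ (image_measure leb mphi) setT measurableT
  (NngNum k0') f mf (fun r _ => f0 r).
by rewrite /= muleA -EFinM mulVf ?mul1e// gt_eqF.
Qed.

(** Completing the square: the integrand is a multiple of the normal density of mean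
[- (B * d / A)] and variance [d / (2 * A)]. *)
Lemma integral_gauss_quadratic (A B d : R) : 0 < A -> 0 < d ->
  (\int[leb]_b (expR (- (A * b ^+ 2 / d) - 2 * B * b))%:E =
    (Num.sqrt (pi * d / A) * expR (B ^+ 2 * d / A))%:E)%E.
Proof.
move=> A0 d0; pose m : R := - (B * d / A); pose g : R := Num.sqrt (d / (2 * A)).
have g0 : g != 0 by rewrite gt_eqF// sqrtr_gt0 divr_gt0// mulr_gt0.
have g2 : g ^+ 2 = d / (2 * A) by rewrite sqr_sqrtr// ltW// divr_gt0// mulr_gt0.
have pE : Num.sqrt (g ^+ 2 * pi *+ 2) = Num.sqrt (pi * d / A).
  by congr Num.sqrt; rewrite g2 -mulr_natr; field; rewrite gt_eqF.
have p0 : 0 < Num.sqrt (pi * d / A).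
  by rewrite sqrtr_gt0 divr_gt0// mulr_gt0// pi_gt0.
transitivity (\int[leb]_b ((Num.sqrt (pi * d / A) * expR (B ^+ 2 * d / A))%:E *
   (normal_pdf m g b)%:E))%E.
  apply: eq_integral => b _; rewrite -EFinM normal_pdfE// /normal_peak /normal_fun.
  rewrite pE mulrACA mulfV ?gt_eqF// mul1r -expRD g2 /m.
  congr (expR _)%:E; rewrite -mulr_natr; field.
  by rewrite !gt_eqF.
rewrite ge0_integralZl//=.
- by rewrite integral_normal_pdf mule1.
- by apply/measurable_EFinP; exact: measurable_normal_pdf.
- by move=> x _; rewrite lee_fin normal_pdf_ge0.
Qed.

(** The cut-off at 0 carries the positivity of a pivot, so that the density of the
Wishart law will vanish off the cone without further restriction. *)
Definition gamma_density (q c d : R) : R :=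
  if 0 < d then d `^ q * expR (- (c * d)) else 0.

Lemma gamma_density_ge0 q c d : 0 <= gamma_density q c d.
Proof. by rewrite /gamma_density; case: ifP => // _; rewrite mulr_ge0 ?powR_ge0 ?expR_ge0. Qed.

Lemma measurable_gamma_density q c :
  measurable_fun [set: R] (gamma_density q c).
Proof.
apply: measurable_fun_ifT => //=.
  exact: measurable_fun_ltr.
apply: measurable_funM; first exact: measurable_powR.
apply: measurableT_comp => //.
by apply: measurable_funN; apply: measurable_funM.
Qed.

(** This is Gamma (q + 1). *)
Definition gamma_int (q : R) : \bar R := (\int[leb]_d (gamma_density q 1 d)%:E)%E.

Lemma integral_gamma_density q c : 0 < c ->
  (\int[leb]_d (gamma_density q c d)%:E =
   (expR (- ((q + 1) * ln c)))%:E * gamma_int q)%E.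
Proof.
move=> c0.
transitivity (\int[leb]_d ((c `^ (- q))%:E * (gamma_density q 1 (c * d))%:E))%E.
  apply: eq_integral => d _; rewrite -EFinM; congr EFin; rewrite /gamma_density.
  rewrite pmulr_rgt0//; case: ifPn => d0; last by rewrite mulr0.
  have cq : c `^ (- q) * c `^ q = 1.
    by rewrite -powRD ?addNr ?powRr0 ?(gt_eqF c0)// implybT.
  by rewrite powRM ?(ltW c0) ?(ltW d0)// !mulrA cq !mul1r.
rewrite ge0_integralZl//=.
- rewrite (@ge0_integral_dilate (EFin \o gamma_density q 1))//.
  + rewrite muleA -EFinM; congr ((_)%:E * _)%E.
    rewrite /powR gt_eqF// -{2}(lnK c0) -expRN -expRD; congr expR; ring.
  + by apply/measurable_EFinP; exact: measurable_gamma_density.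
  + by move=> r; rewrite /= lee_fin gamma_density_ge0.
- apply/measurable_EFinP; apply: (measurableT_comp (measurable_gamma_density q 1)).
  exact: measurable_funM.
- by move=> d _; rewrite lee_fin gamma_density_ge0.
- by rewrite lee_fin powR_ge0.
Qed.

(** The bound does not depend on [e], which is what the limit [e --> 0] needs. *)
Lemma integral_powR_itv q (e : R) : -1 < q -> 0 < e -> e < 1 ->
  (\int[leb]_(d in `[e, 1%R]) (d `^ q)%:E <= ((q + 1)^-1)%:E)%E.
Proof.
move=> q1 e0 e1; have q10 : 0 < q + 1 by rewrite -ltrBlDr sub0r.
have der (x : R) : 0 < x ->
    is_derive x 1 (fun x => (q + 1)^-1 * x `^ (q + 1)) (x `^ q).
  move=> x0; have := is_derive1_powR (q + 1) x0.
  rewrite addrK => /(@is_deriveZ _ _ _ _ (q + 1)^-1); rewrite /GRing.scale /=.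
  by rewrite mulrA mulVf ?mul1r// gt_eqF.
have pos x : e <= x -> 0 < x by exact: lt_le_trans.
have cpow p (x : R) : 0 < x -> {for x, continuous (fun x => x `^ p)}.
  move=> x0; apply/differentiable_continuous/derivable1_diffP.
  by have [] := is_derive1_powR p x0.
rewrite (@continuous_FTC2 _ _ (fun x => (q + 1)^-1 * x `^ (q + 1)) _ _ e1).
- by rewrite -EFinB lee_fin powR1 mulr1 gerBl mulr_ge0 ?powR_ge0// invr_ge0 ltW.
- apply: continuous_in_subspaceT => x; rewrite inE/= in_itv/= => /andP[/pos x0 _].
  exact: cpow.
- split.
  + by move=> x; rewrite in_itv/= => /andP[/ltW/pos/der[]].
  + apply: cvg_at_right_filter; apply: cvgM; first exact: cvg_cst.
    exact: cpow.
  + apply: cvg_at_left_filter; apply: cvgM; first exact: cvg_cst.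
    exact: cpow.
- by move=> x; rewrite in_itv/= => /andP[/ltW/pos/der]; rewrite derive1E => dx; rewrite derive_val.
Qed.

Lemma integral_powR_01 q : -1 < q ->
  (\int[leb]_(d in `]0%R, 1%R]) (d `^ q)%:E <= ((q + 1)^-1)%:E)%E.
Proof.
(* The sets [1 / (n + 2), 1] increase to ]0, 1] and stay away from 0, where the
   integrand may be unbounded. *)
move=> q1; pose F n : set R := `[(n.+2%:R)^-1, 1%R]%classic.
have UF : \bigcup_n F n = `]0, 1]%classic.
  apply/seteqP; split => [x [n _]|x]/=; rewrite /F /= !in_itv/=.
    by move=> /andP[nx ->]; rewrite andbT (lt_le_trans _ nx)// invr_gt0.
  move=> /andP[x0 x1]; exists (Num.truncn x^-1) => //=; rewrite in_itv/= x1 andbT.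
  rewrite invf_ple ?posrE// (le_trans (ltW (truncnS_gt _)))// ler_nat//.
have cv : (\int[leb]_(d in F n) (d `^ q)%:E)%E @[n --> \oo] -->
    (\int[leb]_(d in `]0%R, 1%R]) (d `^ q)%:E)%E.
  rewrite -UF; apply: ge0_nondecreasing_set_cvg_integral.
  - move=> m n mn; apply/subsetPset => x; rewrite /F/= !in_itv/= => /andP[mx ->].
    by rewrite andbT (le_trans _ mx)// lef_pV2 ?posrE ?ltr0n// ler_nat.
  - by move=> n; exact: measurable_itv.
  - by move=> n; apply/measurable_EFinP/measurable_funTS; exact: measurable_powR.
  - by move=> n x _; rewrite lee_fin powR_ge0.
rewrite -(cvg_lim _ cv)//; apply: lime_le; first exact: cvgP cv.
apply: nearW => n; apply: integral_powR_itv => //.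
by rewrite invf_lt1 ?ltr1n// ltr0n.
Qed.

Lemma ln_le_subr1 (x : R) : 0 < x -> ln x <= x - 1.
Proof.
by move=> x0; rewrite -[in leLHS](subrK 1 x) addrC le_ln1Dx// ltrBrDr addNr.
Qed.

(** Near 0 the exponential is at most 1; beyond 1 half of it absorbs the power, and
the other half is an exponential density up to a constant. *)
Lemma gamma_int_lty q : -1 < q -> (gamma_int q < +oo)%E.
Proof.
move=> q1; pose Q := 1 + `|q|; have Q0 : 0 < Q by rewrite ltr_pwDl.
(* ln d <= d / (2 Q) + ln (2 Q), hence d^q <= exp (Q ln d) <= K exp (d / 2). *)
pose K := expR (Q * ln (2 * Q)).
have tail d : 1 < d -> d `^ q * expR (- (1 * d)) <= K * expR (- 2^-1 * d).
  move=> d1; have d0 : 0 < d by rewrite (lt_trans ltr01).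
  have ld : ln d <= d / (2 * Q) + ln (2 * Q).
    rewrite -{1}(@mulfVK _ (2 * Q) _ d) ?gt_eqF ?mulr_gt0//.
    rewrite lnM ?posrE ?divr_gt0 ?mulr_gt0// lerD2r.
    by rewrite (le_trans (ln_le_subr1 _)) ?divr_gt0 ?mulr_gt0// gerBl.
  have lnd0 : 0 <= ln d by rewrite ln_ge0// ltW.
  rewrite /powR gt_eqF// -!expRD ler_expR.
  have h1 : q * ln d <= Q * ln d.
    by rewrite ler_wpM2r// /Q (le_trans (ler_norm _))// lerDr.
  have h2 : Q * ln d <= Q * (d / (2 * Q) + ln (2 * Q)) by rewrite ler_pM2l.
  have h3 : Q * (d / (2 * Q)) = d / 2 by field; rewrite gt_eqF.
  by rewrite mulrDr h3 in h2; lra.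
pose f1 := (fun d : R => (d `^ q)%:E) \_ (`]0, 1] : set R).
pose f2 : R -> \bar R := fun d => ((2 * K)%:E * (exponential_pdf 2^-1 d)%:E)%E.
have mf1 : measurable_fun [set: R] f1.
  apply/(measurable_restrictT _ _).1; first exact: measurable_itv.
  by apply/measurable_EFinP/measurable_funTS; exact: measurable_powR.
have mf2 : measurable_fun [set: R] f2.
  by apply: measurable_funeM; apply/measurable_EFinP; exact: measurable_exponential_pdf.
have f10 d : (0 <= f1 d)%E.
  by rewrite /f1 /patch; case: ifP => // _; rewrite lee_fin powR_ge0.
have f20 d : (0 <= f2 d)%E.
  by rewrite /f2 mule_ge0// lee_fin ?exponential_pdf_ge0// mulr_ge0// expR_ge0.
apply: (@le_lt_trans _ _ (\int[leb]_d (f1 d + f2 d))%E).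
  apply: ge0_le_integral => //=.
  - by move=> d _; rewrite lee_fin gamma_density_ge0.
  - by apply/measurable_EFinP; exact: measurable_gamma_density.
  - exact: emeasurable_funD.
  move=> d _; rewrite /gamma_density; case: ifPn => d0; last by rewrite adde_ge0.
  have [d1|d1] := leP d 1.
    rewrite -[leLHS]adde0 leeD// /f1 patchE mem_set/= ?in_itv/= ?d0//.
    by rewrite lee_fin ler_piMr ?powR_ge0// -[leRHS]expR0 ler_expR mul1r oppr_le0 ltW.
  rewrite -[leLHS]add0e leeD// /f2 -EFinM lee_fin (le_trans (tail _ d1))//.
  rewrite /exponential_pdf patchE mem_set/= ?in_itv/= ?andbT ?(ltW d0)//.
  by rewrite mulrACA mulfV// mul1r.
rewrite ge0_integralD//=.
rewrite lte_add_pinfty//.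
  rewrite /f1 -integral_mkcond (le_lt_trans (integral_powR_01 q1)) ?ltry//.
rewrite ge0_integralZl//=.
- by rewrite integral_exponential_pdf ?mule1 ?ltry.
- by apply/measurable_EFinP; exact: measurable_exponential_pdf.
- by move=> d _; rewrite lee_fin exponential_pdf_ge0.
- by rewrite lee_fin mulr_ge0// expR_ge0.
Qed.

(** On [1, 2] the integrand is bounded below by a positive constant. *)
Lemma gamma_int_gt0 q : (0 < gamma_int q)%E.
Proof.
pose k := expR (- (`|q| * ln 2)) * expR (- 2).
have k0 : 0 < k by rewrite mulr_gt0 ?expR_gt0.
apply: (@lt_le_trans _ _ (\int[leb]_(d in `[1%R, 2%R]) k%:E)%E).
  rewrite integral_cst//= lebesgue_measure_itv/= lte_fin ltr1n -EFinB -EFinM.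
  by rewrite lte_fin mulr_gt0// subr_gt0 ltr1n.
apply: (@le_trans _ _ (\int[leb]_(d in `[1%R, 2%R]) (gamma_density q 1 d)%:E)%E).
  apply: ge0_le_integral => //=.
  - by move=> d _; rewrite lee_fin ltW.
  - by apply/measurable_EFinP/measurable_funTS; exact: measurable_gamma_density.
  move=> d; rewrite in_itv/= => /andP[d1 d2]; have d0 := lt_le_trans ltr01 d1.
  rewrite lee_fin /gamma_density d0 /k ler_pM ?expR_ge0// ?ler_expR ?mul1r ?lerN2//.
  rewrite /powR gt_eqF// ler_expR -mulNr (le_trans (_ : _ <= - `|q| * ln d))//.
    by rewrite ler_wnM2l ?oppr_le0// ler_ln ?posrE.
  by rewrite ler_wpM2r ?ln_ge0// lerNl -normrN ler_norm.
apply: ge0_subset_integral => //=.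
- by apply/measurable_EFinP; exact: measurable_gamma_density.
- by move=> d _; rewrite lee_fin gamma_density_ge0.
Qed.

Lemma gamma_int_fineK q : -1 < q -> ((fine (gamma_int q))%:E = gamma_int q).
Proof. by move=> q1; rewrite fineK// ge0_fin_numE ?gamma_int_lty// ltW// gamma_int_gt0. Qed.

Lemma gamma_fine_gt0 q : -1 < q -> 0 < fine (gamma_int q).
Proof. by move=> q1; rewrite -lte_fin gamma_int_fineK// gamma_int_gt0. Qed.

(** What is left in the pivot [d] of a vertex once the entry joining it to the next
vertex has been integrated out by [integral_gauss_quadratic]. *)
Definition gauss_gamma_density (q A B A' d : R) : R :=
  Num.sqrt (pi * d / A) * expR (B ^+ 2 * d / A) * gamma_density q A' d.

Lemma gauss_gamma_densityE q A B A' d : 0 < A ->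
  gauss_gamma_density q A B A' d =
  Num.sqrt (pi / A) * gamma_density (q + 2^-1) (A' - B ^+ 2 / A) d.
Proof.
move=> A0; rewrite /gauss_gamma_density /gamma_density.
case: ifPn => d0; last by rewrite !mulr0.
have -> : Num.sqrt (pi * d / A) = Num.sqrt (pi / A) * Num.sqrt d.
  by rewrite mulrAC sqrtrM// divr_ge0 ?pi_ge0// ltW.
have -> : expR (- ((A' - B ^+ 2 / A) * d)) =
    expR (B ^+ 2 * d / A) * expR (- (A' * d)) by rewrite -expRD; congr expR; ring.
rewrite powRD ?(gt_eqF d0) ?implybT// powR12_sqrt ?ltW//; ring.
Qed.

Lemma measurable_gauss_gamma_density q A B A' :
  measurable_fun [set: R] (gauss_gamma_density q A B A').
Proof.
apply: measurable_funM; last exact: measurable_gamma_density.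
apply: measurable_funM.
  apply: (measurableT_comp (continuous_measurable_fun (@sqrt_continuous R))).
  by apply: measurable_funM => //; exact: measurable_funM.
apply: measurableT_comp => //.
by apply: measurable_funM => //; exact: measurable_funM.
Qed.

(** sqrt pi times Gamma (q + 3/2). *)
Definition block_const q : R := Num.sqrt pi * fine (gamma_int (q + 2^-1)).

Lemma block_const_gt0 q : - (3 / 2) < q -> 0 < block_const q.
Proof.
move=> q1; rewrite mulr_gt0// ?sqrtr_gt0 ?pi_gt0// gamma_fine_gt0//; lra.
Qed.

(** The contribution of one edge to the normalising integral: the factor sqrt d of the
Gaussian integral raises the exponent of the Gamma integral to q + 1/2, and
[B ^+ 2 / A] lowers its rate to [(A * A' - B ^+ 2) / A]. *)
Lemma integral_gauss_gamma_density q A B A' : - (3 / 2) < q -> 0 < A ->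
  0 < A * A' - B ^+ 2 ->
  (\int[leb]_d (gauss_gamma_density q A B A' d)%:E =
   (block_const q * expR ((q + 1) * ln A
      - (q + 3 / 2) * ln (A * A' - B ^+ 2)))%:E)%E.
Proof.
move=> q1 A0 D0; under eq_integral do rewrite gauss_gamma_densityE// EFinM.
have cE : A' - B ^+ 2 / A = (A * A' - B ^+ 2) / A by field; rewrite gt_eqF.
have c0 : 0 < A' - B ^+ 2 / A by rewrite cE divr_gt0.
rewrite ge0_integralZl//=; last 2 first.
- by apply/measurable_EFinP; exact: measurable_gamma_density.
- by move=> d _; rewrite lee_fin gamma_density_ge0.
rewrite integral_gamma_density// -gamma_int_fineK; last by lra.
rewrite -!EFinM; congr EFin; rewrite /block_const cE ln_div ?posrE//.
rewrite sqrtrM ?pi_ge0// -mulrA -[RHS]mulrA; congr (_ * _).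
rewrite mulrA mulrC; congr (_ * _).
have -> : Num.sqrt A^-1 = expR (- 2^-1 * ln A).
  by rewrite -powR12_sqrt ?invr_ge0 ?ltW// /powR invr_eq0 gt_eqF// lnV ?posrE// mulrN mulNr.
rewrite -expRD; congr expR.
by field.
Qed.

End line.

(** * Iterated integrals *)

Section product_sigma_finite.
Local Open Scope ereal_scope.
Context d1 d2 (T1 : measurableType d1) (T2 : measurableType d2) (R : realType).
Variable m1 : {sigma_finite_measure set T1 -> \bar R}.
Variable m2 : {sigma_finite_measure set T2 -> \bar R}.

(** An alias of the product measure that bears a sigma-finite structure for
arbitrary sigma-finite factors. *)
Definition sigma_finite_prod : set (T1 * T2)%type -> \bar R := m1 \x m2.

HB.instance Definition _ := Measure.on sigma_finite_prod.

Let sigma_finite_prod_sigma_finite : sigma_finite setT sigma_finite_prod.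
Proof.
have /sigma_finiteP[F [TF ndF Foo]] := sigma_finiteT m1.
have /sigma_finiteP[G [TG ndG Goo]] := sigma_finiteT m2.
exists (fun k => F k `*` G k).
  apply/seteqP; split => // -[x y] _.
  have [i _ Fi] : (\bigcup_i F i) x by rewrite -TF.
  have [j _ Gj] : (\bigcup_i G i) y by rewrite -TG.
  exists (maxn i j) => //; split => /=.
    by move: x Fi; exact/subsetPset/ndF/leq_maxl.
  by move: y Gj; exact/subsetPset/ndG/leq_maxr.
move=> k; have [mF Fk] := Foo k; have [mG Gk] := Goo k.
split; first exact: measurableX.
by rewrite /sigma_finite_prod product_measure1E// lte_mul_pinfty// ge0_fin_numE.
Qed.

HB.instance Definition _ := Measure_isSigmaFinite.Build _ _ _ sigma_finite_prod
  sigma_finite_prod_sigma_finite.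

End product_sigma_finite.

Section tonelli.
Local Open Scope ereal_scope.

Lemma tonelli3 d1 d2 d3 (X : measurableType d1) (Y : measurableType d2)
    (Z : measurableType d3) (R : realType)
    (mx : {sigma_finite_measure set X -> \bar R})
    (my : {sigma_finite_measure set Y -> \bar R})
    (mz : {sigma_finite_measure set Z -> \bar R})
    (H : X -> Y -> Z -> \bar R) :
  measurable_fun setT (fun p : X * Y * Z => H p.1.1 p.1.2 p.2) ->
  (forall x y z, 0 <= H x y z) ->
  \int[mx]_x \int[my]_y \int[mz]_z H x y z =
  \int[mz]_z \int[my]_y \int[mx]_x H x y z.
Proof.
move=> mH H0.
have mHx x : measurable_fun setT (fun p : Y * Z => H x p.1 p.2).
  apply: (measurableT_comp mH (_ : measurable_fun _ (fun p => (x, p.1, p.2)))).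
  by apply/measurable_fun_pair => //=; apply/measurable_fun_pair.
have mHz z : measurable_fun setT (fun p : X * Y => H p.1 p.2 z).
  by apply: (measurableT_comp mH (_ : measurable_fun _ (fun p => (p, z)))).
transitivity (\int[mx]_x \int[mz]_z \int[my]_y H x y z).
  apply: eq_integral => x _.
  exact: (@fubini_tonelli _ _ _ _ _ my mz (fun p => H x p.1 p.2)).
have mH' : measurable_fun setT (fun p : X * Z * Y => H p.1.1 p.2 p.1.2).
  apply: (measurableT_comp mH (_ : measurable_fun _ (fun p => (p.1.1, p.2, p.1.2)))).
  apply/measurable_fun_pair => //=; last exact: measurableT_comp.
  by apply/measurable_fun_pair => //=; exact: measurableT_comp.
have mK : measurable_fun setT (fun p : X * Z => \int[my]_y H p.1 y p.2).
  exact: (@measurable_fun_fubini_tonelli_F _ _ _ _ _ my _ mH').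
rewrite (@fubini_tonelli _ _ _ _ _ mx mz (fun p => \int[my]_y H p.1 y p.2))//=; last first.
  by move=> p; apply: integral_ge0.
apply: eq_integral => z _.
exact: (@fubini_tonelli _ _ _ _ _ mx my (fun p => H p.1 p.2 z)).
Qed.

(** Pairs the first coordinates of two products: this is what isolates the first
diagonal and the first off-diagonal entry of a band matrix. *)
Lemma tonelli4 d1 d2 d3 d4 (X : measurableType d1) (Y : measurableType d2)
    (Z : measurableType d3) (W : measurableType d4) (R : realType)
    (mx : {sigma_finite_measure set X -> \bar R})
    (my : {sigma_finite_measure set Y -> \bar R})
    (mz : {sigma_finite_measure set Z -> \bar R})
    (mw : {sigma_finite_measure set W -> \bar R})
    (H : X -> Z -> Y -> W -> \bar R) :
  measurable_fun setT
    (fun p : (X * Z) * (Y * W) => H p.1.1 p.1.2 p.2.1 p.2.2) ->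
  (forall x z y w, 0 <= H x z y w) ->
  \int[mx \x mz]_q \int[my \x mw]_r H q.1 q.2 r.1 r.2 =
  \int[mx]_x \int[my]_y \int[mz \x mw]_r H x r.1 y r.2.
Proof.
move=> mH H0.
have mH1 q : measurable_fun setT (fun r : Y * W => H q.1 q.2 r.1 r.2).
  by apply: (measurableT_comp mH (_ : measurable_fun _ (fun r => (q, r)))); apply/measurable_fun_pair.
have mI : measurable_fun setT (fun q : X * Z => \int[my \x mw]_r H q.1 q.2 r.1 r.2).
  exact: (@measurable_fun_fubini_tonelli_F _ _ _ _ _ (sigma_finite_prod my mw) _ mH).
rewrite fubini_tonelli1//=; last by move=> q; apply: integral_ge0.
apply: eq_integral => x _; rewrite /fubini_F/=.
transitivity (\int[mz]_z \int[my]_y \int[mw]_w H x z y w).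
  apply: eq_integral => z _.
  by rewrite (fubini_tonelli1 _ (mH1 (x, z)))//.
have mH3 : measurable_fun setT (fun p : Z * Y * W => H x p.1.1 p.1.2 p.2).
  apply: (measurableT_comp mH (_ : measurable_fun _ (fun p => ((x, p.1.1), (p.1.2, p.2))))).
  apply/measurable_fun_pair => //=; apply/measurable_fun_pair => //=; exact: measurableT_comp.
rewrite (@fubini_tonelli _ _ _ _ _ mz my (fun p => \int[mw]_w H x p.1 p.2 w))//=; first last.
- by move=> p; apply: integral_ge0.
- exact: (@measurable_fun_fubini_tonelli_F _ _ _ _ _ mw _ mH3).
apply: eq_integral => y _; rewrite (@fubini_tonelli1 _ _ _ _ _ mz mw)//=.
apply: (measurableT_comp mH (_ : measurable_fun _ (fun p => ((x, p.1), (y, p.2))))).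
by apply/measurable_fun_pair => //=; apply/measurable_fun_pair.
Qed.

End tonelli.

(** * Integration over diagonal and off-diagonal sequences *)

Section tuples.
Context {R : realType}.
Implicit Types (a b : nat -> R).
Local Notation tl := (@tuple_lebesgue R).
Local Notation leb := (@lebesgue_measure R).
Local Notation nth0 := (@nth R 0%R).
Local Notation seqf := ((nat -> R) -> (nat -> R) -> \bar R).

Definition scons {T : Type} (x : T) (f : nat -> T) (i : nat) : T :=
  if i is j.+1 then f j else x.

Lemma nth_tuple_cons m (x : R) (t : m.-tuple R) :
  nth0 (tuple_cons (x, t)) = scons x (nth0 t).
Proof. by apply/funext => -[]. Qed.

Lemma nth_behead_tuple m (t : m.+1.-tuple R) :
  nth0 (behead t) = fun i => nth0 t i.+1.
Proof. by apply/funext => i; rewrite nth_behead. Qed.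

(** Functions of a band matrix are taken on sequences rather than on tuples, so that
recursion on the size needs no cast; [m] is the size and the off-diagonal has
length [m.-1]. *)
Definition band_measurable m d (T : measurableType d) (F : (nat -> R) -> (nat -> R) -> T) :=
  measurable_fun setT (fun p : m.-tuple R * m.-1.-tuple R =>
    F (nth0 p.1) (nth0 p.2)).

Definition band_integral m (F : seqf) : \bar R :=
  (\int[tl m \x tl m.-1]_p F (nth0 p.1) (nth0 p.2))%E.

Lemma ge0_integral_tupleS m (G : m.+1.-tuple R -> \bar R) :
  measurable_fun setT G -> (forall t, 0 <= G t)%E ->
  (\int[tl m.+1]_t G t = \int[leb \x tl m]_q G (tuple_cons q))%E.
Proof.
move=> mG G0; rewrite /= [LHS](_ : _ =
  (\int[pushforward (leb \x tl m)%E (@tuple_cons R m)]_t G t)%E)//.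
by rewrite ge0_integral_pushforward//; exact: measurable_tuple_cons.
Qed.

Lemma measurable_nth m (i : nat) :
  measurable_fun setT (fun t : m.-tuple R => t`_i).
Proof.
case: (ltnP i m) => im.
  rewrite (_ : (fun _ => _) = (@tnth m R ^~ (Ordinal im))).
    exact: measurable_tnth.
  by apply/funext => v; rewrite (tnth_nth 0).
rewrite (_ : (fun _ => _) = cst 0) //.
by apply/funext => v; rewrite nth_default// size_tuple.
Qed.

Lemma measurable_cons_band m :
  measurable_fun setT (fun p : (R * R) * (m.+1.-tuple R * m.-tuple R) =>
    (tuple_cons (p.1.1, p.2.1), tuple_cons (p.1.2, p.2.2))).
Proof.
apply/measurable_fun_pair => /=.
  apply: (measurableT_comp (@measurable_tuple_cons R m.+1)).
  by apply/measurable_fun_pair; exact: measurableT_comp.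
apply: (measurableT_comp (@measurable_tuple_cons R m)).
by apply/measurable_fun_pair; exact: measurableT_comp.
Qed.

Lemma band_measurable_scons m d (T : measurableType d)
    (F : (nat -> R) -> (nat -> R) -> T) :
  band_measurable m.+2 F ->
  measurable_fun setT (fun p : (R * R) * (m.+1.-tuple R * m.-tuple R) =>
    F (scons p.1.1 (nth0 p.2.1)) (scons p.1.2 (nth0 p.2.2))).
Proof.
move=> mF; have := measurableT_comp mF (@measurable_cons_band m).
apply: eq_measurable_fun => p _ /=.
by rewrite -!nth_tuple_cons.
Qed.

(** Integrating the first vertex last is suited to elimination from the left, where
the first pivot is the first diagonal entry; [band_integral_peel_rev]
integrates it first, as elimination from the right requires. *)
Lemma band_integral_peel m (F : seqf) :
  band_measurable m.+2 F -> (forall a b, 0 <= F a b)%E ->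
  band_integral m.+2 F = (\int[leb]_x \int[leb]_y
    band_integral m.+1 (fun a b => F (scons x a) (scons y b)))%E.
Proof.
move=> mF F0; pose G (t : m.+2.-tuple R) (u : m.+1.-tuple R) := F (nth0 t) (nth0 u).
have mG t : measurable_fun setT (G t).
  apply: (measurableT_comp mF (_ : measurable_fun _ (fun u => (t, u)))).
  exact/measurable_fun_pair.
have mI : measurable_fun setT (fun t => \int[tl m.+1]_u G t u)%E.
  exact: (@measurable_fun_fubini_tonelli_F _ _ _ _ _ (tl m.+1) _ mF).
rewrite /band_integral fubini_tonelli1//= /fubini_F/=.
rewrite (@ge0_integral_tupleS m.+1 (fun t => \int[tl m.+1]_u G t u)%E)//; last first.
  by move=> t; apply: integral_ge0 => u _; exact: F0.
transitivity (\int[leb \x tl m.+1]_q \int[leb \x tl m]_r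
    F (scons q.1 (nth0 q.2)) (scons r.1 (nth0 r.2)))%E.
  apply: eq_integral => -[x t] _; rewrite ge0_integral_tupleS//; last first.
    by move=> u; exact: F0.
  by apply: eq_integral => -[y u] _; rewrite /G !nth_tuple_cons.
rewrite (@tonelli4 _ _ _ _ _ _ _ _ R leb leb (tl m.+1) (tl m)
  (fun x t y u => F (scons x (nth0 t)) (scons y (nth0 u))))//.
have := band_measurable_scons mF.
move/measurableT_comp => /(_ _ _ _ (fun p => ((p.1.1, p.2.1), (p.1.2, p.2.2)))); apply.
apply/measurable_fun_pair => /=; apply/measurable_fun_pair; exact: measurableT_comp.
Qed.

Lemma band_integral_peel_rev m (F : seqf) :
  band_measurable m.+2 F -> (forall a b, 0 <= F a b)%E ->
  band_integral m.+2 F = band_integral m.+1 (fun a b =>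
    \int[leb]_y \int[leb]_x F (scons x a) (scons y b))%E.
Proof.
move=> mF F0; rewrite band_integral_peel//.
apply: (@tonelli3 _ _ _ _ _ _ R leb leb (sigma_finite_prod (tl m.+1) (tl m))
  (fun x y p => F (scons x (nth0 p.1)) (scons y (nth0 p.2)))) => //.
exact: band_measurable_scons.
Qed.

Lemma band_measurable_head m d (T : measurableType d)
    (F : (nat -> R) -> (nat -> R) -> T) :
  band_measurable m.+1 F ->
  measurable_fun setT (fun p : (R * m.-tuple R) * m.-tuple R =>
    F (scons p.1.1 (nth0 p.1.2)) (nth0 p.2)).
Proof.
move=> mF; have /(measurableT_comp mF) : measurable_fun setT
    (fun p : (R * m.-tuple R) * m.-tuple R => (tuple_cons p.1, p.2)).
  apply/measurable_fun_pair => //=.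
  exact: (measurableT_comp (@measurable_tuple_cons R m)).
by apply: eq_measurable_fun => -[[x t] u] _ /=; rewrite -nth_tuple_cons.
Qed.

Lemma band_integral_head m (F : seqf) :
  band_measurable m.+1 F -> (forall a b, 0 <= F a b)%E ->
  band_integral m.+1 F =
    (\int[tl m]_t \int[leb]_x \int[tl m]_u F (scons x (nth0 t)) (nth0 u))%E.
Proof.
move=> mF F0.
have mI : measurable_fun setT
    (fun t : m.+1.-tuple R => \int[tl m]_u F (nth0 t) (nth0 u))%E.
  exact: (@measurable_fun_fubini_tonelli_F _ _ _ _ _ (tl m) _ mF).
rewrite /band_integral fubini_tonelli1//.
rewrite (@ge0_integral_tupleS m (fun t => \int[tl m]_u F (nth0 t) (nth0 u))%E)//; last first.
  by move=> t; apply: integral_ge0 => u _; exact: F0.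
rewrite fubini_tonelli2/=; first last.
- by move=> q; apply: integral_ge0 => u _; exact: F0.
- exact: (measurableT_comp mI (@measurable_tuple_cons R m)).
apply: eq_integral => t _; apply: eq_integral => x _.
by apply: eq_integral => u _; rewrite nth_tuple_cons.
Qed.

(** The change of variable of one elimination step: the Schur complement only
translates the first remaining diagonal entry. *)
Lemma band_integral_shift m (F : seqf) c :
  band_measurable m.+1 F -> (forall a b, 0 <= F a b)%E ->
  band_integral m.+1 (fun a b => F (scons (a 0%N - c) (fun i => a i.+1)) b) =
  band_integral m.+1 F.
Proof.
move=> mF F0; pose shift (t : m.+1.-tuple R) : m.+1.-tuple R :=
  tuple_cons ((tuple_uncons t).1 - c, (tuple_uncons t).2).
have nth_shift t : nth0 (shift t) = scons (t`_0 - c) (fun i => t`_i.+1).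
  rewrite nth_tuple_cons/= nth_behead_tuple /thead (tnth_nth 0)//.
have mshift : measurable_fun setT shift.
  apply: (measurableT_comp (@measurable_tuple_cons R m)).
  have m1 := measurableT_comp measurable_fst (@measurable_tuple_uncons R m).
  have m2 := measurableT_comp measurable_snd (@measurable_tuple_uncons R m).
  by apply/measurable_fun_pair => //; exact: measurable_funB.
have mF' : band_measurable m.+1
    (fun a b => F (scons (a 0%N - c) (fun i => a i.+1)) b).
  have /(measurableT_comp mF) : measurable_fun setT
      (fun p : m.+1.-tuple R * m.-tuple R => (shift p.1, p.2)).
    by apply/measurable_fun_pair => //=; exact: measurableT_comp.
  by apply: eq_measurable_fun => -[t u] _ /=; rewrite -nth_shift.
rewrite (band_integral_head mF F0) (band_integral_head mF'); last first.
  by move=> a b; exact: F0.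
apply: eq_integral => t _.
pose f x := (\int[tl m]_u F (scons x (nth0 t)) (nth0 u))%E.
rewrite -(@ge0_integral_translate R f c)//; last first.
  by move=> x; apply: integral_ge0 => u _; exact: F0.
have mF1 : measurable_fun setT (fun p : R * m.-tuple R =>
    F (scons p.1 (nth0 t)) (nth0 p.2)).
  have := band_measurable_head mF.
  move/measurableT_comp => /(_ _ _ _ (fun p => ((p.1, t), p.2))); apply.
  by apply/measurable_fun_pair => //=; exact/measurable_fun_pair.
exact: (@measurable_fun_fubini_tonelli_F _ _ _ _ _ (tl m) _ mF1).
Qed.

Lemma integral_tuple0 (f : 0.-tuple R -> \bar R) :
  (\int[tl 0]_t f t = f [tuple])%E.
Proof.
rewrite /=; have -> : f = cst (f [tuple]) by apply/funext => t; rewrite [t]tuple0.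
by rewrite integral_dirac// diracT mul1e.
Qed.

Lemma band_integral1 (f : R -> \bar R) :
  measurable_fun setT f -> (forall x, 0 <= f x)%E ->
  band_integral 1 (fun a _ => f (a 0%N)) = (\int[leb]_x f x)%E.
Proof.
move=> mf f0; rewrite band_integral_head//.
  by rewrite integral_tuple0; apply: eq_integral => x _; rewrite integral_tuple0.
apply: (measurableT_comp mf).
exact: (measurableT_comp (@measurable_nth 1 0) measurable_fst).
Qed.

End tuples.

(** * Elimination from both ends and the normalising integral *)

Section band.
Context {R : realType}.
Implicit Types (s al be a b v : nat -> R) (i j k m : nat).

Definition shift {T : Type} (f : nat -> T) : nat -> T := fun i => f i.+1.

(** The diagonal left after eliminating vertex 0. *)
Definition schur a b : nat -> R := scons (a 1%N - b 0%N ^+ 2 / a 0%N) (shift (shift a)).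

(** The pivot of vertex 0 when vertices m, m - 1, ..., 1 have been eliminated before
it. *)
Fixpoint back_pivot m a b : R :=
  if m is m'.+1 then a 0%N - b 0%N ^+ 2 / back_pivot m' (shift a) (shift b)
  else a 0%N.

Fixpoint back_pos m a b : bool :=
  (0 < back_pivot m a b) &&
  (if m is m'.+1 then back_pos m' (shift a) (shift b) else true).

Fixpoint pivots_pos k m a b : bool :=
  if k is k'.+1 then (0 < a 0%N) && pivots_pos k' m (schur a b) (shift b)
  else back_pos m a b.

(** The factors of the vertices 1, ..., m of a path eliminated from its far end: the
factor of the pivot of vertex 0 is left to the caller, because that pivot is
completed only when both sides of M have been eliminated. *)
Fixpoint back_density m s al be a b : R :=
  if m is m'.+1 then
    let e := back_pivot m' (shift a) (shift b) in
    expR (- (al 0%N * b 0%N ^+ 2 / e) - 2 * be 0%N * b 0%N) *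
    (gamma_density (s 1%N) (al 1%N) e *
     back_density m' (shift s) (shift al) (shift be) (shift a) (shift b))
  else 1.

(** The Wishart density in its factorised form; see [band_densityE]. *)
Fixpoint band_density k m s al be a b : R :=
  if k is k'.+1 then
    gamma_density (s 0%N) (al 0%N) (a 0%N) *
    expR (- (al 1%N * b 0%N ^+ 2 / a 0%N) - 2 * be 0%N * b 0%N) *
    band_density k' m (shift s) (shift al) (shift be) (schur a b) (shift b)
  else gamma_density (s 0%N) (al 0%N) (back_pivot m a b) *
       back_density m s al be a b.

Lemma back_density_ge0 m s al be a b : 0 <= back_density m s al be a b.
Proof.
elim: m s al be a b => [|m IH] s al be a b //=.
by rewrite !mulr_ge0 ?expR_ge0 ?gamma_density_ge0.
Qed.

Lemma band_density_ge0 k m s al be a b : 0 <= band_density k m s al be a b.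
Proof.
elim: k s al be a b => [|k IH] s al be a b /=.
  by rewrite mulr_ge0 ?gamma_density_ge0 ?back_density_ge0.
by rewrite !mulr_ge0 ?expR_ge0 ?gamma_density_ge0.
Qed.

Local Notation nth0 := (@nth R 0%R).

Lemma band_measurable_fst n i : band_measurable n (fun a b => a i).
Proof. exact: (measurableT_comp (@measurable_nth _ n i) measurable_fst). Qed.

Lemma band_measurable_snd n i : band_measurable n (fun a b => b i).
Proof. exact: (measurableT_comp (@measurable_nth _ n.-1 i) measurable_snd). Qed.

Lemma nth_mktuple_nat n (f : nat -> R) i :
  nth0 [tuple f j | j < n] i = if (i < n)%N then f i else 0.
Proof.
case: ltnP => ni; last by rewrite nth_default// size_tuple.
by rewrite -(tnth_nth 0 _ (Ordinal ni)) tnth_mktuple.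
Qed.

(** Measurability of a composite is tested entry by entry.  The two vanishing
conditions hold because sequences read off a tuple are extended by 0; they make
[phi] and [psi] determined by their first entries. *)
Lemma band_measurable_subst n n' d (T : measurableType d)
    (F : (nat -> R) -> (nat -> R) -> T) (phi psi : (nat -> R) -> (nat -> R) -> nat -> R) :
  (forall i, (i < n')%N -> band_measurable n (fun a b => phi a b i)) ->
  (forall i, (i < n'.-1)%N -> band_measurable n (fun a b => psi a b i)) ->
  (forall (t : n.-tuple R) (u : n.-1.-tuple R) i, (n' <= i)%N -> phi (nth0 t) (nth0 u) i = 0) ->
  (forall (t : n.-tuple R) (u : n.-1.-tuple R) i, (n'.-1 <= i)%N -> psi (nth0 t) (nth0 u) i = 0) ->
  band_measurable n' F ->
  band_measurable n (fun a b => F (phi a b) (psi a b)).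
Proof.
move=> mphi mpsi phi0 psi0 mF.
pose h (p : n.-tuple R * n.-1.-tuple R) : n'.-tuple R * n'.-1.-tuple R :=
  ([tuple phi (nth0 p.1) (nth0 p.2) i | i < n'],
   [tuple psi (nth0 p.1) (nth0 p.2) i | i < n'.-1]).
have mh : measurable_fun setT h.
  apply/measurable_fun_pair; apply/measurable_fun_tnthP => i.
    have := mphi i (ltn_ord i); apply: eq_measurable_fun => p _ /=.
    by rewrite tnth_mktuple.
  have := mpsi i (ltn_ord i); apply: eq_measurable_fun => p _ /=.
  by rewrite tnth_mktuple.
have E1 p : nth0 (h p).1 = phi (nth0 p.1) (nth0 p.2).
  by apply/funext => i; rewrite nth_mktuple_nat; case: ltnP => // /phi0 ->.
have E2 p : nth0 (h p).2 = psi (nth0 p.1) (nth0 p.2).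
  by apply/funext => i; rewrite nth_mktuple_nat; case: ltnP => // /psi0 ->.
have := measurableT_comp mF mh; apply: eq_measurable_fun => p _.
by rewrite -E1 -E2.
Qed.

(** For x >= 0 the inverse is the power -1, including the value 0 at 0, and the
inverse is odd. *)
Lemma measurable_invr : measurable_fun [set: R] (@GRing.inv R).
Proof.
have : measurable_fun [set: R]
    (fun x => if 0 <= x then x `^ (-1) else - ((- x) `^ (-1))).
  apply: measurable_fun_ifT; first exact: measurable_fun_ler.
    exact: measurable_powR.
  apply: measurable_funN; apply: (measurableT_comp (measurable_powR _)).
  exact: measurable_funN.
apply: eq_measurable_fun => x _; case: ifPn => x0; rewrite powR_inv1//.
  by rewrite invrN opprK.
by rewrite oppr_ge0 ltW// ltNge.
Qed.

Lemma band_measurable_shift n d (T : measurableType d)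
    (F : (nat -> R) -> (nat -> R) -> T) :
  band_measurable n.+1 F ->
  band_measurable n.+2 (fun a b => F (shift a) (shift b)).
Proof.
apply: (@band_measurable_subst _ _ _ _ F (fun a _ => shift a) (fun _ b => shift b)).
- by move=> i _; exact: band_measurable_fst.
- by move=> i _; exact: band_measurable_snd.
- by move=> t u i ni; rewrite /shift nth_default// size_tuple.
- by move=> t u i ni; rewrite /shift nth_default// size_tuple.
Qed.

Lemma band_measurable_schur n d (T : measurableType d)
    (F : (nat -> R) -> (nat -> R) -> T) :
  band_measurable n.+1 F ->
  band_measurable n.+2 (fun a b => F (schur a b) (shift b)).
Proof.
apply: (@band_measurable_subst _ _ _ _ F schur (fun _ b => shift b)).
- move=> [_|i _]; last exact: band_measurable_fst.
  apply: measurable_funB; first exact: band_measurable_fst.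
  apply: measurable_funM.
    by apply: measurable_funX; exact: band_measurable_snd.
  by apply: (measurableT_comp measurable_invr); exact: band_measurable_fst.
- by move=> i _; exact: band_measurable_snd.
- by move=> t u [//|i] ni; rewrite /= /shift nth_default// size_tuple.
- by move=> t u i ni; rewrite /shift nth_default// size_tuple.
Qed.

Lemma band_measurable_back_pivot m : band_measurable m.+1 (back_pivot m).
Proof.
elim: m => [|m IH]; first exact: band_measurable_fst.
apply: measurable_funB; first exact: band_measurable_fst.
apply: measurable_funM.
  by apply: measurable_funX; exact: band_measurable_snd.
exact: (measurableT_comp measurable_invr (band_measurable_shift IH)).
Qed.

Lemma measurable_gauss_weight d (T : measurableType d) (A B : R) (b e : T -> R) :
  measurable_fun setT b -> measurable_fun setT e ->
  measurable_fun setT (fun t => expR (- (A * b t ^+ 2 / e t) - 2 * B * b t)).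
Proof.
move=> mb me; apply: measurableT_comp => //; apply: measurable_funB.
  apply: measurable_funN; apply: measurable_funM.
    by apply: measurable_funM => //; exact: measurable_funX.
  exact: (measurableT_comp measurable_invr me).
exact: measurable_funM.
Qed.

Lemma band_measurable_back_density m s al be :
  band_measurable m.+1 (back_density m s al be).
Proof.
elim: m s al be => [|m IH] s al be; first exact: measurable_cst.
apply: measurable_funM.
  apply: measurable_gauss_weight; first exact: band_measurable_snd.
  exact: (band_measurable_shift (@band_measurable_back_pivot m)).
apply: measurable_funM; last exact: (band_measurable_shift (IH (shift s) (shift al) (shift be))).
apply: (measurableT_comp (measurable_gamma_density _ _)).
exact: (band_measurable_shift (@band_measurable_back_pivot m)).
Qed.

Lemma band_measurable_density k m s al be :
  band_measurable (k + m).+1 (band_density k m s al be).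
Proof.
elim: k s al be => [|k IH] s al be.
  apply: measurable_funM; last exact: band_measurable_back_density.
  apply: (measurableT_comp (measurable_gamma_density _ _)).
  exact: band_measurable_back_pivot.
apply: measurable_funM; last exact: (band_measurable_schur (IH (shift s) (shift al) (shift be))).
apply: measurable_funM.
  apply: (measurableT_comp (measurable_gamma_density _ _)).
  exact: band_measurable_fst.
by apply: measurable_gauss_weight; [exact: band_measurable_snd|exact: band_measurable_fst].
Qed.

(** The positivity of the principal minors of x on the vertices and the edges, that
is on the cliques of the path: this describes Q_G, where the missing entries of x
leave no larger minor to test. *)
Fixpoint cliques_pos m al be : bool :=
  (0 < al 0%N) &&
  (if m is m'.+1 then (0 < al 0%N * al 1%N - be 0%N ^+ 2) &&
     cliques_pos m' (shift al) (shift be) else true).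

Fixpoint back_const m s : R :=
  if m is m'.+1 then block_const (s 1%N) * back_const m' (shift s) else 1.

(** The logarithm of x_jj^{s_i + 1} |x_{i,j}|^{-(s_i + 3/2)}, summed over the edges
{j, i = j + 1} on the right of M. *)
Fixpoint back_log m s al be : R :=
  if m is m'.+1 then (s 1%N + 1) * ln (al 0%N)
    - (s 1%N + 3 / 2) * ln (al 0%N * al 1%N - be 0%N ^+ 2)
    + back_log m' (shift s) (shift al) (shift be)
  else 0.

Lemma back_const_gt0 m s : (forall i, (i < m)%N -> - (3 / 2) < s i.+1) ->
  0 < back_const m s.
Proof.
elim: m s => [//|m IH] s sm /=; rewrite mulr_gt0 ?block_const_gt0 ?sm//.
by apply: IH => i im; exact: sm.
Qed.

Lemma ge0_integral_translate_scale (f : R -> R) (c : R) (r : R) :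
  0 <= c -> (forall x, 0 <= f x) -> measurable_fun setT f ->
  (\int[lebesgue_measure]_x (f (x - r) * c)%:E =
   c%:E * \int[lebesgue_measure]_x (f x)%:E)%E.
Proof.
move=> c0 f0 mf; have mf' : measurable_fun setT (fun x => (f x)%:E).
  exact/measurable_EFinP.
rewrite -(@ge0_integral_translate R (fun x => (f x)%:E) r)//.
rewrite -ge0_integralZl//; first by apply: eq_integral => x _; rewrite mulrC.
- by apply: (measurableT_comp mf'); exact: measurable_funB.
- by move=> x _; rewrite lee_fin.
Qed.

(** Elimination from the right.  The function [g] of the last pivot is arbitrary for
the sake of the induction: eliminating vertex 0 turns [g (back_pivot m.+1 a b)]
into a constant, by translation of the entry at vertex 0, and hands the weight
[gauss_gamma_density] of the pivot of vertex 1 to the induction hypothesis. *)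
Lemma band_integral_back m s al be (g : R -> R) :
  (forall i, (i < m)%N -> - (3 / 2) < s i.+1) -> cliques_pos m al be ->
  (forall x, 0 <= g x) -> measurable_fun setT g ->
  band_integral m.+1
    (fun a b => (g (back_pivot m a b) * back_density m s al be a b)%:E) =
  ((back_const m s * expR (back_log m s al be))%:E *
     \int[lebesgue_measure]_x (g x)%:E)%E.
Proof.
elim: m s al be g => [|m IH] s al be g sm.
  move=> _ g0 mg /=; rewrite expR0 mulr1 mul1e.
  under [X in band_integral _ X]eq_fun2 do rewrite mulr1.
  apply: (@band_integral1 R (fun x => (g x)%:E)) => //.
  exact/measurable_EFinP.
move=> /= /andP[al0 /andP[D0 gb]] g0 mg.
have mF : band_measurable m.+2 (fun a b =>
    (g (back_pivot m.+1 a b) * back_density m.+1 s al be a b)%:E).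
  apply/measurable_EFinP/measurable_funM; last exact: band_measurable_back_density.
  apply: (measurableT_comp mg); exact: band_measurable_back_pivot.
have F0 a b : (0 <= (g (back_pivot m.+1 a b) * back_density m.+1 s al be a b)%:E)%E.
  by rewrite lee_fin mulr_ge0// back_density_ge0.
have H1 := band_integral_peel_rev mF F0.
rewrite H1 {H1}.
pose G := (\int[lebesgue_measure]_x (g x)%:E)%E.
pose h := gauss_gamma_density (s 1%N) (al 0%N) (be 0%N) (al 1%N).
have inner a b :
  (\int[lebesgue_measure]_y \int[lebesgue_measure]_x
    (g (back_pivot m.+1 (scons x a) (scons y b)) *
     back_density m.+1 s al be (scons x a) (scons y b))%:E)%E =
  (G * (h (back_pivot m a b) *
     back_density m (shift s) (shift al) (shift be) a b)%:E)%E.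
  rewrite /=; change (shift (scons _ a)) with a; change (shift (scons _ b)) with b.
  set e := back_pivot m a b; set w := back_density m _ _ _ a b.
  have w0 : 0 <= w by exact: back_density_ge0.
  pose k := gamma_density (s 1%N) (al 1%N) e * w.
  have k0 : 0 <= k by rewrite mulr_ge0 ?gamma_density_ge0.
  transitivity (\int[lebesgue_measure]_y (G * k%:E *
      (expR (- (al 0%N * y ^+ 2 / e) - 2 * be 0%N * y))%:E))%E.
    apply: eq_integral => y _; rewrite ge0_integral_translate_scale//; last first.
      by rewrite !mulr_ge0 ?expR_ge0 ?gamma_density_ge0.
    by rewrite -/k mulrC EFinM muleC muleA.
  have G0 : (0 <= G)%E by apply: integral_ge0 => x _; rewrite lee_fin.
  rewrite ge0_integralZl//; last 2 first.
  - apply/measurable_EFinP/measurable_gauss_weight; [exact: measurable_id|exact: measurable_cst].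
  - by rewrite mule_ge0.
  rewrite -muleA; congr (G * _)%E; rewrite /h /gauss_gamma_density /k.
  (* For e <= 0 both sides vanish, through the cut-off in the Gamma density. *)
  have [e0|e0] := ltP 0 e.
    rewrite integral_gauss_quadratic// -EFinM; congr EFin; ring.
  by rewrite /gamma_density ltNge e0/= !(mul0r, mulr0) mul0e.
have G0 : (0 <= G)%E by apply: integral_ge0 => x _; rewrite lee_fin.
have h0 x : 0 <= h x.
  by rewrite /h /gauss_gamma_density !mulr_ge0 ?expR_ge0 ?gamma_density_ge0 ?sqrtr_ge0.
transitivity (G * band_integral m.+1 (fun a b =>
   (h (back_pivot m a b) * back_density m (shift s) (shift al) (shift be) a b)%:E))%E.
  rewrite /band_integral -ge0_integralZl//.
  - by apply: eq_integral => p _; rewrite inner.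
  - apply/measurable_EFinP/measurable_funM; last exact: band_measurable_back_density.
    apply: (measurableT_comp (measurable_gauss_gamma_density _ _ _ _)).
    exact: band_measurable_back_pivot.
  - by move=> p _; rewrite lee_fin mulr_ge0// back_density_ge0.
rewrite IH//; last 2 first.
- by move=> i im; exact: sm.
- exact: measurable_gauss_gamma_density.
rewrite integral_gauss_gamma_density//; last exact: (sm 0%N).
rewrite muleC; congr (_ * G)%E; rewrite -EFinM; congr EFin.
rewrite [in RHS]expRD; ring.
Qed.

Fixpoint band_const k m s : R :=
  if k is k'.+1 then block_const (s 0%N) * band_const k' m (shift s)
  else fine (gamma_int (s 0%N)) * back_const m s.

Fixpoint band_log k m s al be : R :=
  if k is k'.+1 then (s 0%N + 1) * ln (al 1%N)
    - (s 0%N + 3 / 2) * ln (al 0%N * al 1%N - be 0%N ^+ 2)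
    + band_log k' m (shift s) (shift al) (shift be)
  else - ((s 0%N + 1) * ln (al 0%N)) + back_log m s al be.

Lemma band_const_gt0 k m s :
  (forall i, (i <= k + m)%N -> i != k -> - (3 / 2) < s i) -> -1 < s k ->
  0 < band_const k m s.
Proof.
elim: k s => [|k IH] s sm sk /=.
  rewrite mulr_gt0 ?gamma_fine_gt0// back_const_gt0// => i im; exact: sm.
rewrite mulr_gt0 ?block_const_gt0 ?sm// IH// => i im ik; exact: sm.
Qed.

(** Elimination from the left down to M, each step being an instance of
[integral_gauss_gamma_density]; [band_integral_back] then treats M and the vertices
on its right. *)
Lemma band_integral_density k m s al be :
  (forall i, (i <= k + m)%N -> i != k -> - (3 / 2) < s i) -> -1 < s k ->
  cliques_pos (k + m) al be ->
  band_integral (k + m).+1 (fun a b => (band_density k m s al be a b)%:E) =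
  (band_const k m s * expR (band_log k m s al be))%:E.
Proof.
elim: k s al be => [|k IH] s al be sm sk gb.
  have al0 : 0 < al 0%N by case: (m) gb => [|m']/= /andP[].
  have H := @band_integral_back m s al be (gamma_density (s 0%N) (al 0%N)).
  rewrite [LHS]H//.
  - rewrite integral_gamma_density// -gamma_int_fineK// -!EFinM/=; congr EFin.
    rewrite [in RHS]expRD; ring.
  - by move=> i im; apply: sm.
  - by move=> x; exact: gamma_density_ge0.
  - exact: measurable_gamma_density.
have mF := @band_measurable_density k.+1 m s al be.
have {}mF : band_measurable (k + m).+2 (fun a b => (band_density k.+1 m s al be a b)%:E).
  exact/measurable_EFinP.
have F0 a b : (0 <= (band_density k.+1 m s al be a b)%:E)%E.
  by rewrite lee_fin band_density_ge0.
have H1 := band_integral_peel mF F0.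
rewrite [LHS]H1 {H1 mF F0}.
move: gb => /= /andP[al0 /andP[D0 gb]].
have al1 : 0 < al 1%N by case: (k + m)%N gb => [|m']/= /andP[].
pose w x y := gamma_density (s 0%N) (al 0%N) x *
  expR (- (al 1%N * y ^+ 2 / x) - 2 * be 0%N * y).
pose f := band_density k m (shift s) (shift al) (shift be).
have mf : band_measurable (k + m).+1 (fun a b => (f a b)%:E).
  by apply/measurable_EFinP; exact: band_measurable_density.
have f0 a b : (0 <= (f a b)%:E)%E by rewrite lee_fin band_density_ge0.
pose Z := band_const k m (shift s) * expR (band_log k m (shift s) (shift al) (shift be)).
have ZE : band_integral (k + m).+1 (fun a b => (f a b)%:E) = Z%:E.
  by rewrite IH// => i im ik; exact: sm.
have Z0 : 0 <= Z.
  rewrite mulr_ge0 ?expR_ge0// ltW// band_const_gt0// => i im ik; exact: sm.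
have inner x y : band_integral (k + m).+1 (fun a b =>
    (band_density k.+1 m s al be (scons x a) (scons y b))%:E) = (w x y * Z)%:E.
  transitivity ((w x y)%:E * band_integral (k + m).+1 (fun a b =>
      (f (scons (a 0%N - y ^+ 2 / x) (fun i => a i.+1)) b)%:E))%E.
    rewrite /band_integral -ge0_integralZl//.
    - apply: (@band_measurable_subst _ (k + m).+1 _ _ (fun a b => (f a b)%:E)
        (fun a _ => scons (a 0%N - y ^+ 2 / x) (fun i => a i.+1)) (fun _ b => b)) => //.
      + move=> [|i] _; last exact: band_measurable_fst.
        by apply: measurable_funB => //; exact: band_measurable_fst.
      + by move=> i _; exact: band_measurable_snd.
      + by move=> t u [//|i] ni /=; rewrite nth_default// size_tuple.
      + by move=> t u i ni; rewrite nth_default// size_tuple.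
    - by rewrite lee_fin mulr_ge0 ?gamma_density_ge0 ?expR_ge0.
  have -> := @band_integral_shift R (k + m) (fun a b => (f a b)%:E) (y ^+ 2 / x) mf f0.
  by rewrite ZE.
transitivity (\int[lebesgue_measure]_x (Z%:E *
    (gauss_gamma_density (s 0%N) (al 1%N) (be 0%N) (al 0%N) x)%:E))%E.
  apply: eq_integral => x _.
  transitivity (\int[lebesgue_measure]_y ((Z * gamma_density (s 0%N) (al 0%N) x)%:E *
      (expR (- (al 1%N * y ^+ 2 / x) - 2 * be 0%N * y))%:E))%E.
    apply: eq_integral => y _; rewrite [LHS]inner -EFinM; congr EFin.
    by rewrite /w mulrC mulrA.
  rewrite ge0_integralZl//; last 2 first.
  - apply/measurable_EFinP/measurable_gauss_weight; [exact: measurable_id|exact: measurable_cst].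
  - by rewrite lee_fin mulr_ge0 ?gamma_density_ge0.
  rewrite /gauss_gamma_density; have [x0|x0] := ltP 0 x.
    rewrite integral_gauss_quadratic// -!EFinM; congr EFin; ring.
  by rewrite /gamma_density ltNge x0/= !mulr0 mul0e mule0.
rewrite ge0_integralZl//; last 2 first.
- by apply/measurable_EFinP; exact: measurable_gauss_gamma_density.
- move=> x _; rewrite lee_fin.
  by rewrite !mulr_ge0 ?expR_ge0 ?gamma_density_ge0 ?sqrtr_ge0.
rewrite integral_gauss_gamma_density//; first last.
- by rewrite mulrC.
- exact: (sm 0%N).
rewrite -EFinM; congr EFin.
rewrite [in RHS]expRD (mulrC (al 1%N)) /Z; ring.
Qed.

End band.

(** * Minors, pairings and positive definiteness of band matrices *)

Section minors.
Context {R : realType}.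
Implicit Types (s al be a b v : nat -> R) (i j k m n : nat).

(** The determinant of a tridiagonal symmetric matrix of size [n], by its three-term
recurrence. *)
Fixpoint band_minor n a b : R :=
  if n is n1.+1 then
    a 0%N * band_minor n1 (shift a) (shift b) -
    (if n1 is n2.+1 then b 0%N ^+ 2 * band_minor n2 (shift (shift a)) (shift (shift b))
     else 0)
  else 1.

Arguments band_minor : simpl never.

Definition from {T : Type} k (f : nat -> T) : nat -> T := fun i => f (k + i)%N.

(** [gpower] in terms of band minors; see [gpower_path_mx]. *)
Definition band_power k m s a b : R :=
  (\prod_(i < k) band_minor i.+1 a b `^ (s i - s i.+1)) *
  band_minor (k + m).+1 a b `^ s k *
  (\prod_(j < m) band_minor (m - j) (from (k + j).+1 a) (from (k + j).+1 b)
     `^ (s (k + j).+1 - s (k + j)%N)).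

(** The sum of [band_entry a b i j * w i j], arranged for recursion on the size; the
choices of [w] below give the quadratic form and the trace pairing. *)
Fixpoint band_sum n a b (w : nat -> nat -> R) : R :=
  a 0%N * w 0%N 0%N + (if n is n'.+1 then
    b 0%N * (w 0%N 1%N + w 1%N 0%N) +
    band_sum n' (shift a) (shift b) (fun i j => w i.+1 j.+1) else 0).

Definition band_entry a b i j : R :=
  if i == j then a i else if j == i.+1 then b i else if i == j.+1 then b j else 0.

Lemma band_minor1 a b : band_minor 1 a b = a 0%N.
Proof. by rewrite /band_minor mulr1 subr0. Qed.

Lemma band_minorSS n a b : band_minor n.+2 a b =
  a 0%N * band_minor n.+1 (shift a) (shift b) -
  b 0%N ^+ 2 * band_minor n (shift (shift a)) (shift (shift b)).
Proof. by []. Qed.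

Lemma band_minor_schur n a b : a 0%N != 0 ->
  band_minor n.+2 a b = a 0%N * band_minor n.+1 (schur a b) (shift b).
Proof.
move=> a0; case: n => [|n].
  by rewrite band_minorSS !band_minor1 /= mulr1 /shift; field.
rewrite band_minorSS (band_minorSS n (schur a b)) (band_minorSS n (shift a)).
change (shift (schur a b)) with (shift (shift a)).
by rewrite /= /shift; field.
Qed.

Lemma back_pivotS m a b : back_pivot m.+1 a b =
  a 0%N - b 0%N ^+ 2 / back_pivot m (shift a) (shift b).
Proof. by []. Qed.

Lemma back_posS m a b : back_pos m.+1 a b =
  (0 < back_pivot m.+1 a b) && back_pos m (shift a) (shift b).
Proof. by []. Qed.

Lemma back_pos_pivot m a b : back_pos m a b -> 0 < back_pivot m a b.
Proof. by case: m => [|m] /andP[]. Qed.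

Lemma back_pos_minor m a b : back_pos m a b ->
  0 < band_minor m.+1 a b /\
  band_minor m.+1 a b = back_pivot m a b * band_minor m (shift a) (shift b).
Proof.
elim: m a b => [|m IH] a b; first by rewrite !band_minor1 mulr1 /= andbT.
rewrite back_posS => /andP[e0 bp]; have [c0 cE] := IH _ _ bp.
have p0 := back_pos_pivot bp.
suff E : band_minor m.+2 a b = back_pivot m.+1 a b * band_minor m.+1 (shift a) (shift b).
  by rewrite E mulr_gt0.
rewrite band_minorSS back_pivotS mulrBl; congr (_ - _).
rewrite [in RHS]cE; field; rewrite gt_eqF//.
Qed.

(** With M at vertex 0, the pivot of that vertex divides only the full determinant; what
remains of the determinant is the minor of the vertices 1, 2, ..., whose exponent
becomes s_0 + (s_1 - s_0) = s_1. *)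
Lemma band_power0S m s a b : back_pos m.+1 a b ->
  band_power 0 m.+1 s a b =
  back_pivot m.+1 a b `^ s 0%N * band_power 0 m (shift s) (shift a) (shift b).
Proof.
move=> bp; have [c0 cE] := back_pos_minor bp.
move: (bp); rewrite back_posS => /andP[e0 bp'].
have [c1 _] := back_pos_minor bp'.
rewrite /band_power !big_ord0 !mul1r big_ord_recl !add0n subn0 [in LHS]cE.
rewrite powRM ?(ltW e0) ?(ltW c1)// -!mulrA; congr (_ * _).
rewrite mulrA -powRD; last by rewrite (gt_eqF c1) implybT.
by congr (_ `^ _ * _); rewrite /shift addrC subrK.
Qed.

Lemma pivots_posS k m a b : pivots_pos k.+1 m a b =
  (0 < a 0%N) && pivots_pos k m (schur a b) (shift b).
Proof. by []. Qed.

Lemma pivots_pos_minor k m a b : pivots_pos k m a b ->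
  (forall i, (i < k)%N -> 0 < band_minor i.+1 a b) /\ 0 < band_minor (k + m).+1 a b.
Proof.
elim: k a b => [|k IH] a b; first by move=> /back_pos_minor[].
rewrite pivots_posS => /andP[a0 /IH[IH1 IH2]]; have a0' : a 0%N != 0 by rewrite gt_eqF.
split; last by rewrite addSn band_minor_schur// mulr_gt0.
move=> [|i] ik; first by rewrite band_minor1.
by rewrite band_minor_schur// mulr_gt0// IH1.
Qed.

(** Every leading minor contains the first pivot once, so its exponent telescopes to
s_0; the minors of the trailing blocks do not contain it. *)
Lemma band_powerS k m s a b : 0 < a 0%N -> pivots_pos k m (schur a b) (shift b) ->
  band_power k.+1 m s a b =
  a 0%N `^ s 0%N * band_power k m (shift s) (schur a b) (shift b).
Proof.
move=> a0 pp; have [c1 c2] := pivots_pos_minor pp.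
have a0' : a 0%N != 0 by rewrite gt_eqF.
rewrite /band_power big_ord_recl band_minor1 addSn band_minor_schur//.
rewrite powRM ?(ltW a0) ?(ltW c2)//.
under eq_bigr => i _.
  rewrite lift0 band_minor_schur//.
  rewrite powRM ?(ltW a0) ?ltW ?c1//; over.
rewrite big_split/=.
have -> : \prod_(i < k) a 0%N `^ (s i.+1 - s i.+2) = a 0%N `^ (s 1%N - s k.+1).
  elim: (k) => [|k' IHk]; first by rewrite big_ord0 subrr powRr0.
  rewrite big_ord_recr/= IHk -powRD; last by rewrite a0' implybT.
  by congr (_ `^ _); ring.
have -> : a 0%N `^ s 0%N = a 0%N `^ (s 0%N - s 1%N) * a 0%N `^ (s 1%N - s k.+1) * a 0%N `^ s k.+1.
  by rewrite -!powRD ?a0' ?implybT//; congr (_ `^ _); ring.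
have E : \prod_(j < m) band_minor (m - j) (from (k.+1 + j).+1 a) (from (k.+1 + j).+1 b)
     `^ (s (k.+1 + j).+1 - s (k.+1 + j)%N) =
   \prod_(j < m) band_minor (m - j) (from (k + j).+1 (schur a b))
       (from (k + j).+1 (shift b)) `^ (shift s (k + j).+1 - shift s (k + j)%N).
  by [].
rewrite [X in _ * X = _]E /shift; ring.
Qed.

Lemma band_sum_head n a b (x : R) w :
  band_sum n (scons x (shift a)) b w =
  x * w 0%N 0%N + band_sum n (scons 0 (shift a)) b w.
Proof. by case: n => [|n] /=; rewrite mul0r add0r// addr0. Qed.

Definition band_form n a b v := band_sum n a b (fun i j => v i * v j).

Definition band_pairing n al be a b := band_sum n al be (band_entry a b).

Lemma band_formS n a b v : band_form n.+1 a b v =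
  a 0%N * v 0%N ^+ 2 + 2 * b 0%N * v 0%N * v 1%N +
  band_form n (shift a) (shift b) (shift v).
Proof. rewrite /band_form /=; ring. Qed.

Lemma band_pairingS n al be a b : band_pairing n.+1 al be a b =
  al 0%N * a 0%N + 2 * be 0%N * b 0%N +
  band_pairing n (shift al) (shift be) (shift a) (shift b).
Proof. rewrite /band_pairing /= /band_entry/=; ring. Qed.

Lemma scons_shift a : scons (a 0%N) (shift a) = a.
Proof. by apply/funext => -[]. Qed.

Lemma band_form_schur n a b v : a 0%N != 0 ->
  band_form n.+1 a b v = a 0%N * (v 0%N + b 0%N / a 0%N * v 1%N) ^+ 2 +
    band_form n (schur a b) (shift b) (shift v).
Proof.
move=> a0; rewrite band_formS /band_form -[in LHS](scons_shift (shift a)).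
rewrite [in LHS](band_sum_head n) [in RHS]/schur [in RHS](band_sum_head n) /shift.
by field.
Qed.

(** In terms of the Schur complement the term [al 1 * a 1] releases
[al 1 * b 0 ^ 2 / a 0], which makes the exponent quadratic in [b 0]. *)
Lemma band_pairing_schur n al be a b :
  band_pairing n.+1 al be a b =
    al 0%N * a 0%N + (al 1%N * b 0%N ^+ 2 / a 0%N + 2 * be 0%N * b 0%N) +
    band_pairing n (shift al) (shift be) (schur a b) (shift b).
Proof.
rewrite band_pairingS.
have -> : band_pairing n (shift al) (shift be) (schur a b) (shift b) =
    band_pairing n (shift al) (shift be) (shift a) (shift b) - al 1%N * b 0%N ^+ 2 / a 0%N.
  by rewrite /band_pairing; case: n => [|n] /=; rewrite /band_entry /= /shift/=; ring.
ring.
Qed.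

(** Multiplying out the factors of the pivots recovers exp (- <x, y>) Delta_s(y) on
the cone, and 0 off it. *)
Lemma band_densityE k m s al be a b :
  band_density k m s al be a b =
  if pivots_pos k m a b
  then expR (- band_pairing (k + m) al be a b) * band_power k m s a b else 0.
Proof.
elim: k s al be a b => [|k IH] s al be a b.
  elim: m s al be a b => [|m IH] s al be a b.
    rewrite /= /gamma_density mulr1 andbT; case: ifP => // a0.
    rewrite /band_power !big_ord0 mul1r mulr1 addn0 band_minor1 mulrC.
    by rewrite /band_pairing/= /band_entry eqxx addr0.
  have -> : band_density 0 m.+1 s al be a b =
      gamma_density (s 0%N) (al 0%N) (back_pivot m.+1 a b) *
      expR (- (al 0%N * b 0%N ^+ 2 / back_pivot m (shift a) (shift b)) - 2 * be 0%N * b 0%N) *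
      band_density 0 m (shift s) (shift al) (shift be) (shift a) (shift b).
    by rewrite /= !mulrA.
  rewrite IH [pivots_pos 0 m.+1 a b]back_posS /gamma_density; case: ifPn => e0; last by rewrite !mul0r.
  change (pivots_pos 0 m (shift a) (shift b)) with (back_pos m (shift a) (shift b)).
  rewrite andTb; case: ifPn => bp; last by rewrite mulr0.
  rewrite band_power0S; last by rewrite back_posS e0.
  rewrite add0n band_pairingS back_pivotS.
  set e := back_pivot m _ _; set P := band_power _ _ _ _ _; set L := band_pairing _ _ _ _ _.
  set A := expR (- (al 0%N * _)); set B := expR (_ - _).
  have -> : expR (- (al 0%N * a 0%N + 2 * be 0%N * b 0%N + L)) = A * B * expR (- L).
    by rewrite -!expRD; congr expR; ring.
  ring.
have -> : band_density k.+1 m s al be a b =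
    gamma_density (s 0%N) (al 0%N) (a 0%N) *
    expR (- (al 1%N * b 0%N ^+ 2 / a 0%N) - 2 * be 0%N * b 0%N) *
    band_density k m (shift s) (shift al) (shift be) (schur a b) (shift b) by [].
rewrite IH pivots_posS /gamma_density; case: ifPn => a0; last by rewrite !mul0r.
case: ifPn => pp; last by rewrite mulr0.
rewrite band_powerS// addSn band_pairing_schur.
set P := band_power _ _ _ _ _; set L := band_pairing _ _ _ _ _.
set A := expR (- (al 0%N * _)); set B := expR (- _ - _).
have -> : expR (- (al 0%N * a 0%N +
    (al 1%N * b 0%N ^+ 2 / a 0%N + 2 * be 0%N * b 0%N) + L)) = A * B * expR (- L).
  by rewrite -!expRD; congr expR; ring.
ring.
Qed.

Definition band_posdef n a b : Prop :=
  forall v, (exists2 i, (i <= n)%N & v i != 0) -> 0 < band_form n a b v.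

Lemma band_form_eq0 n a b v : (forall i, (i <= n)%N -> v i = 0) ->
  band_form n a b v = 0.
Proof.
elim: n a b v => [|n IH] a b v v0; first by rewrite /band_form/= v0// !mulr0 addr0.
rewrite band_formS IH => [|i ni]; last exact: v0.
by rewrite !v0// expr0n !mulr0 !addr0.
Qed.

(** Completing the square in [v 0]: the form splits into the pivot times a square and
the form of the Schur complement. *)
Lemma band_posdef_schur n a b :
  band_posdef n.+1 a b <-> 0 < a 0%N /\ band_posdef n (schur a b) (shift b).
Proof.
split=> [pd|[a0 pd] v [i ni vi]].
  have a0 : 0 < a 0%N.
    have := pd (scons 1 (fun=> 0)) (ex_intro2 _ _ 0%N isT (oner_neq0 _)).
    by rewrite band_formS /= mulr0 expr1n mulr1 addr0 band_form_eq0// addr0.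
  split => // u [i ni ui].
  have := pd (scons (- (b 0%N / a 0%N * u 0%N)) u) (ex_intro2 _ _ i.+1 ni ui).
  by rewrite band_form_schur ?gt_eqF//= addNr expr0n mulr0 add0r.
rewrite band_form_schur ?gt_eqF//.
have sq0 : 0 <= a 0%N * (v 0%N + b 0%N / a 0%N * v 1%N) ^+ 2.
  by rewrite mulr_ge0 ?sqr_ge0// ltW.
have [[j nj vj]|nv] := pselect (exists2 j, (j <= n)%N & shift v j != 0).
  by rewrite ltr_wpDl// pd//; exists j.
have vS0 j : (j <= n)%N -> shift v j = 0.
  by move=> nj; apply: contra_notP nv => /eqP vj; exists j.
rewrite band_form_eq0// addr0 [v 1%N]vS0// mulr0 addr0 mulr_gt0//.
case: i ni vi => [_ v0|i ni]; last by rewrite [v i.+1]vS0// eqxx.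
by rewrite exprn_even_gt0.
Qed.

(** The squares of the decomposition obtained by completing them from the far end,
apart from the one carried by the pivot of vertex 0. *)
Fixpoint back_squares m a b v : R :=
  if m is m'.+1 then
    let e := back_pivot m' (shift a) (shift b) in
    e * (v 1%N + b 0%N / e * v 0%N) ^+ 2 +
    back_squares m' (shift a) (shift b) (shift v)
  else 0.

Lemma back_squares_ge0 m a b v : (if m is m'.+1 then back_pos m' (shift a) (shift b) else true) ->
  0 <= back_squares m a b v.
Proof.
elim: m a b v => [//|m IH] a b v bp /=.
apply: addr_ge0.
  by apply: mulr_ge0; [exact/ltW/back_pos_pivot|exact: sqr_ge0].
apply: IH; by case: (m) bp => // m'; rewrite back_posS => /andP[].
Qed.

Lemma band_form_squares m a b v :
  (if m is m'.+1 then back_pos m' (shift a) (shift b) else true) ->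
  band_form m a b v = back_pivot m a b * v 0%N ^+ 2 + back_squares m a b v.
Proof.
elim: m a b v => [|m IH] a b v bp; first by rewrite /band_form/= !addr0.
rewrite band_formS IH; last by case: (m) bp => // m'; rewrite back_posS => /andP[].
have e0 := back_pos_pivot bp.
rewrite back_pivotS /=; set e := back_pivot m _ _ in e0 *; set S := back_squares _ _ _ _.
by rewrite /shift; field; rewrite gt_eqF.
Qed.

(** The vector starting with [x] at which all the [back_squares] vanish. *)
Fixpoint square_kernel m a b (x : R) : nat -> R :=
  scons x (if m is m'.+1 then
    square_kernel m' (shift a) (shift b)
      (- (b 0%N / back_pivot m' (shift a) (shift b) * x))
    else fun=> 0).

Lemma square_kernel0 m a b x : square_kernel m a b x 0%N = x.
Proof. by case: m. Qed.

Lemma back_squares_kernel m a b x :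
  back_squares m a b (square_kernel m a b x) = 0.
Proof.
elim: m a b x => [//|m IH] a b x /=.
change (shift (scons _ ?f)) with f.
by rewrite square_kernel0 addNr expr0n mulr0 add0r IH.
Qed.

(** The sum of squares gives one direction; for the other, evaluating the form at a
[square_kernel] isolates the pivot of vertex 0. *)
Lemma back_pos_posdef m a b : back_pos m a b <-> band_posdef m a b.
Proof.
elim: m a b => [|m IH] a b.
  rewrite /= andbT; split=> [a0 v [[|//] _ v0]|pd].
    by rewrite /band_form/= addr0 mulr_gt0// -expr2 exprn_even_gt0.
  have := pd (fun=> 1) (ex_intro2 _ _ 0%N isT (oner_neq0 _)).
  by rewrite /band_form/= addr0 !mulr1.
rewrite back_posS; split=> [/andP[e0 bp] v [i mi vi]|pd].
  have [v0|v0] := eqVneq (v 0%N) 0.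
    rewrite band_formS v0 expr0n !(mulr0, mul0r) !add0r.
    move/IH : bp; apply; case: i mi vi => [|i] mi vi; last by exists i.
    by rewrite v0 eqxx in vi.
  rewrite band_form_squares// ltr_wpDr ?back_squares_ge0// mulr_gt0//.
  by rewrite exprn_even_gt0.
have bp : back_pos m (shift a) (shift b).
  apply/IH => u [i mi ui].
  have := pd (scons 0 u) (ex_intro2 _ _ i.+1 mi ui).
  by rewrite band_formS /= expr0n !(mulr0, mul0r) !add0r.
rewrite bp andbT.
have := pd (square_kernel m.+1 a b 1) (ex_intro2 _ _ 0%N isT (oner_neq0 _)).
by rewrite band_form_squares// back_squares_kernel addr0 square_kernel0 expr1n mulr1.
Qed.

Lemma pivots_pos_posdef k m a b : pivots_pos k m a b <-> band_posdef (k + m) a b.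
Proof.
elim: k a b => [|k IH] a b; first exact: back_pos_posdef.
rewrite pivots_posS addSn; split=> [/andP[a0 /IH pp]|/band_posdef_schur[-> /IH]//].
by apply/band_posdef_schur.
Qed.

End minors.

(** * Matrices of the path graph as band matrices *)

Section matrices.
Context {R : realType}.
Implicit Types (a b v : nat -> R) (i j k m N : nat).
Local Notation nth0 := (@nth R 0%R).

Lemma sum_band N a b (w : nat -> nat -> R) :
  \sum_(i < N.+1) \sum_(j < N.+1) band_entry a b i j * w i j = band_sum N a b w.
Proof.
elim: N a b w => [|N IH] a b w; first by rewrite !big_ord1 /= addr0.
rewrite big_ord_recl.
have -> : \sum_(j < N.+2) band_entry a b (@ord0 N.+1) j * w (@ord0 N.+1) j =
    a 0%N * w 0%N 0%N + b 0%N * w 0%N 1%N.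
  rewrite big_ord_recl big_ord_recl big1 ?addr0// => j _.
  by rewrite !lift0 /band_entry/= mul0r.
under eq_bigr => i _ do rewrite lift0 big_ord_recl.
rewrite big_split.
have -> : \sum_(i < N.+1) band_entry a b i.+1 (@ord0 N.+1) * w i.+1 (@ord0 N.+1) =
    b 0%N * w 1%N 0%N.
  rewrite big_ord_recl big1 ?addr0// => i _.
  by rewrite !lift0 /band_entry/= mul0r.
have -> : \sum_(i < N.+1) \sum_(j < N.+1)
    band_entry a b i.+1 (lift ord0 j) * w i.+1 (lift ord0 j) =
    band_sum N (shift a) (shift b) (fun i j => w i.+1 j.+1).
  by rewrite -IH; apply: eq_bigr => i _; apply: eq_bigr => j _; rewrite lift0.
by rewrite /= mulrDr !addrA.
Qed.

Lemma det_band m (A : 'M[R]_m) a b :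
  (forall i j : 'I_m, A i j = band_entry a b i j) -> \det A = band_minor m a b.
Proof.
have [n] := ubnP m; elim: n m A a b => // n IH [|[|m]] A a b mn AE.
- by rewrite det_mx00.
- by rewrite (mx11_scalar A) det_scalar1 AE band_minor1.
rewrite (expand_det_row _ ord0) big_ord_recl big_ord_recl big1 ?addr0; last first.
  by move=> j _; rewrite AE /band_entry/= /bump/= mul0r.
rewrite band_minorSS !AE /=; congr (_ + _).
  rewrite /cofactor/= expr0 mul1r; congr (_ * _).
  by apply: IH => // i j; rewrite !mxE AE.
rewrite /cofactor/= expr1 mulN1r (expand_det_col _ ord0) big_ord_recl big1 ?addr0; last first.
  by move=> j _; rewrite !mxE AE /band_entry/= /bump/= mul0r.
rewrite !mxE AE /cofactor/= expr0 mul1r expr2 mulrN mulrA; congr (- (_ * _)).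
by apply: IH => [|i j]; [lia|rewrite !mxE AE].
Qed.

(** A segment is enumerated increasingly, so that a principal submatrix on it is again
a band matrix. *)
Lemma val_enum_seg n i j : (0 < i)%N -> (j <= n)%N ->
  map val (enum (seg n i j)) = iota i.-1 (j - i.-1).
Proof.
move=> i0 jn; apply: (irr_sorted_eq ltn_trans ltnn).
- have -> : enum (seg n i j) = [seq x : 'I_n <- enum 'I_n | (i <= (val x).+1 <= j)%N].
    by rewrite [LHS]/enum_mem -enumT; apply: eq_filter => x; rewrite /= inE.
  rewrite -(filter_map val (fun k => (i <= k.+1 <= j)%N)) val_enum_ord.
  by apply: sorted_filter; [exact: ltn_trans|exact: iota_ltn_sorted].
- exact: iota_ltn_sorted.
- move=> k; rewrite mem_iota; apply/mapP/idP => [[x]|kij].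
    by rewrite mem_enum inE => xij -> /=; lia.
  have kn : (k < n)%N by lia.
  by exists (Ordinal kn) => //; rewrite mem_enum inE /=; lia.
Qed.

Lemma card_seg n i j : (0 < i)%N -> (j <= n)%N -> #|seg n i j| = (j - i.-1)%N.
Proof. by move=> i0 jn; rewrite cardE -(size_map val) val_enum_seg// size_iota. Qed.

Lemma enum_val_seg n i j (r : 'I_#|seg n i j|) : (0 < i)%N -> (j <= n)%N ->
  enum_val r = (i.-1 + r)%N :> nat.
Proof.
move=> i0 jn; have rj : (r < j - i.-1)%N by rewrite -(card_seg i0 jn).
have x0 : 'I_n := enum_val r.
rewrite (enum_val_nth x0) -(nth_map x0 0%N val) -?cardE//.
by rewrite val_enum_seg// nth_iota.
Qed.

Lemma path_mxE N (p : N.+1.-tuple R * N.-tuple R) (i j : 'I_N.+1) :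
  path_mx p i j = band_entry (nth0 p.1) (nth0 p.2) i j.
Proof. by rewrite mxE. Qed.

Lemma from_band_entry k a b i j :
  band_entry a b (k + i) (k + j) = band_entry (from k a) (from k b) i j.
Proof. by rewrite /band_entry -!addnS !eqn_add2l. Qed.

Lemma seg_minor_path_mx N (p : N.+1.-tuple R * N.-tuple R) i j :
  (0 < i)%N -> (j <= N.+1)%N ->
  seg_minor i j (path_mx p) =
  band_minor (j - i.-1) (from i.-1 (nth0 p.1)) (from i.-1 (nth0 p.2)).
Proof.
move=> i0 jN; rewrite -(card_seg i0 jN); apply: det_band => r t.
by rewrite mxE path_mxE !enum_val_seg// from_band_entry.
Qed.

Lemma gpower_path_mx k m (s : nat -> R) (p : (k + m).+1.-tuple R * (k + m).-tuple R) :
  gpower k.+1 s (path_mx p) = band_power k m (shift s) (nth0 p.1) (nth0 p.2).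
Proof.
rewrite /gpower /band_power; congr (_ * _ * _).
- rewrite big_add1 big_mkord; apply: eq_bigr => i _.
  by rewrite seg_minor_path_mx//; have := ltn_ord i; lia.
- by rewrite (det_band (path_mxE p)).
- rewrite -[k.+2]add0n big_addn big_mkord.
  have -> : ((k + m).+2 - k.+2 = m)%N by lia.
  apply: eq_bigr => j _.
  have -> : (j + k.+2 = (k + j).+2)%N by lia.
  rewrite seg_minor_path_mx//=.
  by have -> : ((k + m).+1 - (k + j).+1 = m - j)%N by lia.
Qed.

Lemma band_entry_sym a b i j : band_entry a b i j = band_entry a b j i.
Proof.
rewrite /band_entry eq_sym; case: eqP => [->//|_].
case: eqP => [->|_]; case: eqP => //; lia.
Qed.

Lemma path_mx_tr N (p : N.+1.-tuple R * N.-tuple R) : (path_mx p)^T = path_mx p.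
Proof. by apply/matrixP => i j; rewrite mxE !path_mxE band_entry_sym. Qed.

Lemma ZG_path_mx N (p : N.+1.-tuple R * N.-tuple R) : ZG (path_mx p).
Proof.
split; first exact: path_mx_tr.
move=> i j; rewrite /path_edge path_mxE /band_entry.
case: eqP => [->|]; first by rewrite leqnSn.
case: eqP => [e|_]; first by move=> _ /negP[]; lia.
by case: eqP => // e _ /negP[]; lia.
Qed.

Definition path_coords N (y : 'M[R]_N.+1) : N.+1.-tuple R * N.-tuple R :=
  ([tuple y i i | i < N.+1],
   [tuple y (widen_ord (leqnSn N) i) (lift ord0 i) | i < N]).

Lemma nth_path_coords1 N (y : 'M[R]_N.+1) (i : 'I_N.+1) :
  nth0 (path_coords y).1 i = y i i.
Proof. by rewrite -tnth_nth tnth_mktuple. Qed.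

Lemma nth_path_coords2 N (y : 'M[R]_N.+1) (i : 'I_N) :
  nth0 (path_coords y).2 i = y (widen_ord (leqnSn N) i) (lift ord0 i).
Proof. by rewrite -tnth_nth tnth_mktuple. Qed.

Lemma path_coordsK N (y : 'M[R]_N.+1) : ZG y -> path_mx (path_coords y) = y.
Proof.
move=> [ysym y0]; apply/matrixP => i j; rewrite path_mxE /band_entry.
have sym (c d : 'I_N.+1) : y c d = y d c by rewrite -[in LHS]ysym mxE.
case: eqP => [/val_inj ->|ij]; first exact: nth_path_coords1.
case: eqP => [ji|ji].
  have iN : (i < N)%N by have := ltn_ord j; lia.
  rewrite -[nat_of_ord i]/(nat_of_ord (Ordinal iN)) nth_path_coords2.
  by congr (y _ _); apply: val_inj.
case: eqP => [ij'|ij'].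
  have jN : (j < N)%N by have := ltn_ord i; lia.
  rewrite -[nat_of_ord j]/(nat_of_ord (Ordinal jN)) nth_path_coords2 sym.
  by congr (y _ _); apply: val_inj.
by rewrite y0// /path_edge; lia.
Qed.

Definition row_fun N (v : 'rV[R]_N.+1) : nat -> R := fun i => v ord0 (inord i).

Lemma path_mx_form N (p : N.+1.-tuple R * N.-tuple R) (v : 'rV[R]_N.+1) :
  (v *m path_mx p *m v^T) ord0 ord0 =
  band_form N (nth0 p.1) (nth0 p.2) (row_fun v).
Proof.
rewrite /band_form -sum_band mxE exchange_big/=; apply: eq_bigr => j _.
rewrite !mxE mulr_suml; apply: eq_bigr => i _.
rewrite path_mxE band_entry_sym /row_fun !inord_val; ring.
Qed.

Lemma PG_path_mx N (p : N.+1.-tuple R * N.-tuple R) :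
  PG (path_mx p) <-> band_posdef N (nth0 p.1) (nth0 p.2).
Proof.
split=> [[_ pd] v [i iN vi]|pd].
  pose w : 'rV[R]_N.+1 := \row_j v j.
  have w0 : w != 0.
    apply/eqP => /rowP/(_ (inord i)); rewrite !mxE inordK// => /eqP.
    by rewrite (negbTE vi).
  have := pd w w0; rewrite path_mx_form /band_form -!sum_band.
  congr (0 < _); apply: eq_bigr => k _; apply: eq_bigr => l _.
  by rewrite /row_fun !mxE !inord_val.
split; first exact: ZG_path_mx.
move=> v v0; rewrite path_mx_form; apply: pd.
have /existsP[i vi] : [exists i, v ord0 i != 0].
  apply: contraNT v0; rewrite negb_exists => /forallP v0.
  by apply/eqP/rowP => i; rewrite mxE; apply/eqP; rewrite -[_ == _]negbK v0.
by exists i; rewrite /row_fun ?inord_val// -ltnS.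
Qed.

Lemma mx_pairing_path_mx N (q p : N.+1.-tuple R * N.-tuple R) :
  mx_pairing (path_mx q) (path_mx p) =
  band_pairing N (nth0 q.1) (nth0 q.2) (nth0 p.1) (nth0 p.2).
Proof.
rewrite /mx_pairing /band_pairing -sum_band /mxtrace exchange_big/=.
under eq_bigr do rewrite mxE.
apply: eq_bigr => i _; apply: eq_bigr => j _.
by rewrite !path_mxE mulrC (band_entry_sym _ _ j) (band_entry_sym _ _ j).
Qed.

(** It is enough to test the form on vectors supported by one edge: for the minor of
the edge {0, 1} take the vector (be_0, - al_0), at which the form equals
al_0 (al_0 al_1 - be_0^2). *)
Lemma cliques_pos_form N (al be : nat -> R) :
  (forall k v, (forall i, (i != k) && (i != k.+1) -> v i = 0) ->
    (exists2 i, (i <= N)%N & v i != 0) -> 0 < band_form N al be v) ->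
  cliques_pos N al be.
Proof.
elim: N al be => [|N IH] al be form.
  have := form 0%N (fun i => (i == 0%N)%:R).
  rewrite /band_form /= addr0 !mulr1 andbT; apply.
    by move=> [|i] // /andP[].
  by exists 0%N => //=; rewrite oner_neq0.
have al0 : 0 < al 0%N.
  have := form 0%N (scons 1 (fun=> 0)).
  rewrite band_formS band_form_eq0// /= expr1n !mulr1 mulr0 !addr0; apply.
    by move=> [|i].
  by exists 0%N => //=; rewrite oner_neq0.
rewrite /= al0 /= IH ?andbT.
  have := form 0%N (scons (be 0%N) (scons (- al 0%N) (fun=> 0))).
  have -> : band_form N.+1 al be (scons (be 0%N) (scons (- al 0%N) (fun=> 0))) =
      al 0%N * (al 0%N * al 1%N - be 0%N ^+ 2).
    rewrite band_formS; case: (N) => [|N'].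
      rewrite /band_form /= /shift/=; ring.
    rewrite band_formS (@band_form_eq0 _ N')// /= /shift/=; ring.
  rewrite pmulr_rgt0//; apply; first by move=> [|[|i]].
  by exists 1%N => //=; rewrite oppr_eq0 gt_eqF.
move=> k v vk [i iN vi]; have := form k.+1 (scons 0 v).
rewrite band_formS /= expr0n !(mulr0, mul0r) !add0r; apply.
  by move=> [|j] //; rewrite !eqSS; exact: vk.
by exists i.+1.
Qed.

Lemma rank1_form N (x : 'M[R]_N) (v : 'rV[R]_N) :
  mx_pairing x (v^T *m v) = (v *m x *m v^T) ord0 ord0.
Proof. by rewrite /mx_pairing -mulmxA mxtrace_mulC trace_mx11. Qed.

Lemma row_sqr_gt0 N (w : 'rV[R]_N) : w != 0 -> 0 < (w *m w^T) ord0 ord0.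
Proof.
move=> w0; rewrite mxE; have sq (i : 'I_N) : 0 <= w ord0 i * w^T i ord0.
  by rewrite mxE -expr2 sqr_ge0.
rewrite lt0r sumr_ge0// andbT psumr_neq0//.
apply: contraNT w0 => /hasPn w0; apply/eqP/rowP => i.
have := w0 i; rewrite mem_index_enum => /(_ isT); rewrite mxE -expr2.
rewrite lt0r sqr_ge0 andbT negbK sqrf_eq0 mxE => /eqP //.
Qed.

(** v^T v + (e / 2) Id is positive definite and within e of v^T v. *)
Lemma rank1_closure_PG N (v : 'rV[R]_N.+1) :
  ZG (v^T *m v) -> closure (@PG R N.+1) (v^T *m v).
Proof.
move=> [vsym v0] B /nbhs_ballP[e /= e0 eB].
pose y : 'M[R]_N.+1 := v^T *m v + (e / 2)%:M.
have e20 : 0 < e / 2 by rewrite divr_gt0.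
exists y; split.
  split; first split.
  - by rewrite /y linearD/= vsym tr_scalar_mx.
  - move=> i j ij; rewrite mxE v0// mxE add0r.
    suff /negbTE-> : i != j by [].
    by apply: contraNneq ij => ->; rewrite /path_edge leqnSn.
  move=> w w0; rewrite /y mulmxDr mulmxDl mul_mx_scalar -scalemxAl mxE.
  rewrite [X in _ + X]mxE ltr_wpDl//.
    rewrite !mulmxA -mulmxA -[v *m w^T]trmxK trmx_mul trmxK.
    rewrite mxE big_ord1 [X in _ * X]mxE -expr2 sqr_ge0//.
  by rewrite mulr_gt0// row_sqr_gt0.
apply: eB; split => // i j; rewrite /y [X in ball _ _ X]mxE /ball/= opprD addNKr normrN.
rewrite mxE; case: (i == j); first by rewrite gtr0_norm// ltr_pdivrMr// ltr_pMr// ltr1n.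
by rewrite normr0.
Qed.

(** If v is supported by an edge, then v^T v is in Z_G and in the closure of P_G, so
that x in Q_G forces v x v^T > 0. *)
Lemma QG_cliques_pos N (q : N.+1.-tuple R * N.-tuple R) :
  QG (path_mx q) -> cliques_pos N (nth0 q.1) (nth0 q.2).
Proof.
move=> [_ qpos]; set al := nth0 q.1; set be := nth0 q.2.
apply: cliques_pos_form => k v vk [i iN vi]; pose w : 'rV[R]_N.+1 := \row_j v j.
have wE (i1 j1 : 'I_N.+1) : (w^T *m w) i1 j1 = v i1 * v j1.
  by rewrite mxE big_ord1 !mxE.
have <- : (w *m path_mx q *m w^T) ord0 ord0 = band_form N al be v.
  rewrite path_mx_form /band_form -!sum_band.
  apply: eq_bigr => i1 _; apply: eq_bigr => j1 _.
  by rewrite /row_fun !mxE !inord_val.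
rewrite -rank1_form; apply: qpos.
  apply: rank1_closure_PG; split; first by rewrite trmx_mul trmxK.
  move=> i1 j1; rewrite wE /path_edge => ij.
  have [i1k|i1k] := boolP ((nat_of_ord i1 != k) && (nat_of_ord i1 != k.+1)).
    by rewrite vk// mul0r.
  by rewrite [v j1]vk ?mulr0//; lia.
move=> /matrixP/(_ (inord i) (inord i)); rewrite wE mxE inordK// => /eqP.
by rewrite mulf_eq0 orbb (negbTE vi).
Qed.

End matrices.

(** * Inverses on vertices and edges *)

Section inverses.
Context {R : realType}.
Local Notation nth0 := (@nth R 0%R).

(** Characterises the inverse through full-size matrices, so that a candidate is checked
on its entries rather than on a submatrix indexed by a cardinal. *)
Lemma seg_inv_eq n i j (x Z : 'M[R]_n) :
  (forall c d, ~~ ((c \in seg n i j) && (d \in seg n i j)) -> Z c d = 0) ->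
  (forall c d, c \in seg n i j -> d \in seg n i j ->
     \sum_(e in seg n i j) x c e * Z e d = (c == d)%:R) ->
  seg_inv i j x = Z.
Proof.
set I := seg n i j => Z0 xZ.
pose K : 'M[R]_#|I| := mxsub enum_val enum_val Z.
have xK : principal_submx I x *m K = 1%:M.
  apply/matrixP => r t; rewrite !mxE -(inj_eq enum_val_inj) -xZ ?enum_valP//.
  by rewrite [RHS]big_enum_val; apply: eq_bigr => k _; rewrite !mxE.
have KE : invmx (principal_submx I x) = K.
  have [xu _] := mulmx1_unit xK.
  by rewrite -[LHS]mulmx1 -xK mulKmx.
rewrite /seg_inv KE /ext0 [RHS]matrix_sum_delta.
have sumI (F : 'I_n -> 'M[R]_n) : (forall c, c \notin I -> F c = 0) ->
    \sum_c F c = \sum_(r < #|I|) F (enum_val r).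
  move=> F0; transitivity (\sum_(c in I) F c); last exact: big_enum_val.
  by rewrite (bigID (mem I))/= [X in _ + X]big1 ?addr0.
rewrite sumI; last first.
  by move=> c cI; apply: big1 => d _; rewrite Z0 ?scale0r// (negbTE cI).
apply: eq_bigr => r _; rewrite sumI; last first.
  by move=> d dI; rewrite Z0 ?scale0r// (negbTE dI) andbF.
by apply: eq_bigr => t _; rewrite mxE.
Qed.

Lemma sum_pair n (e0 e1 : 'I_n) (F : 'I_n -> R) : e0 != e1 ->
  (forall c, c != e0 -> c != e1 -> F c = 0) -> \sum_c F c = F e0 + F e1.
Proof.
move=> e01 F0; rewrite (bigD1 e0)//= (bigD1 e1)/=; last by rewrite eq_sym.
by rewrite big1 ?addr0// => c /andP[ce0 ce1]; exact: F0.
Qed.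

Lemma mx_pairing_sum n (u y : 'M[R]_n) :
  mx_pairing u y = \sum_c \sum_d y c d * u d c.
Proof. by apply: eq_bigr => c _; rewrite mxE. Qed.

(** As u vanishes off the edges, discarding entries does not affect the pairing. *)
Lemma mx_pairing_quadrep n (u A w : 'M[R]_n) : ZG u ->
  mx_pairing u (quadrep A w) = \tr (A *m w *m A *m u).
Proof.
move=> [usym u0]; rewrite mx_pairing_sum; apply: eq_bigr => c _.
rewrite mxE; apply: eq_bigr => d _; rewrite mxE.
case: ifPn => // cd; rewrite [u d c]u0 ?mulr0//.
by move: cd; rewrite /path_edge andbC.
Qed.

Lemma quadrep_sym n (A u u' : 'M[R]_n) : ZG u -> ZG u' ->
  mx_pairing u (quadrep A u') = mx_pairing u' (quadrep A u).
Proof.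
move=> Zu Zu'; rewrite !mx_pairing_quadrep//.
by rewrite -mulmxA mxtrace_mulC mulmxA.
Qed.

Lemma ZG_quadrep n (A u : 'M[R]_n) : A^T = A -> ZG u -> ZG (quadrep A u).
Proof.
move=> Asym [usym u0]; split.
  have AuA : (A *m u *m A)^T = A *m u *m A by rewrite !trmx_mul Asym usym mulmxA.
  apply/matrixP => c d; rewrite mxE [LHS]mxE [RHS]mxE /path_edge andbC.
  by case: ifP => // _; rewrite -[in RHS]AuA [RHS]mxE.
by move=> c d /negbTE cd; rewrite mxE cd.
Qed.

Section on_path.
Variables (N : nat) (q : N.+1.-tuple R * N.-tuple R).
Let al := nth0 q.1.
Let be := nth0 q.2.
Local Notation x := (path_mx q).

Lemma seg_inv1 k : (k <= N)%N -> 0 < al k ->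
  seg_inv k.+1 k.+1 x = (al k)^-1 *: delta_mx (inord k) (inord k).
Proof.
move=> kN al0; have segE c : (c \in seg N.+1 k.+1 k.+1) = (c == inord k).
  by rewrite inE -val_eqE /= inordK//; lia.
apply: seg_inv_eq => c d; rewrite !segE.
  by rewrite !mxE => /negbTE->; rewrite mulr0.
move=> /eqP-> /eqP->; rewrite eqxx (big_pred1 (inord k)).
  by rewrite !mxE !eqxx/= mulr1 inordK// mulfV// gt_eqF.
by move=> c'; exact: segE.
Qed.

(** The inverse of a 2 x 2 symmetric matrix, placed on the edge {k, k + 1}. *)
Definition pair_inv k : 'M[R]_N.+1 :=
  (al k * al k.+1 - be k ^+ 2)^-1 *:
  (al k.+1 *: delta_mx (inord k) (inord k) + al k *: delta_mx (inord k.+1) (inord k.+1)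
   + (- be k) *: (delta_mx (inord k) (inord k.+1) + delta_mx (inord k.+1) (inord k))).

Lemma inord_pair k : (k < N)%N -> (inord k : 'I_N.+1) != inord k.+1.
Proof. by move=> kN; rewrite -val_eqE /= !inordK; lia. Qed.

Lemma seg_inv2 k : (k < N)%N -> 0 < al k * al k.+1 - be k ^+ 2 ->
  seg_inv k.+1 k.+2 x = pair_inv k.
Proof.
move=> kN D0; have e01 := inord_pair kN; have e10 : (inord k.+1 : 'I_N.+1) != inord k.
  by rewrite eq_sym.
have D0' : al k * al k.+1 - be k ^+ 2 != 0 by rewrite gt_eqF.
have segE c : (c \in seg N.+1 k.+1 k.+2) = (c == inord k) || (c == inord k.+1).
  by rewrite inE -!val_eqE /= !inordK//; lia.
have k0 : nat_of_ord (inord k : 'I_N.+1) = k by rewrite inordK//; lia.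
have k1 : nat_of_ord (inord k.+1 : 'I_N.+1) = k.+1 by rewrite inordK//.
have sumE (F : 'I_N.+1 -> R) : \sum_(e in seg N.+1 k.+1 k.+2) F e = F (inord k) + F (inord k.+1).
  rewrite (bigD1 (inord k)) ?segE ?eqxx//= (bigD1 (inord k.+1)) ?segE ?eqxx ?orbT//=.
  rewrite big1 ?addr0// => e; rewrite segE; case/andP=> /andP[/orP[]/eqP-> /eqP//].
  by move=> _ /eqP.
have x00 : x (inord k) (inord k) = al k by rewrite path_mxE /band_entry eqxx k0.
have x11 : x (inord k.+1) (inord k.+1) = al k.+1 by rewrite path_mxE /band_entry eqxx k1.
have x01 : x (inord k) (inord k.+1) = be k.
  by rewrite path_mxE /band_entry k0 k1 eqxx; case: eqP => //; lia.
have x10 : x (inord k.+1) (inord k) = be k.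
  by rewrite path_mxE band_entry_sym /band_entry k0 k1 eqxx; case: eqP => //; lia.
apply: seg_inv_eq => c d; rewrite !segE.
  rewrite !mxE; case: (c == inord k); case: (c == inord k.+1);
  by case: (d == inord k); case: (d == inord k.+1) => //= _; ring.
rewrite sumE.
by move=> /orP[]/eqP-> /orP[]/eqP->; rewrite ?x00 ?x01 ?x10 ?x11 !mxE !eqxx
  ?(negbTE e01) ?(negbTE e10) /=; field.
Qed.

(** A matrix supported on a pair of indices reduces the trace to sixteen terms. *)
Lemma trace_pair n (e0 e1 : 'I_n) (A w u : 'M[R]_n) : e0 != e1 ->
  (forall c d, ~~ (((c == e0) || (c == e1)) && ((d == e0) || (d == e1))) -> A c d = 0) ->
  \tr (A *m w *m A *m u) =
  \sum_(c <- [:: e0; e1]) \sum_(d <- [:: e0; e1]) \sum_(e <- [:: e0; e1])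
    \sum_(f <- [:: e0; e1]) A c f * w f e * A e d * u d c.
Proof.
move=> e01 A0; have A0l c d : c != e0 -> c != e1 -> A c d = 0.
  by move=> /negbTE c0 /negbTE c1; rewrite A0// c0 c1.
have A0r c d : d != e0 -> d != e1 -> A c d = 0.
  by move=> /negbTE c0 /negbTE c1; rewrite A0// c0 c1 andbF.
have sumE (F : 'I_n -> R) : (forall c, c != e0 -> c != e1 -> F c = 0) ->
    \sum_c F c = \sum_(c <- [:: e0; e1]) F c.
  by move=> F0; rewrite (sum_pair e01)// !big_cons big_nil addr0.
have E1 c d : (A *m w) c d = \sum_(f <- [:: e0; e1]) A c f * w f d.
  by rewrite mxE sumE// => f f0 f1; rewrite A0r// mul0r.
have E2 c d : (A *m w *m A) c d =
    \sum_(e <- [:: e0; e1]) \sum_(f <- [:: e0; e1]) A c f * w f e * A e d.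
  rewrite mxE sumE => [|f f0 f1]; last by rewrite A0l// mulr0.
  by apply: eq_bigr => e _; rewrite E1 mulr_suml.
rewrite /mxtrace sumE => [|c c0 c1].
  apply: eq_bigr => c _; rewrite mxE sumE => [|d d0 d1].
    apply: eq_bigr => d _; rewrite E2 mulr_suml; apply: eq_bigr => e _.
    by rewrite mulr_suml.
  by rewrite E2 big1 ?mul0r// => e _; rewrite big1// => f _; rewrite (A0r e d)// mulr0.
rewrite mxE big1// => d _; rewrite E2 big1 ?mul0r// => e _; rewrite big1// => f _.
by rewrite A0l// !mul0r.
Qed.

Section pairings.
Variable r : N.+1.-tuple R * N.-tuple R.
Let ua := nth0 r.1.
Let ub := nth0 r.2.
Local Notation u := (path_mx r).

Lemma pair_entries k : (k < N)%N ->
  [/\ u (inord k) (inord k) = ua k, u (inord k.+1) (inord k.+1) = ua k.+1,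
      u (inord k) (inord k.+1) = ub k & u (inord k.+1) (inord k) = ub k].
Proof.
move=> kN; have k0 : nat_of_ord (inord k : 'I_N.+1) = k by rewrite inordK//; lia.
have k1 : nat_of_ord (inord k.+1 : 'I_N.+1) = k.+1 by rewrite inordK//.
split; rewrite path_mxE ?(band_entry_sym _ _ _ (inord k)) /band_entry ?k0 ?k1 ?eqxx//.
- by case: eqP => //; lia.
- by case: eqP => //; lia.
Qed.

Lemma mx_pairingZ (c : R) n (v y : 'M[R]_n) : mx_pairing v (c *: y) = c * mx_pairing v y.
Proof. by rewrite /mx_pairing -scalemxAl mxtraceZ. Qed.

Lemma mx_pairingD n (v y z : 'M[R]_n) : mx_pairing v (y + z) = mx_pairing v y + mx_pairing v z.
Proof. by rewrite /mx_pairing mulmxDl mxtraceD. Qed.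

Lemma mx_pairing_delta n (v : 'M[R]_n) c d : mx_pairing v (delta_mx c d) = v d c.
Proof.
rewrite mx_pairing_sum (bigD1 c)//= (bigD1 d)//= mxE !eqxx mul1r.
rewrite [X in _ + X + _]big1 ?addr0 => [|e /negbTE ed]; last by rewrite mxE ed andbF mul0r.
by rewrite big1 ?addr0// => e /negbTE ec; rewrite big1// => f _; rewrite mxE ec mul0r.
Qed.

Lemma mx_pairing_seg_inv1 k : (k <= N)%N -> 0 < al k ->
  mx_pairing u (seg_inv k.+1 k.+1 x) = ua k / al k.
Proof.
move=> kN al0; rewrite seg_inv1// mx_pairingZ mx_pairing_delta path_mxE.
by rewrite /band_entry eqxx inordK// mulrC.
Qed.

(** The right-hand side is minus the logarithmic derivative at t = 0 of the minor of
x - t u on the edge, and in [mx_pairing_quadrep_seg_inv2] the second derivative of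
minus its logarithm. *)
Lemma mx_pairing_seg_inv2 k : (k < N)%N -> 0 < al k * al k.+1 - be k ^+ 2 ->
  mx_pairing u (seg_inv k.+1 k.+2 x) =
  (ua k * al k.+1 + al k * ua k.+1 - 2 * be k * ub k) / (al k * al k.+1 - be k ^+ 2).
Proof.
move=> kN D0; have [u00 u11 u01 u10] := pair_entries kN.
rewrite seg_inv2// /pair_inv.
rewrite !(mx_pairingZ, mx_pairingD, mx_pairing_delta) u00 u01 u10 u11.
by field; rewrite gt_eqF.
Qed.

Lemma mx_pairing_quadrep_seg_inv1 k : (k <= N)%N -> 0 < al k ->
  mx_pairing u (quadrep (seg_inv k.+1 k.+1 x) u) = (ua k / al k) ^+ 2.
Proof.
move=> kN al0; rewrite mx_pairing_quadrep ?seg_inv1//; last exact: ZG_path_mx.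
have uE : u (inord k) (inord k) = ua k by rewrite path_mxE /band_entry eqxx inordK.
set c := (al k)^-1; set E := delta_mx _ _.
have -> : (c *: E) *m u *m (c *: E) *m u = (c ^+ 2) *: (E *m (u *m E *m u)).
  by rewrite -!scalemxAl -!scalemxAr -!scalemxAl scalerA expr2 !mulmxA.
rewrite mxtraceZ -/(mx_pairing (u *m E *m u) E) mx_pairing_delta.
have -> : (u *m E *m u) (inord k) (inord k) = ua k ^+ 2.
  rewrite mxE (bigD1 (inord k))//= big1 ?addr0; last first.
    move=> c' /negbTE c'k; rewrite mxE big1 ?mul0r// => d _.
    by rewrite [X in _ * X]mxE c'k andbF mulr0.
  rewrite mxE (bigD1 (inord k))//= big1 ?addr0; last first.
    by move=> c' /negbTE c'k; rewrite [X in _ * X]mxE c'k mulr0.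
  by rewrite [X in _ * X * _]mxE !eqxx mulr1 uE expr2.
by rewrite exprMn exprVn mulrC.
Qed.

Lemma mx_pairing_quadrep_seg_inv2 k : (k < N)%N -> 0 < al k * al k.+1 - be k ^+ 2 ->
  mx_pairing u (quadrep (seg_inv k.+1 k.+2 x) u) =
  ((ua k * al k.+1 + al k * ua k.+1 - 2 * be k * ub k) / (al k * al k.+1 - be k ^+ 2)) ^+ 2
  - 2 * (ua k * ua k.+1 - ub k ^+ 2) / (al k * al k.+1 - be k ^+ 2).
Proof.
move=> kN D0; have e01 := inord_pair kN; have [u00 u11 u01 u10] := pair_entries kN.
have e10 : (inord k.+1 : 'I_N.+1) != inord k by rewrite eq_sym.
rewrite mx_pairing_quadrep ?seg_inv2//; last exact: ZG_path_mx.
rewrite (trace_pair _ _ e01); last first.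
  move=> c d; rewrite !mxE; case: (c == inord k); case: (c == inord k.+1);
  by case: (d == inord k); case: (d == inord k.+1) => //= _; ring.
rewrite !big_cons !big_nil u00 u01 u10 u11 !mxE !eqxx (negbTE e01) (negbTE e10) /=.
by field; rewrite gt_eqF.
Qed.

Lemma seg_inv1_sym k : (k <= N)%N -> 0 < al k ->
  (seg_inv k.+1 k.+1 x)^T = seg_inv k.+1 k.+1 x.
Proof. by move=> kN al0; rewrite seg_inv1// linearZ/= trmx_delta. Qed.

Lemma seg_inv2_sym k : (k < N)%N -> 0 < al k * al k.+1 - be k ^+ 2 ->
  (seg_inv k.+1 k.+2 x)^T = seg_inv k.+1 k.+2 x.
Proof.
move=> kN D0; rewrite seg_inv2// /pair_inv; apply/matrixP => c d; rewrite !mxE.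
by case: (c == inord k); case: (c == inord k.+1); case: (d == inord k);
  case: (d == inord k.+1) => //=; ring.
Qed.

Lemma path_edge_seg_inv1 k c d : (k <= N)%N -> 0 < al k -> ~~ path_edge c d ->
  seg_inv k.+1 k.+1 x c d = 0.
Proof.
move=> kN al0 cd; rewrite seg_inv1// !mxE; case: eqP => [ck|]; last by rewrite mulr0.
case: eqP => [dk|]; last by rewrite mulr0.
by move: cd; rewrite ck dk /path_edge leqnSn.
Qed.

Lemma path_edge_seg_inv2 k c d : (k < N)%N -> 0 < al k * al k.+1 - be k ^+ 2 ->
  ~~ path_edge c d -> seg_inv k.+1 k.+2 x c d = 0.
Proof.
move=> kN D0; rewrite seg_inv2// /pair_inv !mxE /path_edge -!val_eqE /= !inordK//; last by lia.
move=> cd; have -> : (c == k :> nat) && (d == k :> nat) = false by lia.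
have -> : (c == k.+1 :> nat) && (d == k.+1 :> nat) = false by lia.
have -> : (c == k :> nat) && (d == k.+1 :> nat) = false by lia.
have -> : (c == k.+1 :> nat) && (d == k :> nat) = false by lia.
by rewrite !(mulr0, addr0).
Qed.

End pairings.
End on_path.
End inverses.

(** * Moments from the moment generating function *)

Lemma is_derive_mulr {R : realType} (c t : R) : is_derive t 1 (fun t => t * c) c.
Proof.
have := is_deriveZ c (@is_derive_id _ _ t 1); rewrite [c *: _]mulr1.
by congr (is_derive _ _ _ _); apply/funext => u /=; exact: mulrC.
Qed.

Section moments.
Context d (T : measurableType d) {R : realType} (P : probability T R).
Variables (X : T -> R) (mX : measurable_fun [set: T] X).
Variables (dl : R) (psi psi1 : R -> R) (psi2 : R).
Hypotheses (dl0 : 0 < dl)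
  (mgfE : forall t, `|t| < dl ->
     (\int[P]_w (expR (t * X w))%:E = (expR (psi t))%:E)%E)
  (dpsi : forall t : R, `|t| < dl -> is_derive t 1 psi (psi1 t))
  (dpsi1 : is_derive (0 : R) 1 psi1 psi2).

Let I : set R := `]- (dl / 4), (dl / 4)[.

Let I_small t : I t -> `|t| < dl / 4.
Proof. by rewrite /I/= in_itv/= ltr_norml. Qed.

Let e : R := dl / 4.

Let e0 : 0 < e. Proof. by rewrite divr_gt0. Qed.

Let integrable_exp t : `|t| < dl -> P.-integrable setT (fun w => (expR (t * X w))%:E).
Proof.
move=> tdl; apply/integrableP; split.
  by apply/measurable_EFinP; apply: measurableT_comp => //; exact: measurable_funM.
under eq_integral do rewrite gee0_abs ?lee_fin ?expR_ge0//.
by rewrite mgfE// ltry.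
Qed.

(** Dominates |X|^n exp (t X) for n <= 2 and |t| < e: one factor exp (e |X|) absorbs
exp (t X), n further ones absorb e^n |X|^n, and exp (3 e |X|) is at most the sum of
the two exponentials, which are integrable as 3 e < dl. *)
Definition moment_bound (n : nat) (w : T) : R :=
  e ^- n * (expR (3 * e * X w) + expR (- (3 * e) * X w)).

Let small3 : `|3 * e| < dl.
Proof. rewrite gtr0_norm ?mulr_gt0// /e; have := dl0; lra. Qed.

Let integrable_moment_bound n : P.-integrable setT (EFin \o moment_bound n).
Proof.
rewrite /moment_bound.
have -> : EFin \o (fun w => e ^- n * (expR (3 * e * X w) + expR (- (3 * e) * X w))) =
  (fun w => (e ^- n)%:E * ((expR (3 * e * X w))%:E + (expR (- (3 * e) * X w))%:E))%E.
  by apply/funext => w /=; rewrite EFinM EFinD.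
apply: integrableZl => //; apply: integrableD => //; apply: integrable_exp => //.
by rewrite normrN.
Qed.

Let moment_le (n : nat) t w : (n <= 2)%N -> I t ->
  `|X w ^+ n * expR (t * X w)| <= moment_bound n w.
Proof.
move=> n2 /I_small te; set y := X w.
have h1 : `|y| <= e^-1 * expR (e * `|y|).
  rewrite ler_pdivlMl// (le_trans _ (expR_ge1Dx _))// lerDr//.
have h2 : expR (t * y) <= expR (e * `|y|).
  rewrite ler_expR (le_trans (ler_norm _))// normrM ler_wpM2r// ltW//.
rewrite normrM normrX [X in _ * X]ger0_norm ?expR_ge0//.
set E := expR (e * `|y|) in h1 h2 *.
have E1 : 1 <= E by rewrite -expR0 ler_expR mulr_ge0// ltW.
have E0 : 0 <= E by rewrite (le_trans ler01).
have h3 : `|y| ^+ n <= (e^-1 * E) ^+ n.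
  by rewrite lerXn2r ?nnegrE ?normr_ge0 ?mulr_ge0 ?invr_ge0 ?(ltW e0).
have h4 : E ^+ n.+1 <= expR (3 * e * `|y|).
  by rewrite -mulrA expRM_natl ler_weXn2l.
have n0 : 0 <= `|y| ^+ n by rewrite exprn_ge0.
apply: (le_trans (ler_pM n0 (expR_ge0 _) h3 h2)).
rewrite exprMn exprVn -mulrA -exprSr /moment_bound -/y ler_wpM2l ?invr_ge0 ?exprn_ge0 ?(ltW e0)//.
apply: (le_trans h4).
have [y0|y0] := leP 0 y; first by rewrite (ger0_norm y0) lerDl expR_ge0.
by rewrite (ltr0_norm y0) mulrN -mulNr lerDr expR_ge0.
Qed.

Let integrable_moment n t : (n <= 2)%N -> I t ->
  P.-integrable setT (fun w => (X w ^+ n * expR (t * X w))%:E).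
Proof.
move=> n2 It; apply: (le_integrable measurableT _ _ (integrable_moment_bound n)) => //.
  apply/measurable_EFinP/measurable_funM; first exact: measurable_funX.
  by apply: measurableT_comp => //; exact: measurable_funM.
move=> w _; rewrite /= lee_fin; apply: (le_trans (moment_le w n2 It)).
exact: ler_norm.
Qed.

Let moment n t : R := (\int[P]_w (X w ^+ n * expR (t * X w)))%R.

Let is_derive_moment_fun n w (t : R) :
  is_derive t 1 (fun t => X w ^+ n * expR (t * X w)) (X w ^+ n.+1 * expR (t * X w)).
Proof.
have := is_deriveZ (X w ^+ n) (@is_derive1_comp _ expR
  (fun t => t * X w) t _ _ (is_derive_expR (t * X w)) (is_derive_mulr (X w) t)).
have -> : X w ^+ n *: (expR (t * X w) * X w) = X w ^+ n.+1 * expR (t * X w).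
  by rewrite exprSr /GRing.scale/= -mulrA [X w * _]mulrC.
exact.
Qed.

Let in_I0 : I 0. Proof. by rewrite /I/= in_itv/= oppr_lt0 e0. Qed.

Let near_I t : I t -> \forall t' \near t, I t'.
Proof. by move=> It; apply: near_in_itvoo; rewrite inE. Qed.

(** Differentiation under the integral sign, dominated by [moment_bound]. *)
Let is_derive_moment n t : (n < 2)%N -> I t ->
  is_derive t 1 (moment n) (moment n.+1 t).
Proof.
move=> n2 It.
have intf t' : I t' -> P.-integrable setT (EFin \o (fun w => X w ^+ n * expR (t' * X w))).
  by move=> It'; apply: integrable_moment => //; exact: ltnW.
have derf t' w : I t' -> setT w ->
    derivable (fun t : R => X w ^+ n * expR (t * X w)) t' 1.
  by move=> _ _; have [] := is_derive_moment_fun n w t'.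
have parE t' w : partial1of2 (fun (t : R) w => X w ^+ n * expR (t * X w)) t' w =
    X w ^+ n.+1 * expR (t' * X w).
  by rewrite partial1of2E; have [] := is_derive_moment_fun n w t'.
have G0 w : 0 <= moment_bound n.+1 w.
  by rewrite /moment_bound mulr_ge0 ?addr_ge0 ?expR_ge0// invr_ge0 exprn_ge0// ltW.
have Gub t' w : I t' -> setT w ->
    `|partial1of2 (fun (t : R) w => X w ^+ n * expR (t * X w)) t' w| <= moment_bound n.+1 w.
  by move=> It' _; rewrite parE; exact: moment_le.
apply: DeriveDef.
  exact: (derivable_under_integral measurableT It intf derf G0
    (integrable_moment_bound n.+1) Gub).
rewrite -derive1E (differentiation_under_integral measurableT It intf derf G0
    (integrable_moment_bound n.+1) Gub).
by apply: eq_Rintegral => w _; rewrite parE.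
Qed.

Let moment0E (t : R) : `|t| < dl -> moment 0 t = expR (psi t).
Proof.
move=> tdl; rewrite /moment /Rintegral; under eq_integral do rewrite expr0 mul1r.
by rewrite mgfE.
Qed.

Let I_dl t : I t -> `|t| < dl.
Proof. by move=> /I_small /lt_trans; apply; rewrite ltr_pdivrMr// ltr_pMr// ltr1n. Qed.

Let is_derive_exp_psi (t : R) : `|t| < dl ->
  is_derive t 1 (expR \o psi) (psi1 t * expR (psi t)).
Proof.
move=> tdl; rewrite mulrC; apply: is_derive1_comp; exact: dpsi.
Qed.

Let moment1E t : I t -> moment 1 t = psi1 t * expR (psi t).
Proof.
move=> It; have /@derive_val <- := is_derive_moment (ltn0Sn 1) It.
have /@derive_val <- := is_derive_exp_psi (I_dl It).
apply: near_eq_derive; near=> t'.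
by rewrite moment0E//; apply: I_dl; near: t'; exact: near_I.
Unshelve. all: by end_near. Qed.

Let exp_psi0 : expR (psi 0) = 1.
Proof.
rewrite -moment0E ?normr0// /moment /Rintegral.
under eq_integral do rewrite expr0 mul0r expR0 mulr1.
by rewrite integral_cst// mul1e [X in fine X](@probability_setT _ _ _ P).
Qed.

(** The second derivative of exp psi at 0, where exp psi = 1. *)
Let moment2E : moment 2 0 = psi2 + psi1 0 ^+ 2.
Proof.
have /@derive_val <- := is_derive_moment (ltnSn 1) in_I0.
have d0 : `|0 : R| < dl by rewrite normr0.
have /@derive_val := is_deriveM dpsi1 (is_derive_exp_psi d0).
rewrite /GRing.scale/= exp_psi0 mulr1 mul1r addrC -expr2 => <-.
apply: near_eq_derive; near=> t'.
by rewrite moment1E//; near: t'; exact: near_I.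
Unshelve. all: by end_near. Qed.

Lemma mgf_integrable : P.-integrable setT (EFin \o X).
Proof.
have := integrable_moment (leqnSn 1) in_I0.
by under eq_fun do rewrite expr1 mul0r expR0 mulr1.
Qed.

Lemma mgf_integrable_sqr : P.-integrable setT (EFin \o (fun w => X w ^+ 2)).
Proof.
have := integrable_moment (leqnn 2) in_I0.
by under eq_fun do rewrite mul0r expR0 mulr1.
Qed.

Lemma mgf_expectation : ('E_P[X] = (psi1 0)%:E)%E.
Proof.
rewrite unlock -[psi1 0]mulr1 -exp_psi0 -moment1E// /moment /Rintegral fineK.
  by apply: eq_integral => w _; rewrite expr1 mul0r expR0 mulr1.
apply: integrable_fin_num => //; exact: integrable_moment.
Qed.

Lemma mgf_expectation_sqr : ('E_P[fun w => (X w ^+ 2)%R] = (psi2 + psi1 0 ^+ 2)%:E)%E.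
Proof.
rewrite unlock -moment2E /moment /Rintegral fineK.
  by apply: eq_integral => w _; rewrite mul0r expR0 mulr1.
apply: integrable_fin_num => //; exact: integrable_moment.
Qed.

End moments.
(** * Measures given by a density *)

Section density.
Local Open Scope ereal_scope.
Import HBNNSimple.
Context d (T : measurableType d) {R : realType}.
Variables (mu nu : {measure set T -> \bar R}) (g : T -> R).
Hypotheses (mg : measurable_fun [set: T] g) (g0 : forall x, (0 <= g x)%R)
  (nuE : forall A, measurable A -> nu A = \int[mu]_(x in A) (g x)%:E).

(** Both sides are limits along simple functions increasing to [h], for which the
identity follows from the formula for [nu] on the level sets. *)
Lemma ge0_integral_density (h : T -> \bar R) :
  measurable_fun [set: T] h -> (forall x, 0 <= h x) ->
  \int[nu]_x h x = \int[mu]_x (h x * (g x)%:E).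
Proof.
move=> mh h0; pose h_ := nnsfun_approx measurableT mh.
have hcvg x : (h_ n x)%:E @[n --> \oo] --> h x.
  by apply: cvg_nnsfun_approx => // y _; exact: h0.
have mg' : measurable_fun setT (fun x => (g x)%:E) by exact/measurable_EFinP.
transitivity (limn (fun n => \int[nu]_x (h_ n x)%:E)).
  rewrite -monotone_convergence//.
  - by apply: eq_integral => x _; apply/esym/cvg_lim.
  - by move=> n; exact/measurable_EFinP/measurable_funP.
  - by move=> n x _; rewrite lee_fin.
  - by move=> x _ m n mn; rewrite lee_fin; exact/lefP/nd_nnsfun_approx.
transitivity (limn (fun n => \int[mu]_x ((h_ n x)%:E * (g x)%:E))); last first.
  rewrite -monotone_convergence//.
  - apply: eq_integral => x _; apply/cvg_lim => //.
    by apply: cvgeZr => //; exact: hcvg.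
  - by move=> n; apply: emeasurable_funM => //; exact/measurable_EFinP/measurable_funP.
  - by move=> n x _; rewrite mule_ge0// lee_fin.
  - move=> x _ m n mn; rewrite lee_wpmul2r ?lee_fin//.
    exact/lefP/nd_nnsfun_approx.
congr (limn _); apply/funext => n.
transitivity (\int[nu]_x
   (\sum_(y \in range (h_ n)) (y * \1_(h_ n @^-1` [set y]) x)%:E)).
  by apply: eq_integral => t tE; rewrite /= fimfunE -fsumEFin.
have indich r : measurable_fun setT (fun x => (r * \1_(h_ n @^-1` [set r]) x)%:E).
  by apply/measurable_EFinP; exact: measurable_funM.
rewrite ge0_integral_fsum//; last by move=> y x _; exact: nnfun_muleindic_ge0.
transitivity (\int[mu]_x (\sum_(y \in range (h_ n))
    (y * \1_(h_ n @^-1` [set y]) x)%:E * (g x)%:E)); last first.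
  apply: eq_integral => x xE.
  rewrite -ge0_mule_fsuml => [|y]; last exact: nnfun_muleindic_ge0.
  by rewrite fsumEFin // -(fimfunE _ x).
rewrite ge0_integral_fsum//; last 2 first.
  - by move=> y; apply: emeasurable_funM.
  - move=> y x _; apply: mule_ge0; last by rewrite lee_fin.
    by rewrite EFinM nnfun_muleindic_ge0.
apply: eq_fsbigr => r rhn.
under eq_integral do rewrite EFinM.
rewrite integralZl_indic_nnsfun//.
under [RHS]eq_integral do rewrite EFinM -muleA.
rewrite ge0_integralZl//.
- under [in RHS]eq_integral do rewrite muleC.
  rewrite [in RHS](eq_integral ((fun x => (g x)%:E) \_ (h_ n @^-1` [set r]))); last first.
    by move=> x xE; rewrite epatch_indic.
  by rewrite -integral_mkcond integral_indic// setIT nuE.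
- by apply: emeasurable_funM => //; exact/measurable_EFinP.
- by move=> t _; rewrite mule_ge0 ?lee_fin.
- by move: rhn; rewrite inE => -[t _ <-]; rewrite lee_fin.
Qed.

End density.

(** * The linear combination of cliques *)

Section combination.
Context {R : realType}.
Implicit Types (s : nat -> R) (i j k m N : nat).

(** The combination shared by - log Z (up to a constant), the mean and the
covariance: [L1 i] stands for the term of vertex i and [L2 i] for that of the edge
{i, i + 1}.  An edge enters
with the index s of its end away from M, together with minus the term of its end
nearer to M; the vertex M itself enters with s_M + 1. *)
Definition wishart_comb (V : lmodType R) k m s (L1 L2 : nat -> V) : V :=
  \sum_(i < k) ((s i + 3 / 2) *: L2 i - (s i + 1) *: L1 i.+1) +
  (s k + 1) *: L1 k +
  \sum_(j < m) ((s (k + j).+1 + 3 / 2) *: L2 (k + j)%N -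
                (s (k + j).+1 + 1) *: L1 (k + j)%N).

(** The vertex M is the inner end of two edges, whence its coefficient
(s_M + 1) - (s_{M-1} + 1) - (s_{M+1} + 1).  When M is an end of the path one of
these edges is absent, and the value -1 of s_0 or s_{n+1} cancels its term. *)
Lemma wishart_combE (V : lmodType R) k m s (F : nat -> nat -> V) :
  s 0%N = -1 -> s (k + m).+2 = -1 ->
  \sum_(1 <= i < k.+1) (s i + 3 / 2) *: F i i.+1
  + \sum_(k.+2 <= i < (k + m).+2) (s i + 3 / 2) *: F i.-1 i
  - \sum_(2 <= i < k.+1) (s i.-1 + 1) *: F i i
  - (s k - s k.+1 + s k.+2 + 1) *: F k.+1 k.+1
  - \sum_(k.+2 <= i < (k + m).+1) (s i.+1 + 1) *: F i i =
  wishart_comb k m (shift s) (fun i => F i.+1 i.+1) (fun i => F i.+1 i.+2).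
Proof.
move=> s0 sn; rewrite /wishart_comb !sumrB.
have E1 : \sum_(i < k) (shift s i + 1) *: F i.+2 i.+2 =
    \sum_(2 <= i < k.+1) (s i.-1 + 1) *: F i i + (s k + 1) *: F k.+1 k.+1.
  case: k sn => [|k] sn.
    by rewrite big_ord0 big_geq// s0 addNr scale0r addr0.
  rewrite big_ord_recr/= big_add1 big_add1 big_mkord; congr (_ + _).
have E2 : \sum_(j < m) (shift s (k + j).+1 + 1) *: F (k + j).+1 (k + j).+1 =
    \sum_(k.+2 <= i < (k + m).+1) (s i.+1 + 1) *: F i i + (s k.+2 + 1) *: F k.+1 k.+1.
  case: m sn => [|m] sn.
    rewrite addn0 in sn; by rewrite big_ord0 addn0 big_geq// sn addNr scale0r addr0.
  rewrite big_ord_recl addn0 addrC; congr (_ + _).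
  rewrite -[k.+2]add0n big_addn big_mkord.
  have -> : ((k + m.+1).+1 - k.+2 = m)%N by lia.
  apply: eq_bigr => j _; rewrite lift0.
  by have -> : (k + j.+1).+1 = (j + k.+2)%N by lia.
have E3 : \sum_(i < k) (shift s i + 3 / 2) *: F i.+1 i.+2 =
    \sum_(1 <= i < k.+1) (s i + 3 / 2) *: F i i.+1.
  by rewrite big_add1 big_mkord.
have E4 : \sum_(j < m) (shift s (k + j).+1 + 3 / 2) *: F (k + j).+1 (k + j).+2 =
    \sum_(k.+2 <= i < (k + m).+2) (s i + 3 / 2) *: F i.-1 i.
  rewrite -[k.+2]add0n big_addn big_mkord.
  have -> : ((k + m).+2 - k.+2 = m)%N by lia.
  apply: eq_bigr => j _.
  by have -> : (j + k.+2 = (k + j).+2)%N by lia.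
rewrite E1 E2 E3 E4 {E1 E2 E3 E4}.
set A := \sum_(1 <= i < _) _; set B := \sum_(k.+2 <= i < (k + m).+2) _.
set C := \sum_(2 <= i < _) _; set D := \sum_(k.+2 <= i < _) _.
set G := F k.+1 k.+1.
have -> : (s k - s k.+1 + s k.+2 + 1) *: G =
    (s k + 1) *: G - (shift s k + 1) *: G + (s k.+2 + 1) *: G.
  by rewrite -scalerBl -scalerDl; congr (_ *: _); rewrite /shift; ring.
move: (_ *: G) (_ *: G) (_ *: G) => X Y Z.
rewrite !opprD !opprK !addrA.
by rewrite [LHS](ACl (1*3*4*5*2*7*6)).
Qed.

Lemma wishart_comb_linear (V W : lmodType R) (f : V -> W) k m s (L1 L2 : nat -> V) :
  (forall x y, f (x + y) = f x + f y) -> (forall c x, f (c *: x) = c *: f x) ->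
  f (wishart_comb k m s L1 L2) = wishart_comb k m s (f \o L1) (f \o L2).
Proof.
move=> fD fZ; have f0 : f 0 = 0 by rewrite -(scale0r 0) fZ scale0r.
have fB x y : f (x - y) = f x - f y by rewrite fD -scaleN1r fZ scaleN1r.
have fsum n (h : 'I_n -> V) : f (\sum_i h i) = \sum_i f (h i) by exact: (big_morph f fD f0).
rewrite /wishart_comb !fD fZ !fsum; congr (_ + _ + _);
  by apply: eq_bigr => i _; rewrite fB !fZ.
Qed.

Lemma eq_wishart_comb (V : lmodType R) k m s (L1 L2 L1' L2' : nat -> V) :
  (forall i, (i <= k + m)%N -> L1 i = L1' i) ->
  (forall i, (i < k + m)%N -> L2 i = L2' i) ->
  wishart_comb k m s L1 L2 = wishart_comb k m s L1' L2'.
Proof.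
move=> e1 e2; rewrite /wishart_comb e1 ?leq_addr//; congr (_ + _ + _).
  by apply: eq_bigr => i _; have := ltn_ord i => ik; rewrite e1 ?e2//; lia.
by apply: eq_bigr => j _; have := ltn_ord j => jm; rewrite e1 ?e2//; lia.
Qed.

Lemma wishart_combD (V : lmodType R) k m s (L1 L2 L1' L2' : nat -> V) :
  wishart_comb k m s (fun i => L1 i + L1' i) (fun i => L2 i + L2' i) =
  wishart_comb k m s L1 L2 + wishart_comb k m s L1' L2'.
Proof.
rewrite /wishart_comb.
have E (c d : R) (x y z t : V) : c *: (x + y) - d *: (z + t) =
    (c *: x - d *: z) + (c *: y - d *: t).
  by rewrite !scalerDr opprD addrACA.
under eq_bigr do rewrite E.
under [X in _ + X = _]eq_bigr do rewrite E.
rewrite !big_split/= scalerDr.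
by rewrite !addrA [LHS](ACl (1*2*5*7*8*3*4*6*9*10)).
Qed.

Lemma is_derive_ord_sum n (h : 'I_n -> R -> R) (dh : 'I_n -> R) (t : R) :
  (forall i : 'I_n, is_derive t 1 (h i) (dh i)) ->
  is_derive t 1 (fun t => \sum_i h i t) (\sum_i dh i).
Proof.
move=> H; have := is_derive_sum H.
by congr (is_derive _ _ _ _); apply/funext => u; rewrite fct_sumE.
Qed.

Lemma is_derive_wishart_comb k m s (L1 L2 : nat -> R -> R) (d1 d2 : nat -> R) (t : R) :
  (forall i, (i <= k + m)%N -> is_derive t 1 (L1 i) (d1 i)) ->
  (forall i, (i < k + m)%N -> is_derive t 1 (L2 i) (d2 i)) ->
  is_derive t 1 (fun t => wishart_comb k m s (fun i => L1 i t : R^o) (fun i => L2 i t))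
    (wishart_comb k m s (d1 : nat -> R^o) d2).
Proof.
move=> D1 D2; apply: is_deriveD; first apply: is_deriveD.
- apply: is_derive_ord_sum => i; apply: is_deriveB.
    by apply: (@is_deriveZ _ _ _ (L2 i)); apply: D2; have := ltn_ord i; lia.
  by apply: (@is_deriveZ _ _ _ (L1 i.+1)); apply: D1; have := ltn_ord i; lia.
- by apply: (@is_deriveZ _ _ _ (L1 k)); apply: D1; rewrite leq_addr.
- apply: is_derive_ord_sum => i; apply: is_deriveB.
    by apply: (@is_deriveZ _ _ _ (L2 (k + i)%N)); apply: D2; have := ltn_ord i; lia.
  by apply: (@is_deriveZ _ _ _ (L1 (k + i)%N)); apply: D1; have := ltn_ord i; lia.
Qed.

Lemma back_logE m s (al be : nat -> R) :
  back_log m s al be =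
  - \sum_(j < m) ((s j.+1 + 3 / 2) * ln (al j * al j.+1 - be j ^+ 2) -
                  (s j.+1 + 1) * ln (al j)).
Proof.
elim: m s al be => [|m IH] s al be; first by rewrite big_ord0 oppr0.
rewrite big_ord_recl/= IH opprD opprB; congr (_ + _).
Qed.

Lemma band_logE k m s (al be : nat -> R) :
  band_log k m s al be =
  - wishart_comb k m s (fun i => ln (al i) : R^o)
      (fun i => ln (al i * al i.+1 - be i ^+ 2)).
Proof.
elim: k s al be => [|k IH] s al be.
  by rewrite /= back_logE /wishart_comb big_ord0 add0r opprD.
rewrite /= IH /wishart_comb [in RHS]big_ord_recl/= -!(addrA (_ *: _ - _)).
by rewrite [RHS]opprD opprB; congr (_ + _).
Qed.

End combination.

(** * Derivatives of the logarithm of the normalising integral *)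

Section tilting.
Context {R : realType}.
Implicit Types (s al be ua ub : nat -> R) (k m N : nat).

(** The coordinates of x - t u. *)
Definition tilt al ua (t : R) : nat -> R := fun i => al i - t * ua i.

Definition edge_minor al be : nat -> R := fun i => al i * al i.+1 - be i ^+ 2.

(** Minus the derivative at t = 0 of the edge minor of x - t u. *)
Definition edge_cross al be ua ub : nat -> R :=
  fun i => ua i * al i.+1 + al i * ua i.+1 - 2 * be i * ub i.

Lemma tilt0 al ua : tilt al ua 0 = al.
Proof. by apply/funext => i; rewrite /tilt mul0r subr0. Qed.

Lemma is_derive_tilt al ua (i : nat) (t : R) :
  is_derive t 1 (fun t => tilt al ua t i) (- ua i).
Proof.
rewrite -[- ua i]add0r; apply: is_deriveB; exact: is_derive_mulr.
Qed.

Lemma is_derive_edge_minor al be ua ub (i : nat) (t : R) :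
  is_derive t 1 (fun t => edge_minor (tilt al ua t) (tilt be ub t) i)
    (- edge_cross (tilt al ua t) (tilt be ub t) ua ub i).
Proof.
have Da := is_derive_tilt al ua i t; have Da1 := is_derive_tilt al ua i.+1 t.
have Db := is_derive_tilt be ub i t.
have := is_deriveB (is_deriveM Da Da1) (is_deriveM Db Db).
rewrite (_ : _ - _ = fun t => edge_minor (tilt al ua t) (tilt be ub t) i); last first.
  by apply/funext => t'; rewrite /edge_minor expr2.
move/is_derive_eq; apply.
by rewrite /edge_cross /GRing.scale/=; ring.
Qed.

Lemma is_derive_edge_cross al be ua ub (i : nat) (t : R) :
  is_derive t 1 (fun t => edge_cross (tilt al ua t) (tilt be ub t) ua ub i)
    (- (2 * (ua i * ua i.+1 - ub i ^+ 2))).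
Proof.
have Da := is_derive_tilt al ua i t; have Da1 := is_derive_tilt al ua i.+1 t.
have Db := is_derive_tilt be ub i t.
have Ca := is_derive_cst (ua i) t 1.
have Ca1 := is_derive_cst (ua i.+1) t 1.
have Cb := is_derive_cst (ub i) t 1.
have C2 := is_derive_cst (2 : R) t 1.
have := is_deriveB (is_deriveD (is_deriveM Ca Da1) (is_deriveM Da Ca1))
  (is_deriveM (is_deriveM C2 Db) Cb).
move/is_derive_eq; apply.
by rewrite /GRing.scale/=; ring.
Qed.

Lemma is_derive_gt0_near (f : R -> R) (t df : R) :
  is_derive t 1 f df -> 0 < f t -> \forall t' \near t, 0 < f t'.
Proof.
move=> [dft _] ft0.
have /differentiable_continuous := (derivable1_diffP _ _).1 dft.
by move=> /cvgr_gt; apply.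
Qed.

(** Q_G is open: only finitely many strict inequalities are involved. *)
Lemma cliques_pos_near N al be ua ub : cliques_pos N al be ->
  \forall t \near (0 : R), cliques_pos N (tilt al ua t) (tilt be ub t).
Proof.
elim: N al be ua ub => [|N IH] al be ua ub /andP[a0].
  move=> _; have := is_derive_gt0_near (is_derive_tilt al ua 0 0).
  rewrite tilt0 => /(_ a0); apply: filterS => t t0; by rewrite /= t0.
move=> /andP[d0 /(IH _ _ (shift ua) (shift ub)) H].
have := is_derive_gt0_near (is_derive_tilt al ua 0 0).
rewrite tilt0 => /(_ a0) Ha.
have := is_derive_gt0_near (is_derive_edge_minor al be ua ub 0 0).
rewrite !tilt0 => /(_ d0) Hd.
near=> t; rewrite /=; apply/and3P; split; last by near: t.
- by near: t.
- by near: t.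
Unshelve. all: by end_near. Qed.

Lemma cliques_pos_tilt N al be ua ub : cliques_pos N al be ->
  exists2 dl : R, 0 < dl &
    forall t : R, `|t| < dl -> cliques_pos N (tilt al ua t) (tilt be ub t).
Proof.
move=> /cliques_pos_near -/(_ ua ub) /nbhs_ballP[dl /= dl0 H]; exists dl => // t tdl.
by apply: H; rewrite /ball/= sub0r normrN.
Qed.

Lemma cliques_pos_diag N al be i : cliques_pos N al be -> (i <= N)%N -> 0 < al i.
Proof.
elim: N al be i => [|N IH] al be [|i] /andP[a0 //].
by move=> /andP[_ /IH H] iN; exact: H.
Qed.

Lemma cliques_pos_edge N al be i : cliques_pos N al be -> (i < N)%N ->
  0 < edge_minor al be i.
Proof.
elim: N al be i => [//|N IH] al be [|i] /andP[_ /andP[d0 //]].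
by move=> /IH H iN; exact: H.
Qed.

Definition band_mean k m s al be ua ub : R :=
  wishart_comb k m s (fun i => ua i / al i : R^o)
    (fun i => edge_cross al be ua ub i / edge_minor al be i).

Definition band_var k m s al be ua ub : R :=
  wishart_comb k m s (fun i => (ua i / al i) ^+ 2 : R^o)
    (fun i => (edge_cross al be ua ub i / edge_minor al be i) ^+ 2 -
              2 * (ua i * ua i.+1 - ub i ^+ 2) / edge_minor al be i).

Lemma is_derive_band_log k m s al be ua ub (t : R) :
  cliques_pos (k + m) (tilt al ua t) (tilt be ub t) ->
  is_derive t 1 (fun t => band_log k m s (tilt al ua t) (tilt be ub t))
    (band_mean k m s (tilt al ua t) (tilt be ub t) ua ub).
Proof.
move=> gt.
have -> : (fun t => band_log k m s (tilt al ua t) (tilt be ub t)) = fun t =>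
    wishart_comb k m s (fun i => - ln (tilt al ua t i) : R^o)
      (fun i => - ln (edge_minor (tilt al ua t) (tilt be ub t) i)).
  apply/funext => t'; rewrite band_logE.
  by rewrite (wishart_comb_linear (f := -%R : R^o -> R^o))//
    => [x y|c x]; [exact: opprD|exact/esym/scalerN].
apply: (@is_derive_wishart_comb _ _ _ _ (fun i t => - ln (tilt al ua t i))
  (fun i t => - ln (edge_minor (tilt al ua t) (tilt be ub t) i))) => i ik.
  have := is_deriveN (@is_derive1_comp _ (@ln R) (fun t => tilt al ua t i) t _ _
    (is_derive1_ln (cliques_pos_diag gt ik)) (is_derive_tilt al ua i t)).
  by move/is_derive_eq; apply; rewrite mulrN opprK mulrC.
have := is_deriveN (@is_derive1_comp _ (@ln R)
  (fun t => edge_minor (tilt al ua t) (tilt be ub t) i) t _ _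
  (is_derive1_ln (cliques_pos_edge gt ik)) (is_derive_edge_minor al be ua ub i t)).
by move/is_derive_eq; apply; rewrite mulrN opprK mulrC.
Qed.

Lemma is_derive_band_mean k m s al be ua ub (t : R) :
  cliques_pos (k + m) (tilt al ua t) (tilt be ub t) ->
  is_derive t 1 (fun t => band_mean k m s (tilt al ua t) (tilt be ub t) ua ub)
    (band_var k m s (tilt al ua t) (tilt be ub t) ua ub).
Proof.
move=> gt.
apply: (@is_derive_wishart_comb _ _ _ _ (fun i t => ua i / tilt al ua t i)
  (fun i t => edge_cross (tilt al ua t) (tilt be ub t) ua ub i /
     edge_minor (tilt al ua t) (tilt be ub t) i)) => i ik.
  have /lt0r_neq0 a0 := cliques_pos_diag gt ik.
  have := is_deriveM (is_derive_cst (ua i) t 1) (@realfun.is_deriveV _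
    (fun t => tilt al ua t i) t _ _ a0 (is_derive_tilt al ua i t)).
  by move/is_derive_eq; apply; rewrite /GRing.scale/=; field.
have /lt0r_neq0 d0 := cliques_pos_edge gt ik.
have := is_deriveM (is_derive_edge_cross al be ua ub i t)
  (@realfun.is_deriveV _ (fun t => edge_minor (tilt al ua t) (tilt be ub t) i) t _ _
    d0 (is_derive_edge_minor al be ua ub i t)).
by move/is_derive_eq; apply; rewrite /GRing.scale/=; field.
Qed.

End tilting.

(** * The density on matrices *)

Section matrix_density.
Context {R : realType}.
Local Notation nth0 := (@nth R 0%R).

Lemma measurable_mx_entry n (a b : 'I_n) :
  measurable_fun [set: 'M[R]_n] (fun y : 'M[R]_n => y a b).
Proof.
move=> _ B mB; rewrite setTI.
by apply: sub_gen_smallest; exists a, b, B.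
Qed.

Lemma measurable_mktuple d (T : measurableType d) n (f : T -> n.-tuple R) :
  (forall i, measurable_fun setT (fun x => tnth (f x) i)) -> measurable_fun setT f.
Proof. by move=> mf; apply/measurable_fun_tnthP. Qed.

Lemma measurable_path_coords N :
  measurable_fun setT (fun y : 'M[R]_N.+1 => path_coords y).
Proof.
apply/measurable_fun_pair.
  apply: measurable_mktuple => i; under eq_fun do rewrite tnth_mktuple.
  exact: measurable_mx_entry.
apply: measurable_mktuple => i; under eq_fun do rewrite tnth_mktuple.
exact: measurable_mx_entry.
Qed.

Lemma path_mxK N (p : N.+1.-tuple R * N.-tuple R) : path_coords (path_mx p) = p.
Proof.
case: p => p1 p2; congr (_, _); apply: eq_from_tnth => i; rewrite tnth_mktuple path_mxE.
  by rewrite /band_entry eqxx -tnth_nth.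
by rewrite /band_entry lift0 /= ltn_eqF// eqxx -tnth_nth.
Qed.

(** Z_G is the set of fixed points of [path_mx \o path_coords], hence an intersection
of finitely many level sets. *)
Lemma measurable_ZG N : measurable (@ZG R N.+1).
Proof.
pose S a b := [set y : 'M[R]_N.+1 | path_mx (path_coords y) a b - y a b = 0].
have -> : @ZG R N.+1 = \bigcap_a \bigcap_b S a b.
  apply/seteqP; split=> [y /path_coordsK yE a _ b _|y Sy].
    by rewrite /S/= yE subrr.
  have -> : y = path_mx (path_coords y).
    by apply/matrixP => a b; apply/esym/eqP; rewrite -subr_eq0; apply/eqP/Sy.
  exact: ZG_path_mx.
apply: fin_bigcap_measurable => // a _; apply: fin_bigcap_measurable => // b _.
rewrite /S -[X in measurable X]setTI.
have mf : measurable_fun setT (fun y : 'M[R]_N.+1 => path_mx (path_coords y) a b - y a b).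
  apply: measurable_funB; last exact: measurable_mx_entry.
  apply: (measurableT_comp (measurable_mx_entry a b)).
  exact: (measurableT_comp (measurable_path_mx (n := N.+1)) (@measurable_path_coords N)).
exact: (mf measurableT [set 0] (measurable_set1 0)).
Qed.

Lemma measurable_mx_pairing n (u : 'M[R]_n) : measurable_fun setT (mx_pairing u).
Proof.
rewrite (_ : mx_pairing u = fun y => \sum_c \sum_d y c d * u d c); last first.
  by apply/funext => y; exact: mx_pairing_sum.
apply: measurable_sum => c; apply: measurable_sum => d.
by apply: measurable_funM => //; exact: measurable_mx_entry.
Qed.

Lemma band_pairing_tilt N (al be ua ub a b : nat -> R) (t : R) :
  band_pairing N (tilt al ua t) (tilt be ub t) a b =
  band_pairing N al be a b - t * band_pairing N ua ub a b.
Proof.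
rewrite /band_pairing; move: (band_entry a b) => w.
elim: N al be ua ub w => [|N IH] al be ua ub w /=; first by rewrite /tilt; ring.
have -> := IH (shift al) (shift be) (shift ua) (shift ub) (fun i j => w i.+1 j.+1).
by rewrite /tilt; ring.
Qed.

(** The exponential family property: an exponential weight in <u, y> replaces x by
x - t u. *)
Lemma band_density_tilt k m s (al be ua ub a b : nat -> R) (t : R) :
  expR (t * band_pairing (k + m) ua ub a b) * band_density k m s al be a b =
  band_density k m s (tilt al ua t) (tilt be ub t) a b.
Proof.
rewrite !band_densityE; case: ifP => _; last by rewrite mulr0.
by rewrite mulrA -expRD band_pairing_tilt; congr (expR _ * _); ring.
Qed.

(** As [path_coords] ignores the entries off the path, the factor [\1_ZG] confines the
density to Z_G; the cut-off to positive definite matrices is in [band_density],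
through the signs of the pivots. *)
Definition mx_density k m (s : nat -> R) (q : (k + m).+1.-tuple R * (k + m).-tuple R)
    (y : 'M[R]_((k + m).+1)) : R :=
  band_density k m (shift s) (nth0 q.1) (nth0 q.2)
    (nth0 (path_coords y).1) (nth0 (path_coords y).2) * \1_(@ZG R (k + m).+1) y.

Section wishart_density.
Variables (k m : nat) (s : nat -> R) (q : (k + m).+1.-tuple R * (k + m).-tuple R).
Local Notation N := (k + m)%N.
Local Notation mu := (@ZG_lebesgue R N.+1).
Local Notation x := (path_mx q).

Lemma mx_density_ge0 y : 0 <= mx_density s q y.
Proof. by rewrite mulr_ge0// ?band_density_ge0// indicE. Qed.

Lemma measurable_mx_density : measurable_fun setT (mx_density s q).
Proof.
apply: measurable_funM; last by apply: measurable_indic; exact: measurable_ZG.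
exact: (measurableT_comp (@band_measurable_density R k m (shift s) (nth0 q.1) (nth0 q.2))
  (@measurable_path_coords N)).
Qed.

Lemma mx_density_path_mx p : mx_density s q (path_mx p) =
  band_density k m (shift s) (nth0 q.1) (nth0 q.2) (nth0 p.1) (nth0 p.2).
Proof.
by rewrite /mx_density path_mxK indicE mem_set ?mulr1//; exact: ZG_path_mx.
Qed.

Lemma mx_densityE y : mx_density s q y =
  if y \in @PG R N.+1 then expR (- mx_pairing x y) * gpower k.+1 s y else 0.
Proof.
have [zy|zy] := pselect (ZG y); last first.
  rewrite memNset; last by move=> [].
  by rewrite /mx_density indicE memNset// mulr0.
rewrite -(path_coordsK zy); move: (path_coords y) => p.
rewrite mx_density_path_mx band_densityE mx_pairing_path_mx gpower_path_mx.
case: ifP => pp.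
  by rewrite mem_set//; apply/PG_path_mx/pivots_pos_posdef.
rewrite memNset// => /PG_path_mx /pivots_pos_posdef; by rewrite pp.
Qed.

Lemma integral_wishart_set A :
  (\int[mu]_(y in A `&` @PG R N.+1) (expR (- mx_pairing x y) * gpower k.+1 s y)%:E =
   \int[mu]_(y in A) (mx_density s q y)%:E)%E.
Proof.
rewrite integral_mkcond [RHS]integral_mkcond; apply: eq_integral => y _.
rewrite /patch in_setI mx_densityE.
by case: (y \in A) => //=; case: ifP.
Qed.

(** Z(x - t u), where u is [path_mx r]. *)
Lemma integral_mx_density (r : N.+1.-tuple R * N.-tuple R) (t : R) :
  (forall i, (i <= N)%N -> i != k -> - (3 / 2) < shift s i) -> -1 < shift s k ->
  cliques_pos N (tilt (nth0 q.1) (nth0 r.1) t) (tilt (nth0 q.2) (nth0 r.2) t) ->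
  (\int[mu]_y (expR (t * mx_pairing (path_mx r) y) * mx_density s q y)%:E =
   (band_const k m (shift s) * expR (band_log k m (shift s)
      (tilt (nth0 q.1) (nth0 r.1) t) (tilt (nth0 q.2) (nth0 r.2) t)))%:E)%E.
Proof.
move=> hs hk gb; rewrite -band_integral_density// /band_integral.
rewrite ge0_integral_pushforward//=; last 2 first.
- apply/measurable_EFinP/measurable_funM; last exact: measurable_mx_density.
  apply: measurableT_comp => //; apply: measurable_funM => //.
  exact: measurable_mx_pairing.
- by move=> y _; rewrite lee_fin mulr_ge0// ?expR_ge0// mx_density_ge0.
apply: eq_integral => p _ /=; congr EFin.
  by rewrite mx_density_path_mx mx_pairing_path_mx band_density_tilt.
exact: measurable_path_mx.
Qed.

End wishart_density.
End matrix_density.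

(** * The Wishart law and its moments *)

Section density_law.
Local Open Scope ereal_scope.
Context d (T : measurableType d) {R : realType}.
Variables (mu : {measure set T -> \bar R}) (g : T -> R).
Hypotheses (mg : measurable_fun [set: T] g) (g0 : forall x, (0 <= g x)%R)
  (g1 : \int[mu]_x (g x)%:E = 1).

Let law (A : set T) : \bar R := \int[mu]_(x in A) (g x)%:E.

Let law0 : law set0 = 0. Proof. exact: integral_set0. Qed.

Let law_ge0 A : 0 <= law A.
Proof. by apply: integral_ge0 => x _; rewrite lee_fin. Qed.

Let integrable_g : mu.-integrable setT (EFin \o g).
Proof.
apply/integrableP; split; first exact/measurable_EFinP.
under eq_integral do rewrite /= ger0_norm//.
by rewrite g1 ltry.
Qed.

Let law_sigma_additive : semi_sigma_additive law.
Proof.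
move=> A mA tA mUA; rewrite /law integral_bigcup//; last first.
  exact: (integrableS _ _ (subsetT _)).
by apply: is_cvg_ereal_nneg_natsum_cond => n _ _; exact: law_ge0.
Qed.

HB.instance Definition _ := isMeasure.Build _ _ _ law law0 law_ge0 law_sigma_additive.

HB.instance Definition _ := @Measure_isProbability.Build _ _ R law g1.

Lemma density_law : exists P : probability T R,
  forall A, measurable A -> P A = \int[mu]_(x in A) (g x)%:E.
Proof. by exists law. Qed.

End density_law.

Section wishart_law.
Context {R : realType}.
Local Notation nth0 := (@nth R 0%R).
Variables (k m : nat) (s : nat -> R) (q : (k + m).+1.-tuple R * (k + m).-tuple R).
Local Notation N := (k + m)%N.
Local Notation mu := (@ZG_lebesgue R N.+1).
Local Notation x := (path_mx q).
Local Notation al := (nth0 q.1).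
Local Notation be := (nth0 q.2).
Hypotheses (hs : forall i, (i <= N)%N -> i != k -> - (3 / 2) < shift s i)
  (hk : -1 < shift s k) (gb : cliques_pos N al be).

Definition normalisation : R :=
  band_const k m (shift s) * expR (band_log k m (shift s) al be).

Lemma normalisation_gt0 : 0 < normalisation.
Proof. by rewrite mulr_gt0 ?expR_gt0// band_const_gt0. Qed.

Definition wishart_density (y : 'M[R]_N.+1) : R := normalisation^-1 * mx_density s q y.

Lemma wishart_density_ge0 y : 0 <= wishart_density y.
Proof. by rewrite mulr_ge0 ?mx_density_ge0// invr_ge0 ltW// normalisation_gt0. Qed.

Lemma measurable_wishart_density : measurable_fun setT wishart_density.
Proof. by apply: measurable_funM => //; exact: measurable_mx_density. Qed.

Lemma integral_wishart_density A : measurable A ->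
  (\int[mu]_(y in A) (wishart_density y)%:E =
   (normalisation^-1)%:E * \int[mu]_(y in A) (mx_density s q y)%:E)%E.
Proof.
move=> mA; under eq_integral do rewrite EFinM.
rewrite ge0_integralZl//.
- by apply/measurable_EFinP/measurable_funTS; exact: measurable_mx_density.
- by move=> y _; rewrite lee_fin mx_density_ge0.
- by rewrite lee_fin invr_ge0 ltW// normalisation_gt0.
Qed.

Lemma integral_exp_wishart_density (r : N.+1.-tuple R * N.-tuple R) (t : R) :
  cliques_pos N (tilt al (nth0 r.1) t) (tilt be (nth0 r.2) t) ->
  (\int[mu]_y ((expR (t * mx_pairing (path_mx r) y))%:E * (wishart_density y)%:E) =
   (expR (band_log k m (shift s) (tilt al (nth0 r.1) t) (tilt be (nth0 r.2) t) -
          band_log k m (shift s) al be))%:E)%E.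
Proof.
move=> gt.
transitivity (\int[mu]_y ((normalisation^-1)%:E *
    (expR (t * mx_pairing (path_mx r) y) * mx_density s q y)%:E))%E.
  by apply: eq_integral => y _; rewrite -!EFinM /wishart_density mulrCA.
rewrite ge0_integralZl//.
- rewrite integral_mx_density// -EFinM /normalisation; congr EFin.
  have c0 : band_const k m (shift s) != 0 by rewrite gt_eqF// band_const_gt0.
  by rewrite expRD expRN invfM mulrACA mulVf// mul1r mulrC.
- apply/measurable_EFinP/measurable_funM; last exact: measurable_mx_density.
  apply: measurableT_comp => //; apply: measurable_funM => //.
  exact: measurable_mx_pairing.
- by move=> y _; rewrite lee_fin mulr_ge0// ?expR_ge0// mx_density_ge0.
- by rewrite lee_fin invr_ge0 ltW// normalisation_gt0.
Qed.

Lemma integral_wishart_density1 : (\int[mu]_y (wishart_density y)%:E = 1)%E.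
Proof.
have := @integral_exp_wishart_density q 0; rewrite !tilt0 subrr expR0 => /(_ gb) <-.
by apply: eq_integral => y _; rewrite mul0r expR0 mul1e.
Qed.

Lemma integral_mx_density1 : (\int[mu]_y (mx_density s q y)%:E = normalisation%:E)%E.
Proof.
have := @integral_mx_density R k m s q q 0 hs hk; rewrite !tilt0 => /(_ gb) <-.
by apply: eq_integral => y _; rewrite mul0r expR0 mul1r.
Qed.

Lemma wishart_exists : exists P : probability 'M[R]_N.+1 R, is_wishart k.+1 s x P.
Proof.
have [P PE] := density_law measurable_wishart_density wishart_density_ge0
  integral_wishart_density1.
exists P, normalisation^-1 => A mA.
by rewrite PE// integral_wishart_density// integral_wishart_set.
Qed.

Section moments.
Variable P : probability 'M[R]_N.+1 R.
Hypothesis wP : is_wishart k.+1 s x P.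

(** The constant in [is_wishart] is determined by the total mass. *)
Lemma wishart_density_law A : measurable A ->
  P A = (\int[mu]_(y in A) (wishart_density y)%:E)%E.
Proof.
have [c PE] := wP; move=> mA; rewrite integral_wishart_density// PE// integral_wishart_set.
congr (_%:E * _)%E.
have := PE _ measurableT; rewrite integral_wishart_set integral_mx_density1.
rewrite [LHS]probability_setT -EFinM => /eqP; rewrite eqe => /eqP c1.
by rewrite -[LHS](mulfK (lt0r_neq0 normalisation_gt0)) -c1 mul1r.
Qed.

Lemma wishart_ZG : {ae P, forall y, ZG y}.
Proof.
exists (~` @ZG R N.+1); split => //.
  by apply: measurableC; exact: measurable_ZG.
have mC : measurable (~` @ZG R N.+1) by apply: measurableC; exact: measurable_ZG.
rewrite wishart_density_law//; apply: integral0_eq => y /= zy.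
by rewrite /wishart_density /mx_density indicE memNset// !mulr0.
Qed.

Section linear_form.
Variable r : N.+1.-tuple R * N.-tuple R.
Local Notation u := (path_mx r).
Local Notation ua := (nth0 r.1).
Local Notation ub := (nth0 r.2).

Lemma wishart_mgf (t : R) : cliques_pos N (tilt al ua t) (tilt be ub t) ->
  (\int[P]_y (expR (t * mx_pairing u y))%:E =
   (expR (band_log k m (shift s) (tilt al ua t) (tilt be ub t) -
          band_log k m (shift s) al be))%:E)%E.
Proof.
move=> gt; rewrite -integral_exp_wishart_density//.
apply: (ge0_integral_density measurable_wishart_density wishart_density_ge0
  wishart_density_law).
  apply/measurable_EFinP; apply: measurableT_comp => //.
  by apply: measurable_funM => //; exact: measurable_mx_pairing.
by move=> y; rewrite lee_fin expR_ge0.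
Qed.

(** Here psi t = log Z(x - t u) - log Z(x). *)
Lemma wishart_moments :
  [/\ P.-integrable setT (EFin \o mx_pairing u),
      P.-integrable setT (EFin \o (fun y => mx_pairing u y ^+ 2)),
      ('E_P[mx_pairing u] = (band_mean k m (shift s) al be ua ub)%:E)%E &
      ('E_P[fun y => (mx_pairing u y ^+ 2)%R] =
       (band_var k m (shift s) al be ua ub +
        band_mean k m (shift s) al be ua ub ^+ 2)%:E)%E].
Proof.
have [dl dl0 gt] := cliques_pos_tilt ua ub gb.
pose BL t := band_log k m (shift s) (tilt al ua t) (tilt be ub t).
pose psi t := BL t - band_log k m (shift s) al be.
pose psi1 t := band_mean k m (shift s) (tilt al ua t) (tilt be ub t) ua ub.
have mgf t : `|t| < dl -> (\int[P]_y (expR (t * mx_pairing u y))%:E = (expR (psi t))%:E)%E.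
  by move=> tdl; apply: wishart_mgf; exact: gt.
have dpsi (t : R) : `|t| < dl -> is_derive t 1 psi (psi1 t).
  move=> tdl; rewrite -[psi1 t]subr0; apply: is_deriveB.
  by apply: is_derive_band_log; exact: gt.
have dpsi1 : is_derive (0 : R) 1 psi1 (band_var k m (shift s) al be ua ub).
  have := @is_derive_band_mean R k m (shift s) al be ua ub 0.
  by rewrite !tilt0; apply.
have p10 : psi1 0 = band_mean k m (shift s) al be ua ub by rewrite /psi1 !tilt0.
have mu_ := @measurable_mx_pairing R N.+1 u.
split.
- exact: (mgf_integrable mu_ dl0 mgf).
- exact: (mgf_integrable_sqr mu_ dl0 mgf).
- by rewrite (mgf_expectation mu_ dl0 mgf dpsi) p10.
- by rewrite (mgf_expectation_sqr mu_ dl0 mgf dpsi dpsi1) p10.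
Qed.

End linear_form.
End moments.
End wishart_law.

(** * Mean and covariance *)

Section mean_covariance.
Context {R : realType}.
Local Notation nth0 := (@nth R 0%R).

Lemma wishart_comb_closed (V : lmodType R) (S : V -> Prop) k m (s : nat -> R)
    (L1 L2 : nat -> V) :
  S 0 -> (forall v w, S v -> S w -> S (v + w)) -> (forall c v, S v -> S (c *: v)) ->
  (forall i, (i <= k + m)%N -> S (L1 i)) -> (forall i, (i < k + m)%N -> S (L2 i)) ->
  S (wishart_comb k m s L1 L2).
Proof.
move=> S0 SD SZ S1 S2.
have SB c d v w : S v -> S w -> S (c *: v - d *: w).
  by move=> Sv Sw; rewrite -scaleNr; apply: SD; exact: SZ.
rewrite /wishart_comb; apply: (SD _ _ (SD _ _ _ _)).
- apply: big_ind => // i _; have ik := ltn_ord i.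
  by apply: SB; [apply: S2|apply: S1]; lia.
- by apply: SZ; apply: S1; rewrite leq_addr.
- apply: big_ind => // i _; have im := ltn_ord i.
  by apply: SB; [apply: S2|apply: S1]; lia.
Qed.

Lemma ZG0 n : @ZG R n 0.
Proof. by split=> [|a b _]; rewrite ?trmx0 ?mxE. Qed.

Lemma ZGD n (y z : 'M[R]_n) : ZG y -> ZG z -> ZG (y + z).
Proof.
move=> [yt y0] [zt z0]; split=> [|a b ab]; first by rewrite linearD/= yt zt.
by rewrite mxE y0// z0// addr0.
Qed.

Lemma ZGZ n (c : R) (y : 'M[R]_n) : ZG y -> ZG (c *: y).
Proof.
move=> [yt y0]; split=> [|a b ab]; first by rewrite linearZ/= yt.
by rewrite mxE y0// mulr0.
Qed.

Lemma mx_pairingDl n (u u' y : 'M[R]_n) :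
  mx_pairing (u + u') y = mx_pairing u y + mx_pairing u' y.
Proof. by rewrite /mx_pairing mulmxDr mxtraceD. Qed.

Lemma quadrepD n (A u u' : 'M[R]_n) : quadrep A (u + u') = quadrep A u + quadrep A u'.
Proof.
apply/matrixP => a b; rewrite /quadrep mulmxDr mulmxDl.
move: (A *m u *m A) (A *m u' *m A) => B C.
by rewrite !mxE; case: ifP; rewrite ?addr0.
Qed.

(** On Z_G every entry is a linear form given by an element of Z_G: half the sum of
two elementary matrices for an edge, and 0 off the edges. *)
Lemma entry_pairing n (a b : 'I_n) : exists2 u : 'M[R]_n, ZG u &
  forall y, ZG y -> mx_pairing u y = y a b.
Proof.
have [ab|ab] := boolP (path_edge a b); last first.
  exists 0; first exact: ZG0.
  by move=> y [_ y0]; rewrite /mx_pairing mulmx0 mxtrace0 y0.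
exists (2^-1 *: (delta_mx a b + delta_mx b a)).
  apply: ZGZ; split; first by rewrite linearD/= !trmx_delta addrC.
  move=> c d cd; rewrite !mxE.
  have [/andP[/eqP ca /eqP db]|_] := boolP ((c == a) && (d == b)).
    by move: cd; rewrite ca db ab.
  have [/andP[/eqP cb /eqP da]|_] := boolP ((c == b) && (d == a)); last by rewrite addr0.
  by move: cd ab; rewrite cb da /path_edge andbC => /negbTE ->.
move=> y [yt _].
have delta c d : \tr (y *m delta_mx c d) = y d c.
  by rewrite mxtrace_mulC; exact: mx_pairing_delta.
rewrite /mx_pairing -scalemxAr mxtraceZ mulmxDr mxtraceD !delta.
have -> : y b a = y a b by rewrite -[in LHS]yt mxE.
by field.
Qed.

Variables (k m : nat) (s : nat -> R) (q : (k + m).+1.-tuple R * (k + m).-tuple R).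
Local Notation N := (k + m)%N.
Local Notation x := (path_mx q).
Local Notation al := (nth0 q.1).
Local Notation be := (nth0 q.2).
Hypotheses (hs : forall i, (i <= N)%N -> i != k -> - (3 / 2) < shift s i)
  (hk : -1 < shift s k) (gb : cliques_pos N al be).

Definition wishart_mean : 'M[R]_N.+1 :=
  wishart_comb k m (shift s) (fun i => seg_inv i.+1 i.+1 x) (fun i => seg_inv i.+1 i.+2 x).

Definition wishart_cov (u : 'M[R]_N.+1) : 'M[R]_N.+1 :=
  wishart_comb k m (shift s) (fun i => quadrep (seg_inv i.+1 i.+1 x) u)
    (fun i => quadrep (seg_inv i.+1 i.+2 x) u).

Lemma ZG_wishart_mean : ZG wishart_mean.
Proof.
apply: wishart_comb_closed => [|y z|c y|i iN|i iN].
- exact: ZG0.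
- exact: ZGD.
- exact: ZGZ.
- have a0 := cliques_pos_diag gb iN.
  by split=> [|c d]; [exact: seg_inv1_sym|exact: path_edge_seg_inv1].
- have d0 := cliques_pos_edge gb iN.
  by split=> [|c d]; [exact: seg_inv2_sym|exact: path_edge_seg_inv2].
Qed.

Lemma ZG_wishart_cov u : ZG u -> ZG (wishart_cov u).
Proof.
move=> zu; apply: wishart_comb_closed => [|y z|c y|i iN|i iN].
- exact: ZG0.
- exact: ZGD.
- exact: ZGZ.
- by apply: ZG_quadrep => //; apply: seg_inv1_sym => //; exact: cliques_pos_diag gb iN.
- by apply: ZG_quadrep => //; apply: seg_inv2_sym => //; exact: cliques_pos_edge gb iN.
Qed.

Lemma mx_pairing_wishart_comb (u : 'M[R]_N.+1) (L1 L2 : nat -> 'M[R]_N.+1) :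
  mx_pairing u (wishart_comb k m (shift s) L1 L2) =
  wishart_comb k m (shift s) (mx_pairing u \o L1 : nat -> R^o) (mx_pairing u \o L2).
Proof.
apply: (@wishart_comb_linear _ _ R^o (mx_pairing u)).
- exact: mx_pairingD.
- by move=> c y; exact: mx_pairingZ.
Qed.

Lemma mx_pairing_wishart_mean (r : N.+1.-tuple R * N.-tuple R) :
  mx_pairing (path_mx r) wishart_mean =
  band_mean k m (shift s) al be (nth0 r.1) (nth0 r.2).
Proof.
rewrite mx_pairing_wishart_comb; apply: eq_wishart_comb => i iN.
  by apply: mx_pairing_seg_inv1 => //; exact: cliques_pos_diag gb iN.
by apply: mx_pairing_seg_inv2 => //; exact: cliques_pos_edge gb iN.
Qed.

Lemma mx_pairing_wishart_cov (r : N.+1.-tuple R * N.-tuple R) :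
  mx_pairing (path_mx r) (wishart_cov (path_mx r)) =
  band_var k m (shift s) al be (nth0 r.1) (nth0 r.2).
Proof.
rewrite mx_pairing_wishart_comb; apply: eq_wishart_comb => i iN.
  by apply: mx_pairing_quadrep_seg_inv1 => //; exact: cliques_pos_diag gb iN.
by apply: mx_pairing_quadrep_seg_inv2 => //; exact: cliques_pos_edge gb iN.
Qed.

(** With [wishart_covD] this makes <u', v u> a symmetric bilinear form, so that it is
determined by its values on the diagonal. *)
Lemma wishart_cov_sym u u' : ZG u -> ZG u' ->
  mx_pairing u (wishart_cov u') = mx_pairing u' (wishart_cov u).
Proof.
move=> zu zu'; rewrite !mx_pairing_wishart_comb; apply: eq_wishart_comb => i iN;
  exact: quadrep_sym.
Qed.

Lemma wishart_covD u u' : wishart_cov (u + u') = wishart_cov u + wishart_cov u'.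
Proof.
rewrite -wishart_combD; apply: eq_wishart_comb => i iN; exact: quadrepD.
Qed.

Variable P : probability 'M[R]_N.+1 R.
Hypothesis wP : is_wishart k.+1 s x P.

Lemma wishart_form_moments u : ZG u ->
  [/\ P.-integrable setT (EFin \o mx_pairing u),
      P.-integrable setT (EFin \o (fun y => mx_pairing u y ^+ 2)),
      ('E_P[mx_pairing u] = (mx_pairing u wishart_mean)%:E)%E &
      ('E_P[fun y => (mx_pairing u y ^+ 2)%R] =
       (mx_pairing u (wishart_cov u) + mx_pairing u wishart_mean ^+ 2)%:E)%E].
Proof.
move=> /path_coordsK <-; rewrite mx_pairing_wishart_mean mx_pairing_wishart_cov.
exact: wishart_moments.
Qed.

(** An entry coincides with a linear form on Z_G, hence almost surely. *)
Lemma wishart_is_mean : is_mean P wishart_mean.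
Proof.
move=> a b; have [u zu uE] := entry_pairing a b.
have [_ _ EX _] := wishart_form_moments zu.
rewrite -uE; last exact: ZG_wishart_mean.
rewrite -EX unlock; apply: ae_eq_integral => //.
- apply/measurable_EFinP; exact: measurable_mx_entry.
- apply/measurable_EFinP; exact: measurable_mx_pairing.
- apply: filterS (wishart_ZG hs hk gb wP) => y zy _; by rewrite /= uE.
Qed.

(** Polarisation: XY = ((X + Y)^2 - X^2 - Y^2) / 2, where X + Y is the linear form of
u + u'. *)
Lemma wishart_is_covariance : is_covariance P wishart_cov.
Proof.
split; first exact: ZG_wishart_cov.
move=> u u' zu zu'.
have [i1 i2 E1 E2] := wishart_form_moments zu.
have [i1' i2' E1' E2'] := wishart_form_moments zu'.
have [_ j2 _ F2] := wishart_form_moments (ZGD zu zu').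
pose X := mx_pairing u; pose Y := mx_pairing u'.
have XYE : EFin \o (X * Y) = (fun y => 2^-1%:E *
    (((mx_pairing (u + u') y) ^+ 2)%:E - (X y ^+ 2)%:E - (Y y ^+ 2)%:E))%E.
  apply/funext => y; rewrite -!EFinB -EFinM /= mx_pairingDl -/X -/Y.
  by congr EFin; rewrite -[LHS]/(X y * Y y); field.
have iXY : P.-integrable setT (EFin \o (X * Y)).
  by rewrite XYE; apply: integrableZl => //; do 2 (apply: integrableB => //).
rewrite covarianceE; do ?exact/Lfun1_integrable.
have -> : ('E_P[X * Y] = 2^-1%:E * ('E_P[fun y => (mx_pairing (u + u') y ^+ 2)%R]
   - 'E_P[fun y => (X y ^+ 2)%R] - 'E_P[fun y => (Y y ^+ 2)%R]))%E.
  rewrite unlock -integralB// -integralB//; last exact: integrableB.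
  rewrite -integralZl//; last by do 2 (apply: integrableB => //).
  by apply: eq_integral => y _; exact: (congr1 (fun f => f y) XYE).
rewrite F2 E2 E2' E1 E1' -!EFinB; congr EFin.
rewrite wishart_covD !mx_pairingDl !(mx_pairingD _ (wishart_cov u)).
rewrite (wishart_cov_sym zu zu').
by field.
Qed.

End mean_covariance.

(* s is indexed from 1 to n.  The values s_0 and s_(n+1) occur only in the
   coefficient of (x_MM^-1)^0, for M = 1 and for M = n, and the value making the
   formulas true there is -1, not 0: since gpower M s is homogeneous of degree
   s_1 + ... + s_n on the (2n-1)-dimensional space Z_G, the mean m(x) satisfies
   <x, m(x)> = s_1 + ... + s_n + 2n - 1. *)
Theorem theorem7 (R : realType) (n M : nat) (s : nat -> R) (x : 'M[R]_n)
    (hM : (1 <= M <= n)%N)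
    (hs : forall i : nat, (1 <= i <= n)%N -> i <> M -> - (3 / 2) < s i)
    (hsM : -1 < s M)
    (hs0 : s 0%N = -1) (hsn : s n.+1 = -1)
    (hx : QG x) :
  (exists P : probability 'M[R]_n R, is_wishart M s x P) /\
  forall P : probability 'M[R]_n R, is_wishart M s x P ->
    is_mean P
      (\sum_(1 <= i < M) (s i + 3 / 2) *: seg_inv i i.+1 x
       + \sum_(M.+1 <= i < n.+1) (s i + 3 / 2) *: seg_inv i.-1 i x
       - \sum_(2 <= i < M) (s i.-1 + 1) *: seg_inv i i x
       - (s M.-1 - s M + s M.+1 + 1) *: seg_inv M M x
       - \sum_(M.+1 <= i < n) (s i.+1 + 1) *: seg_inv i i x)
    /\
    is_covariance P (fun u : 'M[R]_n =>
      \sum_(1 <= i < M) (s i + 3 / 2) *: quadrep (seg_inv i i.+1 x) u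
      + \sum_(M.+1 <= i < n.+1) (s i + 3 / 2) *: quadrep (seg_inv i.-1 i x) u
      - \sum_(2 <= i < M) (s i.-1 + 1) *: quadrep (seg_inv i i x) u
      - (s M.-1 - s M + s M.+1 + 1) *: quadrep (seg_inv M M x) u
      - \sum_(M.+1 <= i < n) (s i.+1 + 1) *: quadrep (seg_inv i i x) u).
Proof.
case: M hM hs hsM => [//|k] /andP[_ kn] hs hsM.
(* m is the number of vertices on the right of M. *)
have [m nE] : exists m, n = (k + m).+1 by exists (n - k.+1)%N; lia.
subst n; have /path_coordsK xE := hx.1.
move: (path_coords x) xE => q xE; subst x.
have gb := QG_cliques_pos hx.
have hs' i : (i <= k + m)%N -> i != k -> - (3 / 2) < shift s i.
  by move=> iN ik; apply: hs; [lia|move/eqP: ik; lia].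
split; first exact: wishart_exists.
move=> P wP; split.
  rewrite [X in is_mean P X](_ : _ = wishart_mean s q); first exact: wishart_is_mean.
  exact: (wishart_combE (fun i j => seg_inv i j (path_mx q)) hs0 hsn).
rewrite [X in is_covariance P X](_ : _ = wishart_cov s q).
  exact: wishart_is_covariance.
apply/funext => u.
exact: (wishart_combE (fun i j => quadrep (seg_inv i j (path_mx q)) u) hs0 hsn).
Qed.
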